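(* Let $X$ be a finite 2-dimensional simplicial complex with vertex set $S$, and let $\sigma,\tau$ be complete ideal hyperbolic metrics on $X\backslash S$. Then there exists a map $H\in\mathcal{D}$. That is, there is a simplicial map $H:(X\backslash S,\sigma)\to(X\backslash S,\tau)$ with finite energy such that $H\vert_T$ is a diffeomorphism for each face $T$ of $X$.
   Context: Complexes. A finite 2-dimensional simplicial complex $X$ is a path connected quotient space $\pi:\coprod_{T\in\mathcal{C}}T\to X$, where $\mathcal{C}$ is a finite set of topological triangles (closed discs with three distinguished boundary points called vertices; the edges are the closed boundary segments between two vertices not containing the third), and the quotient identifies $x\in A$ with $f(x)\in B$ for all gluing maps $f:A\to B$ in a set $\mathcal{F}$. Here $\mathcal{F}$ consists of homeomorphisms between distinct edges of (possibly identical) triangles of $\mathcal{C}$, together with the identity of each edge; there is at most one map $A\to B$ in $\mathcal{F}$ for given edges $A,B$, and $\mathcal{F}$ is closed under inverses and compositions. Images under $\pi$ of triangles, edges and vertices are called faces, edges and vertices of $X$. Any number of faces may meet along an edge. Each edge of $X$ is oriented and gluing maps preserve orientation. $S$ denotes the set of vertices, and faces and edges of $X\backslash S$ are understood with vertices removed. Metrics. $\mathbb{H}^2=\{z=x+iy\in\mathbb{C}: y>0\}$ with $ds^2=(dx^2+dy^2)/y^2$; $\tilde T$ is the ideal hyperbolic triangle with ideal vertices $0,1,\infty$. An ideal hyperbolic metric on $X\backslash S$ consists of a diffeomorphism $\phi:T\backslash S\to\tilde T$ for each $T\in\mathcal{C}$, made an isometry by giving $T\backslash S$ the metric $\phi^*ds^2$,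 such that all gluing maps are (orientation preserving) isometries between edges; it induces a length metric on $X\backslash S$, and is called complete if this metric is complete. Maps. A map $u:(X\backslash S,\sigma)\to(X\backslash S,\tau)$ is simplicial if $u$ maps $T$ to $T$ for each face $T$ and $e$ to $e$ for each edge $e$. The energy is $E(u)=\sum_{T\in\mathcal{C}}\int_T|\nabla u|^2d\mu_\sigma$, where $|\nabla u|^2=\sum g^{\alpha\beta}h_{ij}(u)\,\partial_\alpha u^i\,\partial_\beta u^j$, with $g$ and $h$ the Riemannian metrics of $\sigma$ and $\tau$ on $T$. $W^{1,2}$ is the class of simplicial maps $u:(X\backslash S,\sigma)\to(X\backslash S,\tau)$ with $u\vert_T\in W^{1,2}(T,T)$ for every $T\in\mathcal{C}$ (so $E(u)<\infty$), and $\mathcal{D}=\{u\in W^{1,2}: u\vert_T \text{ is a diffeomorphism for all } T\in\mathcal{C}\}$. *)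

(* Defs.v *)
From HB Require Import structures.
From mathcomp Require Import all_boot all_order all_algebra generic_quotient.
From mathcomp Require Import all_classical all_reals all_analysis.
From Stdlib Require Import Relation_Operators.

Set Implicit Arguments.
Unset Strict Implicit.
Unset Printing Implicit Defensive.
Import Order.TTheory GRing.Theory Num.Theory.
Import numFieldNormedType.Exports.

Local Open Scope classical_set_scope.
Local Open Scope ring_scope.

Notation plane R := (R * R)%type.

Section Smooth.
Context {R : realType}.

Fixpoint Ck (k : nat) (U : set (plane R)) (f : plane R -> R) : Prop :=
  (forall p, U p -> {for p, continuous f}) /\
  if k is k'.+1 then
    forall v : plane R, v = (1, 0) \/ v = (0, 1) ->
      (forall p, U p -> derivable f p v) /\ Ck k' U (fun p => 'D_v f p)
  else True.

(* Smoothness on an arbitrary (not necessarily open) subset of the plane is the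
   existence, near every point, of a smooth extension to an open set; this
   gives smoothness up to the boundary for triangles without vertices. *)
Definition smooth_on (A : set (plane R)) (f : plane R -> plane R) : Prop :=
  forall p, A p -> exists (U : set (plane R)) (F : plane R -> plane R),
    [/\ open U, U p,
        forall k, Ck k U (fun q => (F q).1) /\ Ck k U (fun q => (F q).2) &
        forall q, U q -> A q -> F q = f q].

Definition inverse_diffeos (A B : set (plane R)) (f g : plane R -> plane R) :=
  [/\ (forall p, A p -> B (f p)) /\ (forall q, B q -> A (g q)),
      forall p, A p -> g (f p) = p,
      forall q, B q -> f (g q) = q,
      smooth_on A f &
      smooth_on B g].

Definition diffeomorphism (A B : set (plane R)) (f : plane R -> plane R) :=
  exists g, inverse_diffeos A B f g.

End Smooth.

Section Triangle.
Context {R : realType}.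

Definition barycentric (i : 'I_3) (p : plane R) : R :=
  tnth [tuple 1 - p.1 - p.2; p.1; p.2] i.

Definition vertex (i : 'I_3) : plane R :=
  tnth [tuple (0, 0); (1, 0); (0, 1)] i.

Definition vertices : set (plane R) := range vertex.

(* The model closed disc with three distinguished boundary points. *)
Definition triangle : set (plane R) := [set p | forall i, 0 <= barycentric i p].

(* [edge i] is the side that does not contain [vertex i]. *)
Definition edge (i : 'I_3) : set (plane R) :=
  triangle `&` [set p | barycentric i p = 0].

Definition punctured_triangle : set (plane R) := triangle `\` vertices.

Definition open_edge (i : 'I_3) : set (plane R) := edge i `\` vertices.

End Triangle.

(* The gluing maps are indexed by the ordered pairs of triangle sides they
   relate, which expresses that there is at most one map for each such pair;
   only the restriction of [glue A B] to the side [A] is meaningful.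
   [origin A] is the initial endpoint of the oriented side [A]. *)
Record gluing_data (R : realType) := GluingData {
  face : finType;
  glued : rel (face * 'I_3)%type;
  glue : face * 'I_3 -> face * 'I_3 -> plane R -> plane R;
  origin : face * 'I_3 -> 'I_3;
  glued_refl : forall A, glued A A;
  glued_sym : forall A B, glued A B -> glued B A;
  glued_trans : forall A B C, glued A B -> glued B C -> glued A C;
  glue_id : forall A p, edge A.2 p -> glue A A p = p;
  glue_comp : forall A B C p, glued A B -> glued B C -> edge A.2 p ->
    glue B C (glue A B p) = glue A C p;
  glue_edge : forall A B p, glued A B -> edge A.2 p -> edge B.2 (glue A B p);
  glue_continuous : forall A B, glued A B ->
    {within edge A.2, continuous (glue A B)};
  origin_edge : forall A, origin A != A.2;
  glue_origin : forall A B, glued A B ->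
    glue A B (vertex (origin A)) = vertex (origin B)
}.

Section Space.
Context {R : realType} (K : gluing_data R).

Inductive glue_step : face K * plane R -> face K * plane R -> Prop :=
  GlueStep (A B : face K * 'I_3) (p : plane R) :
    glued A B -> edge A.2 p -> glue_step (A.1, p) (B.1, glue A B p).

(* Gluing along different edges may identify vertices, so the transitive
   closure is larger than [glue_step] there. *)
Definition identified : face K * plane R -> face K * plane R -> Prop :=
  clos_refl_sym_trans _ glue_step.

Definition disjoint_triangles : topologicalType :=
  {T : face K & set_type (@triangle R)}.

Definition identified_rel (x y : disjoint_triangles) : bool :=
  `[< identified (projT1 x, set_val (projT2 x))
                 (projT1 y, set_val (projT2 y)) >].

Lemma identified_rel_refl : reflexive identified_rel.
Proof. by move=> x; apply/asboolP; exact: rst_refl. Qed.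

Lemma identified_rel_sym : symmetric identified_rel.
Proof.
by move=> x y; apply/idP/idP => /asboolP h; apply/asboolP; exact: rst_sym.
Qed.

Lemma identified_rel_trans : transitive identified_rel.
Proof.
by move=> y x z /asboolP h1 /asboolP h2; apply/asboolP; exact: rst_trans h1 h2.
Qed.

Canonical identified_equiv :=
  EquivRel identified_rel identified_rel_refl identified_rel_sym
    identified_rel_trans.

Definition quotient_space : topologicalType :=
  quotient_topology {eq_quot identified_equiv}%qT.

End Space.

Definition path_connected (R : realType) (X : topologicalType) : Prop :=
  forall x y : X, exists c : R -> X,
    [/\ {within `[0, 1], continuous c}, c 0 = x & c 1 = y].

Record complex (R : realType) := Complex {
  complex_gluing :> gluing_data R;
  complex_connected : path_connected R (quotient_space complex_gluing)
}.

Section Hyperbolic.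
Context {R : realType}.

(* The closed region of the upper half-plane bounded by the geodesics
   x = 0, x = 1 and |z - 1/2| = 1/2. *)
Definition ideal_triangle : set (plane R) :=
  [set p | [/\ 0 <= p.1, p.1 <= 1, 0 < p.2 &
               (2^-1) ^+ 2 <= (p.1 - 2^-1) ^+ 2 + p.2 ^+ 2]].

(* A C^1 curve on [0, 1] is represented by a C^1 extension of it to the line. *)
Definition C1_curve (D : set (plane R)) (c : R -> plane R) (p q : plane R) :=
  [/\ forall t, derivable (fun s => (c s).1) t 1 /\
                derivable (fun s => (c s).2) t 1,
      continuous (derive1 (fun s => (c s).1)) /\
      continuous (derive1 (fun s => (c s).2)),
      forall t, 0 <= t <= 1 -> D (c t),
      c 0 = p & c 1 = q].

Definition hyp_length (c : R -> plane R) : \bar R :=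
  (\int[lebesgue_measure]_(t in `[0%R, 1%R])
    (Num.sqrt (derive1 (fun s => (c s).1) t ^+ 2
             + derive1 (fun s => (c s).2) t ^+ 2) / (c t).2)%:E)%E.

Definition hyp_length_dist (D : set (plane R)) (p q : plane R) : \bar R :=
  ereal_inf [set hyp_length c | c in [set c | C1_curve D c p q]].

End Hyperbolic.

(* [uniformize T] is the diffeomorphism from T without its vertices to the
   ideal triangle, and [parametrize T] is its inverse. *)
Record ideal_metric (R : realType) (K : complex R) := IdealMetric {
  uniformize : face K -> plane R -> plane R;
  parametrize : face K -> plane R -> plane R;
  uniformize_diffeo : forall T, inverse_diffeos
    punctured_triangle ideal_triangle (uniformize T) (parametrize T);
  glue_isometry : forall (A B : face K * 'I_3) p q, glued A B ->
    open_edge A.2 p -> open_edge A.2 q ->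
    hyp_length_dist (uniformize B.1 @` open_edge B.2)
      (uniformize B.1 (glue A B p)) (uniformize B.1 (glue A B q)) =
    hyp_length_dist (uniformize A.1 @` open_edge A.2)
      (uniformize A.1 p) (uniformize A.1 q)
}.

Section LengthMetric.
Context {R : realType} {K : complex R} (s : ideal_metric K).

(* [path_of_length x y l]: some piecewise C^1 path of length l in the glued
   surface without vertices joins the point represented by x to the point
   represented by y; every smooth piece lies in a single triangle, and passing
   between identified points costs nothing. *)
Inductive path_of_length :
    face K * plane R -> face K * plane R -> \bar R -> Prop :=
| PathGlue x y : punctured_triangle x.2 -> identified x y ->
    path_of_length x y 0%E
| PathArc T p q c : punctured_triangle p -> punctured_triangle q ->
    C1_curve ideal_triangle c (uniformize s T p) (uniformize s T q) ->
    path_of_length (T, p) (T, q) (hyp_length c)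
| PathConcat x y z l m : path_of_length x y l -> path_of_length y z m ->
    path_of_length x z (l + m)%E.

Definition length_dist (x y : face K * plane R) : \bar R :=
  ereal_inf [set l | path_of_length x y l].

(* Completeness of the glued surface without vertices; its points are given by
   their representatives in the triangles, on which [length_dist] is the
   pull-back of the length metric. *)
Definition complete_metric : Prop :=
  forall x : nat -> face K * plane R,
    (forall n, punctured_triangle (x n).2) ->
    (forall e : R, 0 < e -> exists N, forall m n, (N <= m)%N -> (N <= n)%N ->
      (length_dist (x m) (x n) < e%:E)%E) ->
    exists y, punctured_triangle y.2 /\
      (forall e : R, 0 < e -> exists N, forall n, (N <= n)%N ->
        (length_dist (x n) y < e%:E)%E).

End LengthMetric.

(* A simplicial self-map of the glued surface without vertices is a family of
   self-maps of the triangles without vertices that preserves every side and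
   respects the identifications. *)
Definition simplicial (R : realType) (K : complex R)
    (u : face K -> plane R -> plane R) : Prop :=
  [/\ forall T p, punctured_triangle p -> punctured_triangle (u T p),
      forall T i p, open_edge i p -> open_edge i (u T p) &
      forall x y : face K * plane R,
        punctured_triangle x.2 -> punctured_triangle y.2 ->
        identified x y -> identified (x.1, u x.1 x.2) (y.1, u y.1 y.2)].

Section Energy.
Context {R : realType} {K : complex R} (s t : ideal_metric K).

(* The map u restricted to T, read in the isometric coordinates of the two
   metrics. *)
Definition in_coordinates (u : face K -> plane R -> plane R) (T : face K) :
    plane R -> plane R :=
  uniformize t T \o u T \o parametrize s T.

(* |grad w|^2 at p, where g^{ab} = p.2 ^+ 2 * delta_ab and
   h_ij(w) = (w p).2 ^- 2 * delta_ij. *)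
Definition energy_density (w : plane R -> plane R) (p : plane R) : R :=
  p.2 ^+ 2 * (w p).2 ^- 2 *
  (('D_((1, 0) : plane R) (fun q => (w q).1) p) ^+ 2
 + ('D_((0, 1) : plane R) (fun q => (w q).1) p) ^+ 2
 + ('D_((1, 0) : plane R) (fun q => (w q).2) p) ^+ 2
 + ('D_((0, 1) : plane R) (fun q => (w q).2) p) ^+ 2).

(* The hyperbolic area form is p.2 ^- 2 dx dy.  The integral is over the
   interior because the derivatives involve values of w in a neighbourhood;
   the boundary is a null set. *)
Definition energy (u : face K -> plane R -> plane R) : \bar R :=
  (\sum_(T : face K)
    \int[(@lebesgue_measure R \x @lebesgue_measure R)%E]_(p in
        (@ideal_triangle R)^°)
      (energy_density (in_coordinates u T) p * p.2 ^- 2)%:E)%E.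

(* For maps that are diffeomorphisms on every triangle the weak derivatives are
   the classical ones, so membership in W^{1,2} is finiteness of the energy. *)
Definition simplicial_diffeos : set (face K -> plane R -> plane R) :=
  [set u | [/\ simplicial u, (energy u < +oo)%E &
    forall T, diffeomorphism punctured_triangle punctured_triangle (u T)]].

End Energy.

(* Main.v *)
From HB Require Import structures.
From mathcomp Require Import all_boot all_order all_algebra.
From mathcomp Require Import all_classical all_reals all_analysis.
From mathcomp Require Import measurable_realfun ring lra.
From Stdlib Require Import Relation_Operators.
Require Import Defs.

Set Implicit Arguments.
Unset Strict Implicit.
Unset Printing Implicit Defensive.
Import Order.TTheory GRing.Theory Num.Theory.
Import numFieldNormedType.Exports.

Local Open Scope classical_set_scope.
Local Open Scope ring_scope.

(** Each face, with its metric, is an ideal triangle, and the height of a point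
    above a cusp is measured by a Busemann function ([busemann]). On the sides
    that end at the cusp these functions are arc length parameters, so in them a
    gluing isometry is a translation of the line ([shift_exists]). A walk around
    a vertex through the gluings changes heights by the sum of these
    translations. If a closed walk had a nonzero total, repeating it along
    horocycles, which are exponentially short high above the cusp, would give a
    Cauchy sequence that escapes into the cusp ([spiral]). In a complete metric
    this is impossible ([complete_holonomy]): the horocycles around each vertex
    close up, at heights that can be recorded by a function on the corners of
    the faces ([complete_potential]). Let ws and wt be these functions for sigma
    and tau.

    On each side H is prescribed first. Near either end it is the translation by
    wt - ws in the height coordinate of that end, and in between it interpolates
    smoothly. The amount by which the two translations of a side differ is the
    same for all sides that are glued together, so glued sides can be given the
    same map ([side_maps]).

    It remains to extend side maps to a diffeomorphism of the ideal triangle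
    with bounded energy density ([triangle_extension]). With a cusp at infinity,
    the map (x, y) |-> (x, exp (mu (x, ln y))), where mu is increasing in its
    second variable and interpolates between two functions of ln y, moves the
    two vertical sides as prescribed and fixes the third side. Its density is
    bounded because the two functions agree near the cusp. Three such maps, one
    for each cusp ([cusp_map]), have the required composition. As an ideal
    triangle has finite area ([area_ideal]), a bounded density gives finite
    energy.

    The diffeomorphisms that define the metrics are given on triangles without
    their vertices. That they send vertices to cusps and edges to sides follows
    from compactness and connectedness ([chart_ends]); a symmetry of the ideal
    triangle then makes the labels agree ([chart_exists]). *)

(** * Differentiable functions on the plane *)

Section Gradient.
Context {R : realType}.
Implicit Types (f g : plane R -> R) (p : plane R).

(** The differential is kept as its two coefficients, since energy densities are
    polynomials in the partial derivatives. *)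
Definition has_gradient f p (a b : R) :=
  differentiable f p /\ forall h, 'd f p h = a * h.1 + b * h.2.

Lemma is_derive_slice1 f (t c : R) :
  derivable f (t, c) (1, 0) ->
  is_derive t (1 : R) (fun s => f (s, c)) ('D_((1, 0) : plane R) f (t, c)).
Proof.
move=> df.
have E : (fun h : R => h^-1 *: (((fun s => f (s, c)) \o shift t) (h *: (1 : R)) - f (t, c)))
   = (fun h => h^-1 *: ((f \o shift (t, c)) (h *: ((1, 0) : plane R)) - f (t, c))).
  apply/funext => h /=; congr (_ *: (f _ - _)).
  by congr pair; rewrite /= ?scaler0 ?add0r.
by split; rewrite /derivable /derive E.
Qed.

Lemma is_derive_slice2 f (t c : R) :
  derivable f (c, t) (0, 1) ->
  is_derive t (1 : R) (fun s => f (c, s)) ('D_((0, 1) : plane R) f (c, t)).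
Proof.
move=> df.
have E : (fun h : R => h^-1 *: (((fun s => f (c, s)) \o shift t) (h *: (1 : R)) - f (c, t)))
   = (fun h => h^-1 *: ((f \o shift (c, t)) (h *: ((0, 1) : plane R)) - f (c, t))).
  apply/funext => h /=; congr (_ *: (f _ - _)).
  by congr pair; rewrite /= ?scaler0 ?add0r.
by split; rewrite /derivable /derive E.
Qed.

Lemma mean_value_bound (phi dphi : R -> R) (a b e : R) :
  (forall t, `|t - a| <= `|b - a| -> is_derive t (1 : R) phi (dphi t)) ->
  (forall t, `|t - a| <= `|b - a| -> `|dphi t| <= e) ->
  `|phi b - phi a| <= e * `|b - a|.
Proof.
move=> dp de.
have [ab|ba] := leP a b.
- have I t : t \in `[a, b] -> `|t - a| <= `|b - a|.
    by rewrite in_itv /= => /andP[h1 h2]; rewrite !ger0_norm; lra.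
  have [|||c /I ci ->] := @MVT_segment R phi dphi a b => //.
  + by move=> x /subset_itv_oo_cc /I /dp.
  + by apply: derivable_within_continuous => x /I /dp [].
  + by rewrite normrM ler_wpM2r // de.
- have I t : t \in `[b, a] -> `|t - a| <= `|b - a|.
    by rewrite in_itv /= => /andP[h1 h2]; rewrite !ler0_norm; lra.
  have [||c /I ci E] := @MVT_segment R phi dphi b a (ltW ba) => //.
  + by move=> x /subset_itv_oo_cc /I /dp.
  + by apply: derivable_within_continuous => x /I /dp [].
  + by rewrite distrC E normrM (distrC b) ler_wpM2r // de.
Qed.

(** [Ck] speaks of partial derivatives only; this makes the chain rule available
    for it. The increment is split into a horizontal and a vertical step, and on
    each step the mean value theorem replaces the increment by a partial
    derivative, which is close to its value at [p]. *)
Lemma has_gradient_C1 f (U : set (plane R)) p : open U -> U p ->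
  (forall q, U q -> derivable f q (1, 0)) ->
  (forall q, U q -> derivable f q (0, 1)) ->
  {for p, continuous ('D_((1, 0) : plane R) f)} ->
  {for p, continuous ('D_((0, 1) : plane R) f)} ->
  has_gradient f p ('D_((1, 0) : plane R) f p) ('D_((0, 1) : plane R) f p).
Proof.
set a := 'D__ f p; set b := 'D__ f p => Uo Up d1 d2 c1 c2.
pose d (h : plane R) : R := a * h.1 + b * h.2.
have dl : linear d by move=> k u v; rewrite /d /= ; rewrite /GRing.scale /=; ring.
pose dM := GRing.isLinear.Build _ _ _ _ _ dl.
pose D : {linear plane R -> R} := HB.pack d dM.
have Dc : continuous D.
  move=> q; rewrite /D /= /d.
  apply: cvgD; apply: cvgMr; [exact: cvg_fst|exact: cvg_snd].
have Do : f \o shift p = cst (f p) + (D : plane R -> R) +o_ (0 : plane R) (id : plane R -> plane R).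
  apply/(@eqaddoP R (plane R) R (plane R) (nbhs (0 : plane R))) => _/posnumP[e].
  have e2 : 0 < e%:num / 2 by [].
  have /nbhs_ballP[r /= r0 H] : \forall q \near p,
      [/\ U q, `|a - 'D_((1, 0) : plane R) f q| <= e%:num / 2
      & `|b - 'D_((0, 1) : plane R) f q| <= e%:num / 2].
    move/cvgrPdist_le : c1 => /(_ _ e2) N1.
    move/cvgrPdist_le : c2 => /(_ _ e2) N2.
    have N0 : nbhs p U by exact: open_nbhs_nbhs.
    apply: filterS3 N0 N1 N2 => q h0 h1 h2; exact: (And3 h0 h1 h2).
  have : nbhs (0 : plane R) [set h : plane R | `|h| < r].
    apply/nbhs_ballP; exists r => // q [/=]; rewrite /ball /= !sub0r !normrN => ? ?.
    suff : Num.max `|q.1| `|q.2| < r by [].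
    by rewrite gt_max; apply/andP.
  apply: filterS => h hr.
  have [h1r h2r] : `|h.1| < r /\ `|h.2| < r.
    have : Num.max `|h.1| `|h.2| < r by [].
    by rewrite gt_max => /andP[].
  have [h1h h2h] : `|h.1| <= `|h| /\ `|h.2| <= `|h|.
    suff : `|h.1| <= Num.max `|h.1| `|h.2| /\ `|h.2| <= Num.max `|h.1| `|h.2| by [].
    by rewrite !le_max !lexx orbT.
  case: h hr h1r h2r h1h h2h => h1 h2 /= hr h1r h2r h1h h2h.
  pose p1 := p.1; pose p2 := p.2; have Ep : p = (p1, p2) by apply: surjective_pairing.
  rewrite /= !fctE /= /d /=.
  have B s t : `|s| <= `|h1| -> `|t| <= `|h2| -> ball p r (p1 + s, p2 + t).
    by move=> sh th; split; rewrite /= /ball /= opprD addrA subrr sub0r normrN;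
       apply: le_lt_trans; eassumption.
  have S1 : `|(f (p1 + h1, p2 + h2) - a * (p1 + h1)) - (f (p1, p2 + h2) - a * p1)| <=
      e%:num / 2 * `|(p1 + h1) - p1|.
    apply: (@mean_value_bound (fun s => f (s, p2 + h2) - a * s)
      (fun s => 'D_((1, 0) : plane R) f (s, p2 + h2) - a * 1)) => s sh.
      have /H[Us _ _] : ball p r (s, p2 + h2).
        rewrite (_ : s = p1 + (s - p1)); last by ring.
        by apply: B => //; move: sh; rewrite [X in _ <= `|X|]addrC addKr.
      have := is_derive_slice1 (d1 _ Us) => ?.
      by apply: is_deriveB.
    rewrite mulr1 distrC.
    suff /H[_ Hs _] : ball p r (s, p2 + h2) by exact: Hs.
    rewrite (_ : s = p1 + (s - p1)); last by ring.
    by apply: B => //; move: sh; rewrite [X in _ <= `|X|]addrC addKr.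
  have S2 : `|(f (p1, p2 + h2) - b * (p2 + h2)) - (f (p1, p2) - b * p2)| <=
      e%:num / 2 * `|(p2 + h2) - p2|.
    apply: (@mean_value_bound (fun s => f (p1, s) - b * s)
      (fun s => 'D_((0, 1) : plane R) f (p1, s) - b * 1)) => s sh.
      have /H[Us _ _] : ball p r (p1, s).
        rewrite (_ : s = p2 + (s - p2)); last by ring.
        rewrite -[p1]addr0.
        by apply: B => //; rewrite ?normr0//; move: sh; rewrite [X in _ <= `|X|]addrC addKr.
      have := is_derive_slice2 (d2 _ Us) => ?.
      by apply: is_deriveB.
    rewrite mulr1 distrC.
    suff /H[_ _ Hs] : ball p r (p1, s) by exact: Hs.
    rewrite (_ : s = p2 + (s - p2)); last by ring.
    rewrite -[p1]addr0.
    by apply: B => //; rewrite ?normr0//; move: sh; rewrite [X in _ <= `|X|]addrC addKr.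
  move: S1 S2; rewrite [X in _ * `|X|]addrC addKr [X in _ -> _ <= _ * `|X| -> _]addrC addKr => S1 S2.
  rewrite (_ : (h1, h2) + p = (p1 + h1, p2 + h2)); last first.
    by congr pair => /=; rewrite addrC.
  rewrite -Ep in S2.
  set X := (X in `|X| <= _).
  have -> : X = (f (p1 + h1, p2 + h2) - a * (p1 + h1) - (f (p1, p2 + h2) - a * p1)) +
     (f (p1, p2 + h2) - b * (p2 + h2) - (f p - b * p2)) by rewrite /X; ring.
  apply: le_trans (ler_normD _ _) _.
  apply: le_trans (lerD S1 S2) _.
  set N := `|(h1, h2)|.
  have : e%:num / 2 * `|h1| <= e%:num / 2 * N by rewrite ler_pM2l.
  have : e%:num / 2 * `|h2| <= e%:num / 2 * N by rewrite ler_pM2l.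
  rewrite /=; lra.
have E := diff_unique Dc Do.
split.
  by apply/diff_locallyP; rewrite E.
by move=> h; rewrite E.
Qed.

End Gradient.

Section GradientCalculus.
Context {R : realType}.
Implicit Types (f g : plane R -> R) (p v : plane R).

Lemma has_gradientP f p a b : has_gradient f p a b -> is_diff p f (fun h => a * h.1 + b * h.2).
Proof. by move=> [df E]; split => //; apply/funext. Qed.

Lemma is_diff_gradient f p (df : plane R -> R) a b : is_diff p f df ->
  (forall h, df h = a * h.1 + b * h.2) -> has_gradient f p a b.
Proof. by move=> [d E] H; split => // h; rewrite E. Qed.

Lemma has_gradient_derivable f p v a b : has_gradient f p a b -> derivable f p v.
Proof. by move=> [d _]; apply: diff_derivable. Qed.

Lemma has_gradient_derive f p v a b : has_gradient f p a b ->
  'D_v f p = a * v.1 + b * v.2.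
Proof. by move=> [d E]; rewrite deriveE. Qed.

Lemma has_gradient_dx f p a b : has_gradient f p a b -> 'D_((1, 0) : plane R) f p = a.
Proof. by move=> /has_gradient_derive -> /=; rewrite mulr1 mulr0 addr0. Qed.

Lemma has_gradient_dy f p a b : has_gradient f p a b -> 'D_((0, 1) : plane R) f p = b.
Proof. by move=> /has_gradient_derive -> /=; rewrite mulr1 mulr0 add0r. Qed.

Lemma has_gradient_unique f p a b c d :
  has_gradient f p a b -> has_gradient f p c d -> a = c /\ b = d.
Proof.
move=> h1 h2; split.
  by rewrite -(has_gradient_dx h1) -(has_gradient_dx h2).
by rewrite -(has_gradient_dy h1) -(has_gradient_dy h2).
Qed.

Lemma has_gradient_continuous f p a b : has_gradient f p a b -> {for p, continuous f}.
Proof. by move=> [d _]; apply: differentiable_continuous. Qed.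

Lemma has_gradient_cst (c : R) p : has_gradient (fun=> c) p 0 0.
Proof.
split; first exact: (@differentiable_cst R (plane R) R c p).
by move=> h /=; rewrite (@diff_cst R (plane R) R c p) !mul0r addr0.
Qed.

Lemma has_gradient_linear (a b : R) p :
  has_gradient (fun q => a * q.1 + b * q.2) p a b.
Proof.
pose d (h : plane R) : R := a * h.1 + b * h.2.
have dl : linear d by move=> k u v; rewrite /d /= /GRing.scale /=; ring.
pose dM := GRing.isLinear.Build _ _ _ _ _ dl.
pose D : {linear plane R -> R} := HB.pack d dM.
have Dc : continuous D.
  move=> q; rewrite /D /= /d.
  apply: cvgD; apply: cvgMr; [exact: cvg_fst|exact: cvg_snd].
have -> : (fun q : plane R => a * q.1 + b * q.2) = (D : plane R -> R) by [].
split; first exact: linear_differentiable.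
by move=> h; rewrite diff_lin.
Qed.

Lemma has_gradient_fst p : has_gradient fst p 1 0.
Proof.
have := has_gradient_linear 1 0 p.
by under eq_fun do rewrite mul1r mul0r addr0.
Qed.

Lemma has_gradient_snd p : has_gradient snd p 0 1.
Proof.
have := has_gradient_linear 0 1 p.
by under eq_fun do rewrite mul1r mul0r add0r.
Qed.

Lemma has_gradientD f g p a b c d : has_gradient f p a b -> has_gradient g p c d ->
  has_gradient (fun q => f q + g q) p (a + c) (b + d).
Proof.
move=> /has_gradientP h1 /has_gradientP h2.
apply: (is_diff_gradient (@is_diffD R (plane R) R f g _ _ p h1 h2)).
by move=> h; rewrite !fctE; ring.
Qed.

Lemma has_gradientM f g p a b c d : has_gradient f p a b -> has_gradient g p c d ->
  has_gradient (fun q => f q * g q) p (f p * c + g p * a) (f p * d + g p * b).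
Proof.
move=> /has_gradientP h1 /has_gradientP h2.
apply: (is_diff_gradient (@is_diffM R (plane R) f g _ _ p h1 h2)).
by move=> h; rewrite !fctE /GRing.scale /=; ring.
Qed.

Lemma has_gradient_comp f (F : plane R -> plane R) p a b a1 b1 a2 b2 :
  has_gradient f (F p) a b ->
  has_gradient (fun q => (F q).1) p a1 b1 -> has_gradient (fun q => (F q).2) p a2 b2 ->
  has_gradient (f \o F) p (a * a1 + b * a2) (a * b1 + b * b2).
Proof.
move=> /has_gradientP h /has_gradientP h1 /has_gradientP h2.
have h12 := is_diff_pair h1 h2.
have FE : (fun q => ((F q).1, (F q).2)) = F.
  by apply/funext => q; rewrite -surjective_pairing.
rewrite FE in h12.
apply: (is_diff_gradient (is_diff_comp h12 h)).
by move=> v /=; ring.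
Qed.

Lemma has_gradient_comp1 (phi : R -> R) f p a b d :
  is_derive (f p) (1 : R) phi d -> has_gradient f p a b ->
  has_gradient (phi \o f) p (d * a) (d * b).
Proof.
move=> [d1 d2] /has_gradientP h.
have hp : is_diff (f p) phi ( *:%R^~ d : R -> R).
  split; first by apply/derivable1_diffP.
  by rewrite deriv1E // -d2 derive1E.
apply: (is_diff_gradient (is_diff_comp h hp)).
by move=> v /=; rewrite /GRing.scale /=; ring.
Qed.

Lemma has_gradientV (f : plane R -> R) p a b : has_gradient f p a b -> f p != 0 ->
  has_gradient (fun q => (f q)^-1) p (- a / f p ^+ 2) (- b / f p ^+ 2).
Proof.
move=> G f0; have D := @is_deriveV R id (f p) 1 1 f0 (is_derive_id (f p) (1 : R)).
have := has_gradient_comp1 D G.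
rewrite /= /GRing.scale /= mulr1 !mulNr -!(mulrC a) -!(mulrC b) -!mulNr; exact.
Qed.

Lemma has_gradient_near f g p a b : (\forall q \near p, f q = g q) ->
  has_gradient f p a b -> has_gradient g p a b.
Proof.
move=> fg [df E].
have H : g \o shift p = cst (g p) + ('d f p : plane R -> R) +o_ (0 : plane R) (id : plane R -> plane R).
  apply/(@eqaddoP R (plane R) R (plane R) (nbhs (0 : plane R))) => e e0.
  have := diff_locally df.
  move=> /(@eqaddoP R (plane R) R (plane R) (nbhs (0 : plane R))) /(_ e e0).
  have N : \forall h \near (0 : plane R), f (h + p) = g (h + p).
    move: fg; rewrite (near_shift 0 p) /=.
    by apply: filterS => h /=; rewrite subr0.
  apply: filterS2 N => h hE.
  by rewrite !fctE /= hE (nbhs_singleton fg).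
have Dc : continuous ('d f p) by apply: diff_continuous.
have E2 := diff_unique Dc H.
split; last by move=> h; rewrite E2.
by apply/diff_locallyP; rewrite E2.
Qed.

End GradientCalculus.

(** * Closure properties of smooth functions *)

Section CkCalculus.
Context {R : realType}.
Implicit Types (f g : plane R -> R) (p v : plane R) (U V : set (plane R)).

Lemma for_continuous_near (T : topologicalType) (f g : plane R -> T) p :
  (\forall q \near p, f q = g q) -> {for p, continuous f} -> {for p, continuous g}.
Proof.
move=> fg cf; suff : g @ p --> g p by [].
by rewrite -(nbhs_singleton fg); apply: (cvg_trans _ cf); exact: near_eq_cvg.
Qed.

Lemma Ck_congr k U f g : open U -> (forall p, U p -> f p = g p) -> Ck k U f -> Ck k U g.
Proof.
move=> Uo; have N f' g' p : (forall p, U p -> f' p = g' p :> R) -> U p ->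
    \forall q \near p, f' q = g' q.
  by move=> fg Up; apply: filterS (open_nbhs_nbhs (conj Uo Up)) => q /fg.
elim: k f g => [|k IH] f g fg [cf Df].
  by split=> // p Up; apply: for_continuous_near (cf p Up); exact: N.
split=> [p Up|v hv].
  by apply: for_continuous_near (cf p Up); exact: N.
have [dv Cv] := Df v hv; split.
  by move=> p Up; apply: near_eq_derivable (dv p Up); exact: N.
by apply: IH Cv => p Up; apply: near_eq_derive; exact: N.
Qed.

Lemma Ck_continuous k U f p : Ck k U f -> U p -> {for p, continuous f}.
Proof. by case: k => [|k] [+ _]; apply. Qed.

Lemma Ck_gradient k U f p : open U -> U p -> Ck k.+1 U f ->
  has_gradient f p ('D_((1, 0) : plane R) f p) ('D_((0, 1) : plane R) f p).
Proof.
move=> Uo Up [cf Df].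
have [d1 C1] := Df (1, 0) (or_introl erefl).
have [d2 C2] := Df (0, 1) (or_intror erefl).
by apply: (has_gradient_C1 Uo Up d1 d2); [exact: (Ck_continuous C1)|exact: (Ck_continuous C2)].
Qed.

(** With the partial derivatives as separate functions, each closure property
    below is an induction on k that uses the formula for one gradient. *)
Lemma CkSP k U f : open U -> Ck k.+1 U f <->
  exists fx fy : plane R -> R,
    [/\ forall p, U p -> has_gradient f p (fx p) (fy p), Ck k U fx & Ck k U fy].
Proof.
move=> Uo; split=> [C|[fx [fy [G Cx Cy]]]].
  exists ('D_((1, 0) : plane R) f), ('D_((0, 1) : plane R) f); split.
  - by move=> p Up; apply: Ck_gradient C.
  - by case: C => _ /(_ _ (or_introl erefl))[].
  - by case: C => _ /(_ _ (or_intror erefl))[].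
split=> [p /G /has_gradient_continuous//|v [->|->]]; split.
- by move=> p /G /has_gradient_derivable.
- by apply: Ck_congr Cx => // p /G /has_gradient_dx.
- by move=> p /G /has_gradient_derivable.
- by apply: Ck_congr Cy => // p /G /has_gradient_dy.
Qed.

Lemma CkW k U f : Ck k.+1 U f -> Ck k U f.
Proof.
elim: k f => [|k IH] f [cf Df]; first by split.
by split=> // v /Df[dv Cv]; split=> //; apply: IH.
Qed.

Lemma Ck_sub k U V f : V `<=` U -> Ck k U f -> Ck k V f.
Proof.
move=> VU; elim: k f => [|k IH] f [cf Df]; first by split=> // p /VU /cf.
split=> [p /VU /cf//|v /Df[dv Cv]]; split; [by move=> p /VU /dv|exact: IH].
Qed.

Lemma Ck_cst k U c : open U -> Ck k U (fun=> c).
Proof.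
move=> Uo; elim: k c => [|k IH] c.
  by split=> // p _; exact: cst_continuous.
apply/CkSP => //; exists (fun=> 0), (fun=> 0); split; [|exact: IH..].
by move=> p _; exact: has_gradient_cst.
Qed.

Lemma Ck_fst k U : open U -> Ck k U fst.
Proof.
move=> Uo; case: k => [|k].
  by split; [move=> p _; exact: (has_gradient_continuous (has_gradient_fst p))|].
apply/CkSP => //; exists (fun=> 1), (fun=> 0); split; [|exact: Ck_cst..].
by move=> p _; exact: has_gradient_fst.
Qed.

Lemma Ck_snd k U : open U -> Ck k U snd.
Proof.
move=> Uo; case: k => [|k].
  by split; [move=> p _; exact: (has_gradient_continuous (has_gradient_snd p))|].
apply/CkSP => //; exists (fun=> 0), (fun=> 1); split; [|exact: Ck_cst..].
by move=> p _; exact: has_gradient_snd.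
Qed.

Lemma CkD k U f g : open U -> Ck k U f -> Ck k U g -> Ck k U (fun p => f p + g p).
Proof.
move=> Uo; elim: k f g => [|k IH] f g.
  move=> [cf _] [cg _]; split=> // p Up.
  by apply: continuousD; [exact: cf|exact: cg].
move=> /(CkSP _ _ Uo)[fx [fy [Gf Cfx Cfy]]] /(CkSP _ _ Uo)[gx [gy [Gg Cgx Cgy]]].
apply/CkSP => //; exists (fun p => fx p + gx p), (fun p => fy p + gy p); split.
- by move=> p Up; apply: has_gradientD; auto.
- exact: IH.
- exact: IH.
Qed.

Lemma CkM k U f g : open U -> Ck k U f -> Ck k U g -> Ck k U (fun p => f p * g p).
Proof.
move=> Uo; elim: k f g => [|k IH] f g.
  move=> [cf _] [cg _]; split=> // p Up.
  by apply: continuousM; [exact: cf|exact: cg].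
move=> Cf Cg; have [Cf' Cg'] := (CkW Cf, CkW Cg).
move: Cf Cg => /(CkSP _ _ Uo)[fx [fy [Gf Cfx Cfy]]] /(CkSP _ _ Uo)[gx [gy [Gg Cgx Cgy]]].
apply/CkSP => //; exists (fun p => f p * gx p + g p * fx p), (fun p => f p * gy p + g p * fy p).
split.
- by move=> p Up; apply: has_gradientM; auto.
- by apply: CkD => //; apply: IH.
- by apply: CkD => //; apply: IH.
Qed.

Lemma CkN k U f : open U -> Ck k U f -> Ck k U (fun p => - f p).
Proof.
move=> Uo Cf; have := CkM Uo (Ck_cst k (-1) Uo) Cf.
by under eq_fun do rewrite mulN1r.
Qed.

Lemma CkB k U f g : open U -> Ck k U f -> Ck k U g -> Ck k U (fun p => f p - g p).
Proof. by move=> Uo Cf Cg; apply: CkD => //; exact: CkN. Qed.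

Lemma Ck_comp k U V f (F : plane R -> plane R) : open U -> open V ->
  (forall p, U p -> V (F p)) -> Ck k V f ->
  Ck k U (fun q => (F q).1) -> Ck k U (fun q => (F q).2) -> Ck k U (f \o F).
Proof.
move=> Uo Vo UV; elim: k f => [|k IH] f.
  move=> [cf _] [c1 _] [c2 _]; split=> // p Up.
  apply: continuous_comp; last by apply: cf; exact: UV.
  apply: (@for_continuous_near _ (fun q => ((F q).1, (F q).2))).
    by exists (setT, setT) => [|q _ /=]; [split; exact: filterT|rewrite -surjective_pairing].
  exact: (cvg_pair (c1 p Up) (c2 p Up)).
move=> Cf C1 C2; have [C1' C2'] := (CkW C1, CkW C2).
move: Cf C1 C2 => /(CkSP _ _ Vo)[fx [fy [Gf Cfx Cfy]]]
  /(CkSP _ _ Uo)[x1 [y1 [G1 Cx1 Cy1]]] /(CkSP _ _ Uo)[x2 [y2 [G2 Cx2 Cy2]]].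
apply/CkSP => //.
exists (fun p => (fx \o F) p * x1 p + (fy \o F) p * x2 p),
       (fun p => (fx \o F) p * y1 p + (fy \o F) p * y2 p); split.
- by move=> p Up; apply: has_gradient_comp; auto.
- by apply: CkD => //; apply: CkM => //; apply: IH.
- by apply: CkD => //; apply: CkM => //; apply: IH.
Qed.

(** A function of one variable is treated as a function of the second
    coordinate, so that one calculus serves both. *)
Definition CkR k (I : set R) (phi : R -> R) := Ck k [set p : plane R | I p.2] (phi \o snd).

Lemma open_snd (I : set R) : open I -> open [set p : plane R | I p.2].
Proof.
move=> Io; have /continuousP cs : continuous (snd : plane R -> R).
  by move=> p; exact: (has_gradient_continuous (has_gradient_snd p)).
exact: cs.
Qed.

Lemma CkR_comp k U (I : set R) phi f : open U -> open I ->
  (forall p, U p -> I (f p)) -> CkR k I phi -> Ck k U f -> Ck k U (phi \o f).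
Proof.
move=> Uo Io UI Cp Cf.
have := @Ck_comp k U [set p : plane R | I p.2] (phi \o snd) (fun q => (0, f q)).
apply => //; [exact: open_snd|exact: Ck_cst].
Qed.

Lemma CkRSP k (I : set R) (phi dphi : R -> R) : open I ->
  (forall x, I x -> is_derive x (1 : R) phi (dphi x)) -> CkR k I dphi -> CkR k.+1 I phi.
Proof.
move=> Io D C; apply/CkSP; first exact: open_snd.
exists (fun p => 0), (dphi \o snd); split=> //; last by apply: Ck_cst; exact: open_snd.
move=> p Ip; have := has_gradient_comp1 (D _ Ip) (has_gradient_snd p).
by rewrite mulr0 mulr1.
Qed.

Lemma CkR_exp k : CkR k setT expR.
Proof.
elim: k => [|k IH].
  split=> // p _; apply: continuous_comp; last exact: continuous_expR.
  exact: has_gradient_continuous (has_gradient_snd p).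
by apply: (CkRSP openT _ IH) => x _; exact: is_derive_expR.
Qed.

Lemma CkR_inv k : CkR k [set x | x != 0] (fun x => x^-1).
Proof.
have Io : open [set x : R | x != 0] by exact: open_neq.
have Uo := open_snd Io.
elim: k => [|k IH].
  split=> // p /= Ip; apply: (@continuous_comp _ _ _ snd (fun x : R => x^-1)).
    exact: has_gradient_continuous (has_gradient_snd p).
  exact: inv_continuous.
apply: (@CkRSP _ _ _ (fun x => - (x^-1 * x^-1))) => //.
  move=> x x0; have := @is_deriveV R id x 1 1 x0 (is_derive_id x (1 : R)) => h.
  by apply: (is_derive_eq h); rewrite /GRing.scale /= mulr1 expr2 invfM.
by apply: CkN => //; apply: CkM.
Qed.

Lemma CkR_ln k : CkR k [set x | 0 < x] (@ln R).
Proof.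
have Io : open [set x : R | 0 < x] by exact: open_gt.
have D (x : R) : 0 < x -> is_derive x (1 : R) (@ln R) x^-1 by exact: is_derive1_ln.
case: k => [|k].
  split=> // p /= Ip; apply: continuous_comp; last exact: continuous_ln.
  exact: has_gradient_continuous (has_gradient_snd p).
apply: (CkRSP Io D).
apply: Ck_sub (CkR_inv k) => p /= ?; exact: lt0r_neq0.
Qed.

Lemma Ck_inv (k : nat) U (f : plane R -> R) : open U -> (forall p, U p -> f p != 0) ->
  Ck k U f -> Ck k U (fun p => (f p)^-1).
Proof.
move=> Uo f0 Cf; have Io : open [set x : R | x != 0] by exact: open_neq.
exact: (CkR_comp Uo Io f0 (CkR_inv k) Cf).
Qed.

End CkCalculus.

(** * Smooth inverses of fiberwise increasing maps *)

Section FiberInverse.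
Context {R : realType}.
Implicit Types (f g : plane R -> R) (p v : plane R).

Lemma nbhs_planeP (p : plane R) (A : set (plane R)) : nbhs p A <->
  exists2 d : R, 0 < d & forall q, `|q.1 - p.1| < d -> `|q.2 - p.2| < d -> A q.
Proof.
split.
  move/nbhs_ballP => [d /= d0 H]; exists d => // q h1 h2; apply: H.
  by split; rewrite /ball /= distrC.
move=> [d d0 H]; apply/nbhs_ballP; exists d => // q [h1 h2].
by apply: H; rewrite distrC.
Qed.

Lemma continuous_planeP f p : {for p, continuous f} <->
  forall e, 0 < e -> exists2 d : R, 0 < d &
    forall q, `|q.1 - p.1| < d -> `|q.2 - p.2| < d -> `|f q - f p| < e.
Proof.
split.
  move/cvgrPdist_lt => cf e /cf /nbhs_planeP[d d0 H]; exists d => // q h1 h2.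
  by rewrite distrC; exact: H.
move=> H; suff : f @ p --> f p by [].
apply/cvgrPdist_lt => e /H[d d0 {}H]; apply/nbhs_planeP; exists d => // q h1 h2.
by rewrite distrC; exact: H.
Qed.

(** The form in which differentiability is used at an extremum and proved for an
    inverse map and for a flat function. *)
Lemma has_gradient_epsP f p a b : has_gradient f p a b <->
  forall e, 0 < e -> exists2 d : R, 0 < d & forall q, `|q.1 - p.1| < d -> `|q.2 - p.2| < d ->
    `|f q - f p - a * (q.1 - p.1) - b * (q.2 - p.2)| <=
    e * (`|q.1 - p.1| + `|q.2 - p.2|).
Proof.
split=> [[df E] e e0|H].
  have := diff_locally df.
  move=> /(@eqaddoP R (plane R) R (plane R) (nbhs (0 : plane R))) /(_ e e0).
  move=> /nbhs_planeP[d d0 H]; exists d => // q h1 h2.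
  have /= := H (q - p); rewrite !subr0 => /(_ h1 h2).
  rewrite !fctE /= E /= subrK => h.
  rewrite (_ : f q - _ - _ - _ = f q - (f p + (a * (q.1 - p.1) + b * (q.2 - p.2)))); last by ring.
  apply: (le_trans h); rewrite ler_pM2l //.
  suff : Num.max `|q.1 - p.1| `|q.2 - p.2| <= `|q.1 - p.1| + `|q.2 - p.2| by [].
  by rewrite ge_max lerDl lerDr !normr_ge0.
pose d (h : plane R) : R := a * h.1 + b * h.2.
have dl : linear d by move=> k u v; rewrite /d /= /GRing.scale /=; ring.
pose dM := GRing.isLinear.Build _ _ _ _ _ dl.
pose D : {linear plane R -> R} := HB.pack d dM.
have Dc : continuous D.
  move=> q; rewrite /D /= /d.
  apply: cvgD; apply: cvgMr; [exact: cvg_fst|exact: cvg_snd].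
have Do : f \o shift p = cst (f p) + (D : plane R -> R) +o_ (0 : plane R) (id : plane R -> plane R).
  apply/(@eqaddoP R (plane R) R (plane R) (nbhs (0 : plane R))) => e e0.
  have [r r0 {}H] := H (e / 2) (divr_gt0 e0 (ltr0Sn _ _)).
  apply/nbhs_planeP; exists r => // h /=; rewrite !subr0 => h1 h2.
  have /= := H (h + p); rewrite !addrK => /(_ h1 h2) {}H.
  rewrite !fctE /= /d (_ : _ - _ = f (h + p) - f p - a * h.1 - b * h.2); last by ring.
  apply: (le_trans H).
  suff : e / 2 * (`|h.1| + `|h.2|) <= e * Num.max `|h.1| `|h.2| by [].
  have m1 : `|h.1| <= Num.max `|h.1| `|h.2| by rewrite le_max lexx.
  have m2 : `|h.2| <= Num.max `|h.1| `|h.2| by rewrite le_max lexx orbT.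
  by rewrite -mulrA ler_pM2l // ler_pdivrMl //; lra.
have E := diff_unique Dc Do.
split; last by move=> h; rewrite E.
by apply/diff_locallyP; rewrite E.
Qed.

Lemma fiber_increasing (mu mux mus : plane R -> R) :
  (forall p, has_gradient mu p (mux p) (mus p)) -> (forall p, 0 < mus p) ->
  forall x s t, s < t -> mu (x, s) < mu (x, t).
Proof.
move=> G pos x s t st.
have D u : is_derive u (1 : R) (fun s => mu (x, s)) (mus (x, u)).
  have := is_derive_slice2 (has_gradient_derivable (v := (0, 1)) (G (x, u))).
  by rewrite (has_gradient_dy (G (x, u))).
have [|c _ E] := @MVT R (fun s => mu (x, s)) (fun u => mus (x, u)) s t st.
  by apply: derivable_within_continuous => u _; case: (D u).
by rewrite -subr_gt0 E mulr_gt0 // subr_gt0.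
Qed.

Section Inverse.
Variables (mu mux mus nu : plane R -> R).
Hypothesis G : forall p, has_gradient mu p (mux p) (mus p).
Hypothesis pos : forall p, 0 < mus p.
Hypothesis munu : forall x t, mu (x, nu (x, t)) = t.

Let mono := fiber_increasing G pos.

Let lt_nu x s t : mu (x, s) < t -> s < nu (x, t).
Proof.
move=> h; rewrite ltNge; apply/negP; rewrite le_eqVlt => /predU1P[e|].
  by move: h; rewrite -e munu ltxx.
by move/(mono x); rewrite munu => /(lt_trans h); rewrite ltxx.
Qed.

Let nu_lt x s t : t < mu (x, s) -> nu (x, t) < s.
Proof.
move=> h; rewrite ltNge; apply/negP; rewrite le_eqVlt => /predU1P[e|].
  by move: h; rewrite e munu ltxx.
by move/(mono x); rewrite munu => /(lt_trans h); rewrite ltxx.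
Qed.

(** By monotonicity [nu] stays between [s0 - e] and [s0 + e] as long as [mu] at
    these two heights stays below, respectively above, the second coordinate;
    this is an open condition. *)
Lemma fiber_inverse_continuous p : {for p, continuous nu}.
Proof.
apply/continuous_planeP => e e0.
case: p => x0 t0; set s0 := nu (x0, t0).
have m1 : mu (x0, s0 - e) < t0 by rewrite -[t0](munu x0) mono // gtrDl oppr_lt0.
have m2 : t0 < mu (x0, s0 + e) by rewrite -[t0](munu x0) mono // ltrDl.
have /continuous_planeP /(_ ((t0 - mu (x0, s0 - e)) / 2))[|d1 d10 H1] :=
  has_gradient_continuous (G (x0, s0 - e)); first by lra.
have /continuous_planeP /(_ ((mu (x0, s0 + e) - t0) / 2))[|d2 d20 H2] :=
  has_gradient_continuous (G (x0, s0 + e)); first by lra.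
set r1 := (t0 - _) / 2 in H1; set r2 := (_ - t0) / 2 in H2.
have r10 : 0 < r1 by rewrite /r1; lra.
have r20 : 0 < r2 by rewrite /r2; lra.
exists (Num.min (Num.min d1 d2) (Num.min r1 r2)).
  by rewrite !lt_min d10 d20 r10 r20.
move=> [x t] /=; rewrite !lt_min => /andP[/andP[x1 x2] _] /andP[_ /andP[t1 t2]].
have /= := H1 (x, s0 - e) x1; rewrite subrr normr0 => /(_ d10) {}H1.
have /= := H2 (x, s0 + e) x2; rewrite subrr normr0 => /(_ d20) {}H2.
have L1 : s0 - e < nu (x, t).
  by apply: lt_nu; move: H1 t1; rewrite !ltr_norml /r1 => /andP[? ?] /andP[? ?]; lra.
have L2 : nu (x, t) < s0 + e.
  by apply: nu_lt; move: H2 t2; rewrite !ltr_norml /r2 => /andP[? ?] /andP[? ?]; lra.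
by rewrite -/s0 ltr_norml; lra.
Qed.

(** By continuity the expansion of [mu] at [(x, s)] applies to the increment k
    of [nu]. The linear term b * k absorbs half of the error, which bounds k
    linearly by the increment of [(x, t)], so the error is small for [nu] as
    well. *)
Lemma fiber_inverse_gradient x t :
  has_gradient nu (x, t) (- (mux (x, nu (x, t)) / mus (x, nu (x, t))))
    (mus (x, nu (x, t)))^-1.
Proof.
apply/has_gradient_epsP => e e0.
set s := nu (x, t); set a := mux _; set b := mus _.
have b0 : 0 < b by exact: pos.
(* The linear bound for the increment of [nu], obtained with an error
   coefficient of at most b / 2. *)
pose C := (1 + `|a| + b / 2) / (b / 2).
have C0 : 0 < C by rewrite divr_gt0 ?divr_gt0 //; have := normr_ge0 a; lra.
pose e' := Num.min (b / 2) (e * b / (1 + C)).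
have e'0 : 0 < e' by rewrite lt_min divr_gt0 //= divr_gt0 ?mulr_gt0 //; lra.
have e'1 : e' <= b / 2 by rewrite ge_min lexx.
have e'2 : e' * (1 + C) <= e * b.
  by rewrite -ler_pdivlMr ?ge_min ?lexx ?orbT //; lra.
have /has_gradient_epsP /(_ e' e'0)[d1 d10 H1] := G (x, s).
have /continuous_planeP /(_ d1 d10)[d2 d20 H2] := @fiber_inverse_continuous (x, t).
exists (Num.min d1 d2); first by rewrite lt_min d10 d20.
move=> [x' t'] /=; rewrite !lt_min => /andP[x1 x2] /andP[t1 t2].
have /= := H2 (x', t') x2 t2; set s' := nu (x', t'); rewrite -/s => sd.
have /= := H1 (x', s') x1 sd; rewrite !munu -/a -/b.
set hx := x' - x; set ht := t' - t; set k := s' - s => HH.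
have bk : b * `|k| <= `|ht| + `|a| * `|hx| + e' * (`|hx| + `|k|).
  rewrite -(gtr0_norm b0) -!normrM.
  have -> : b * k = ht - a * hx - (ht - a * hx - b * k) by ring.
  by apply: le_trans (ler_normB _ _) _; apply: lerD => //; apply: ler_normB.
set N := `|hx| + `|ht|.
have kC : `|k| <= C * N.
  rewrite /C mulrAC ler_pdivlMr ?divr_gt0 // mulrC.
  have q1 : e' * `|hx| <= b / 2 * `|hx| by rewrite ler_wpM2r.
  have q2 : e' * `|k| <= b / 2 * `|k| by rewrite ler_wpM2r.
  have q3 : 0 <= `|a| * `|ht| by rewrite mulr_ge0.
  have q4 : 0 <= b / 2 * `|ht| by rewrite mulr_ge0 ?divr_ge0 // ltW.
  have := normr_ge0 hx; rewrite /N !mulrDr !mulrDl.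
  by move: bk; rewrite mulrDr; lra.
have -> : k - - (a / b) * hx - b^-1 * ht = - (b^-1 * (ht - a * hx - b * k)).
  by field; exact: lt0r_neq0.
rewrite normrN normrM gtr0_norm ?invr_gt0 // ler_pdivrMl //.
apply: le_trans HH _.
have e'N : e' * (`|hx| + `|k|) <= e' * ((1 + C) * N).
  rewrite ler_pM2l // mulrDl mul1r lerD // /N lerDl //.
apply: le_trans e'N _; rewrite mulrA [leRHS]mulrA [b * e]mulrC ler_wpM2r //.
by rewrite /N addr_ge0.
Qed.

(** The gradient of [nu] is a smooth expression in [nu] itself, so each
    derivative gained for [nu] yields the next one. *)
Lemma fiber_inverse_smooth : (forall k, Ck k setT mu) -> forall k, Ck k setT nu.
Proof.
move=> smu k.
have Cx k' : Ck k' setT mux.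
  have /(CkSP _ _ openT)[fx [fy [Gf Cf _]]] := smu k'.+1.
  by apply: Ck_congr Cf => [|p _]; [exact: openT|have [] := has_gradient_unique (Gf p I) (G p)].
have Cs k' : Ck k' setT mus.
  have /(CkSP _ _ openT)[fx [fy [Gf _ Cf]]] := smu k'.+1.
  by apply: Ck_congr Cf => [|p _]; [exact: openT|have [] := has_gradient_unique (Gf p I) (G p)].
elim: k => [|k IH]; first by split=> // p _; exact: fiber_inverse_continuous.
pose P (p : plane R) := (p.1, nu p).
have C1 : Ck k setT (mux \o P).
  by apply: (@Ck_comp _ _ _ setT) => //; [exact: openT|exact: openT|apply: Ck_fst; exact: openT].
have C2 : Ck k setT ((fun x => x^-1) \o (mus \o P)).
  apply: (@CkR_comp _ _ _ [set x | x != 0]) (CkR_inv k) _.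
  - exact: openT.
  - exact: open_neq.
  - by move=> p _ /=; exact: lt0r_neq0.
  - by apply: (@Ck_comp _ _ _ setT) => //; [exact: openT|exact: openT|apply: Ck_fst; exact: openT].
apply/(CkSP _ _ openT); exists (fun p => - ((mux \o P) p * ((fun x => x^-1) \o (mus \o P)) p)).
exists ((fun x => x^-1) \o (mus \o P)); split=> //.
- by move=> [x t] _; exact: fiber_inverse_gradient.
- by apply: CkN; [exact: openT|apply: CkM => //; exact: openT].
Qed.

End Inverse.
End FiberInverse.

(** * Diffeomorphisms between subsets of the plane *)

Section Diffeos.
Context {R : realType}.
Implicit Types (f g F G : plane R -> plane R) (p : plane R) (A B C U V : set (plane R)).

Definition smooth_map U F :=
  forall k, Ck k U (fun q => (F q).1) /\ Ck k U (fun q => (F q).2).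

Lemma smooth_map_on U A F : open U -> A `<=` U -> smooth_map U F -> smooth_on A F.
Proof. by move=> Uo AU sF p Ap; exists U, F; split=> //; exact: AU. Qed.

Lemma continuous_pairE F p : {for p, continuous (fun q => (F q).1)} ->
  {for p, continuous (fun q => (F q).2)} -> {for p, continuous F}.
Proof.
move=> c1 c2; apply: (@for_continuous_near _ _ (fun q => ((F q).1, (F q).2))).
  by exists (setT, setT) => [|q _ /=]; [split; exact: filterT|rewrite -surjective_pairing].
exact: (cvg_pair c1 c2).
Qed.

Lemma smooth_map_continuous U F p : smooth_map U F -> U p -> {for p, continuous F}.
Proof.
move=> sF Up; have [C1 C2] := sF 0%N.
by apply: continuous_pairE; [exact: (Ck_continuous C1)|exact: (Ck_continuous C2)].
Qed.

Lemma open_smooth_preimage U V F : open U -> open V -> smooth_map U F ->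
  open (U `&` F @^-1` V).
Proof.
move=> Uo Vo sF; rewrite openE => p [Up Vp]; rewrite /interior.
apply: filterI; first exact: open_nbhs_nbhs.
apply: (smooth_map_continuous sF Up); exact: open_nbhs_nbhs.
Qed.

Lemma smooth_map_comp U V F G : open U -> open V -> (forall p, U p -> V (F p)) ->
  smooth_map U F -> smooth_map V G -> smooth_map U (G \o F).
Proof.
move=> Uo Vo UV sF sG k; have [F1 F2] := sF k; have [G1 G2] := sG k.
split; first exact: (Ck_comp Uo Vo UV G1 F1 F2).
exact: (Ck_comp Uo Vo UV G2 F1 F2).
Qed.

Lemma smooth_on_comp A B f g : (forall p, A p -> B (f p)) ->
  smooth_on A f -> smooth_on B g -> smooth_on A (g \o f).
Proof.
move=> AB sf sg p Ap.
have [U [F [Uo Up sF Ff]]] := sf p Ap.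
have [V [G [Vo Vp sG Gg]]] := sg (f p) (AB _ Ap).
exists (U `&` F @^-1` V), (G \o F).
have oW := open_smooth_preimage Uo Vo sF; split=> //.
- by split=> //=; rewrite Ff.
- have sF' : smooth_map (U `&` F @^-1` V) F.
    by move=> k; have [? ?] := sF k; split; apply: (@Ck_sub _ _ U) => // ? [].
  by apply: smooth_map_comp sF' sG => // q [].
- by move=> q [Uq Vq] Aq /=; rewrite Ff // Gg; [|rewrite -Ff|exact: AB].
Qed.

Lemma smooth_on_within A f p W : smooth_on A f -> A p -> nbhs (f p) W ->
  nbhs p [set q | A q -> W (f q)].
Proof.
move=> sf Ap nW; have [U [F [Uo Up sF Ff]]] := sf p Ap.
have cF : F @ p --> F p := smooth_map_continuous sF Up.
rewrite Ff // in cF; have N : nbhs p (F @^-1` W) := cF _ nW.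
have NU : nbhs p U by exact: open_nbhs_nbhs.
by apply: filterS2 N NU => q /= WF Uq Aq; rewrite -Ff.
Qed.

Lemma smooth_on_continuous A f : smooth_on A f -> {within A, continuous f}.
Proof.
move=> sf; apply/subspace_continuousP => p Ap W nW.
rewrite /nbhs /= /within /=; exact: smooth_on_within.
Qed.

Lemma smooth_on_gradient A f p : smooth_on A f -> nbhs p A ->
  exists a1 b1 a2 b2, has_gradient (fun q => (f q).1) p a1 b1 /\
    has_gradient (fun q => (f q).2) p a2 b2.
Proof.
move=> sf nA; have [U [F [Uo Up sF Ff]]] := sf p (nbhs_singleton nA).
have [C1 C2] := sF 1%N.
have NU : nbhs p U by exact: open_nbhs_nbhs.
have N i : \forall q \near p, (if i then (F q).1 else (F q).2) = (if i then (f q).1 else (f q).2).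
  by apply: filterS2 nA NU => q Aq Uq /=; rewrite Ff.
have g1 := has_gradient_near (N true) (Ck_gradient Uo Up C1).
have g2 := has_gradient_near (N false) (Ck_gradient Uo Up C2).
by do 4!eexists; split; [exact: g1|exact: g2].
Qed.

Lemma inverse_diffeos_sym A B f g : inverse_diffeos A B f g -> inverse_diffeos B A g f.
Proof. by move=> [[? ?] ? ? ? ?]; split. Qed.

Lemma inverse_diffeos_comp A B C f f' g g' : inverse_diffeos A B f f' ->
  inverse_diffeos B C g g' -> inverse_diffeos A C (g \o f) (f' \o g').
Proof.
move=> [[AB BA] ff' f'f sf sf'] [[BC CB] gg' g'g sg sg'].
split.
- by split=> p /=; auto.
- by move=> p Ap /=; rewrite gg' ?ff' //; exact: AB.
- by move=> p Cp /=; rewrite f'f ?g'g //; exact: CB.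
- exact: (smooth_on_comp AB sf sg).
- exact: (smooth_on_comp CB sg' sf').
Qed.

(** Fermat's rule, tested along the two coordinate directions. *)
Lemma minimum_gradient (h : plane R -> R) p a b : has_gradient h p a b ->
  (\forall q \near p, h p <= h q) -> a = 0 /\ b = 0.
Proof.
move=> /has_gradient_epsP G /nbhs_planeP[r r0 M].
have key (c : R) : (forall e, 0 < e -> exists2 d : R, 0 < d &
    forall t, `|t| < d -> c * t >= - (e * `|t|)) -> c = 0.
  move=> H; apply/eqP; rewrite -normr_eq0 eq_le normr_ge0 andbT leNgt; apply/negP => c0.
  have [d d0 {}H] := H (`|c| / 2) (divr_gt0 c0 (ltr0Sn _ _)).
  have d20 : 0 < d / 2 by rewrite divr_gt0.
  have [cp|cn] := leP 0 c.
    have := H (- (d / 2)); rewrite normrN gtr0_norm // ger0_norm // => /(_ _).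
    rewrite mulrN lerN2; move: c0; rewrite ger0_norm // => c0.
    have P : 0 < c * (d / 2) by rewrite mulr_gt0.
    by move=> /(_ ltac:(lra)); lra.
  have := H (d / 2); rewrite gtr0_norm // ltr0_norm //.
  have P : c * (d / 2) < 0 by rewrite nmulr_rlt0.
  by move=> /(_ ltac:(lra)); lra.
split; apply: key => e e0; have [d d0 H] := G e e0.
- exists (Num.min d r) => [|t]; rewrite lt_min ?d0 // => /andP[td tr].
  have := H (p.1 + t, p.2); have := M (p.1 + t, p.2).
  have -> : (p.1 + t, p.2).1 - p.1 = t by rewrite /=; ring.
  rewrite /= subrr normr0 mulr0 subr0 addr0.
  by move=> /(_ tr r0) h1 /(_ td d0); rewrite ler_norml => /andP[h2 h3]; lra.
- exists (Num.min d r) => [|t]; rewrite lt_min ?d0 // => /andP[td tr].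
  have := H (p.1, p.2 + t); have := M (p.1, p.2 + t).
  have -> : (p.1, p.2 + t).2 - p.2 = t by rewrite /=; ring.
  rewrite /= subrr normr0 mulr0 subr0 add0r.
  by move=> /(_ r0 tr) h1 /(_ d0 td); rewrite ler_norml => /andP[h2 h3]; lra.
Qed.

(** A local minimum of [rho \o g] occurs at [z], so the gradient of [rho \o g]
    vanishes there; the Jacobian of [g] at [z] is invertible, as [f \o g] is the
    identity near [z]. Applied to a defining function [rho] of the boundary,
    this keeps boundary points away from interior points. *)
Lemma diffeo_boundary_gradient A B f g (rho : plane R -> R) z a b :
  inverse_diffeos A B f g -> nbhs z B -> has_gradient rho (g z) a b ->
  (forall p, A p -> 0 <= rho p) -> rho (g z) = 0 -> a = 0 /\ b = 0.
Proof.
move=> [[AB BA] gf fg sf sg] nB Gr pos r0.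
have Bz := nbhs_singleton nB.
have [a1 [b1 [a2 [b2 [G1 G2]]]]] := smooth_on_gradient sg nB.
have [U [F [Uo Up sF Ff]]] := sf (g z) (BA _ Bz).
have [C1 C2] := sF 1%N.
have F1 := Ck_gradient Uo Up C1; have F2 := Ck_gradient Uo Up C2.
set c1 := 'D__ _ _ in F1; set d1 := 'D__ _ _ in F1.
set c2 := 'D__ _ _ in F2; set d2 := 'D__ _ _ in F2.
have cg : nbhs z [set w | B w -> U (g w)].
  by apply: smooth_on_within sg Bz _; exact: open_nbhs_nbhs.
have N i : \forall w \near z, (if i then (F (g w)).1 else (F (g w)).2) = (if i then w.1 else w.2).
  apply: filterS2 nB cg => w Bw /(_ Bw) Uw /=.
  by rewrite Ff // ?fg //; exact: BA.
have E1 := has_gradient_near (N true) (has_gradient_comp F1 G1 G2).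
have E2 := has_gradient_near (N false) (has_gradient_comp F2 G1 G2).
have [e11 e12] := has_gradient_unique E1 (has_gradient_fst z).
have [e21 e22] := has_gradient_unique E2 (has_gradient_snd z).
have E3 := has_gradient_comp Gr G1 G2.
have [] := minimum_gradient E3.
  by apply: filterS nB => w Bw /=; rewrite r0; apply: pos; exact: BA.
move=> m1 m2.
have det : (c1 * d2 - d1 * c2) * (a1 * b2 - a2 * b1) = 1.
  transitivity ((c1 * a1 + d1 * a2) * (c2 * b1 + d2 * b2) -
                (c1 * b1 + d1 * b2) * (c2 * a1 + d2 * a2)); first by ring.
  by rewrite e11 e12 e21 e22; ring.
split.
- transitivity ((c1 * d2 - d1 * c2) * ((a * a1 + b * a2) * b2 - (a * b1 + b * b2) * a2)).
    rewrite -[LHS]mulr1 -det; ring.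
  by rewrite m1 m2; ring.
- transitivity ((c1 * d2 - d1 * c2) * ((a * b1 + b * b2) * a1 - (a * a1 + b * a2) * b1)).
    rewrite -[LHS]mulr1 -det; ring.
  by rewrite m1 m2; ring.
Qed.

End Diffeos.

(** * Sides and horocycles of the ideal triangle *)

Definition i0 : 'I_3 := Ordinal (isT : 0 < 3)%N.
Definition i1 : 'I_3 := Ordinal (isT : 1 < 3)%N.
Definition i2 : 'I_3 := Ordinal (isT : 2 < 3)%N.

(** The cyclic order of the cusps; side [i], opposite to cusp [i], joins the
    cusps [nxt i] and [nxt (nxt i)]. *)
Definition nxt (i : 'I_3) : 'I_3 :=
  match val i with 0 => i1 | 1 => i2 | _ => i0 end.

Lemma ord3P (P : 'I_3 -> Prop) : P i0 -> P i1 -> P i2 -> forall i, P i.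
Proof.
move=> h0 h1 h2 [[|[|[|//]]] lt].
- by rewrite (_ : Ordinal lt = i0) //; apply: val_inj.
- by rewrite (_ : Ordinal lt = i1) //; apply: val_inj.
- by rewrite (_ : Ordinal lt = i2) //; apply: val_inj.
Qed.

Lemma nxt3 i : nxt (nxt (nxt i)) = i. Proof. by move: i; apply: ord3P. Qed.
Lemma nxt_neq i : nxt i != i. Proof. by move: i; apply: ord3P. Qed.
Lemma nxt2_neq i : nxt (nxt i) != i. Proof. by move: i; apply: ord3P. Qed.
Lemma ord3_neq i j : j != i -> j = nxt i \/ j = nxt (nxt i).
Proof. by move: i j; do 2![apply: ord3P] => //; by [left|right]. Qed.

Lemma ord3_pair i j k : i != j -> i != k -> j != k ->
  j = nxt i /\ k = nxt (nxt i) \/ j = nxt (nxt i) /\ k = nxt i.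
Proof. by move: i j k; do 3![apply: ord3P] => //; by [left|right]. Qed.

Section IdealTriangle.
Context {R : realType}.
Implicit Types (p q : plane R) (i j k : 'I_3).

(** Defining functions of the sides, for the labelling 0, 1, infinity of the
    cusps. *)
Definition side i p : R :=
  match val i with 0 => 1 - p.1 | 1 => p.1 | _ => p.1 ^+ 2 - p.1 + p.2 ^+ 2 end.

(** The squared distance to the cusp [j] when it is finite, so that [height j]
    is the imaginary part after a symmetry of the triangle that moves [j] to
    infinity. *)
Definition horo j p : R :=
  match val j with 0 => p.1 ^+ 2 + p.2 ^+ 2 | 1 => (1 - p.1) ^+ 2 + p.2 ^+ 2 | _ => 1 end.

Definition height j p : R := p.2 / horo j p.

(** On a side that ends at cusp [j] this is an arc length parameter. *)
Definition busemann j p : R := ln (height j p).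

Lemma ideal_sideP p : ideal_triangle p <-> 0 < p.2 /\ forall i, 0 <= side i p.
Proof.
have E : ((2^-1) ^+ 2 <= (p.1 - 2^-1) ^+ 2 + p.2 ^+ 2) = (0 <= side i2 p).
  rewrite /side /=; have : ((2^-1) ^+ 2 : R) = 4^-1 by field.
  move=> ->; rewrite (_ : (p.1 - 2^-1) ^+ 2 = p.1 ^+ 2 - p.1 + 4^-1); last by field.
  by apply/idP/idP; lra.
split=> [[h1 h2 h3 h4]|[h3 H]].
  split=> //; apply: ord3P; rewrite -?E // /side /=; lra.
split=> //; last by rewrite E.
  by have := H i1.
by have := H i0; rewrite /side /= subr_ge0.
Qed.

Lemma ideal_y p : ideal_triangle p -> 0 < p.2. Proof. by case. Qed.

Lemma horo_gt0 j p : 0 < p.2 -> 0 < horo j p.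
Proof.
move=> y0; move: j; apply: ord3P; rewrite /horo //=.
  by rewrite ltr_wpDl ?sqr_ge0 ?exprn_gt0.
by rewrite ltr_wpDl ?sqr_ge0 ?exprn_gt0.
Qed.

Lemma height_gt0 j p : 0 < p.2 -> 0 < height j p.
Proof. by move=> y0; rewrite divr_gt0 ?horo_gt0. Qed.

Lemma height2 p : height i2 p = p.2. Proof. by rewrite /height /horo /= divr1. Qed.

Lemma horoM i p : horo (nxt i) p * horo (nxt (nxt i)) p = p.2 ^+ 2 + side i p ^+ 2.
Proof. by move: i; apply: ord3P; rewrite /horo /side /=; ring. Qed.

Lemma sideM p : side i0 p * side i1 p + (side i0 p + side i1 p) * side i2 p = p.2 ^+ 2.
Proof. by rewrite /side /=; ring. Qed.

Lemma heightM i p : 0 < p.2 ->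
  height (nxt i) p * height (nxt (nxt i)) p = p.2 ^+ 2 / (p.2 ^+ 2 + side i p ^+ 2).
Proof. by move=> y0; rewrite /height mulrACA -invfM horoM expr2. Qed.

Lemma heightM_le1 j k p : 0 < p.2 -> j != k -> height j p * height k p <= 1.
Proof.
move=> y0; wlog -> : j k / k = nxt j.
  move=> H jk; have [e|e] := ord3_neq jk.
    by rewrite mulrC; apply: H => //; rewrite eq_sym.
  by apply: H => //; rewrite e nxt3.
move=> _; have := heightM (nxt (nxt j)) y0; rewrite !nxt3 => ->.
have y2 : 0 < p.2 ^+ 2 by rewrite exprn_gt0.
by rewrite ler_pdivrMr ?mul1r ?lerDl ?sqr_ge0 // ltr_wpDr ?sqr_ge0.
Qed.

(** The horocycles of height h at one cusp and of height 1/h at another are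
    tangent, and their point of tangency lies on the side that joins the two
    cusps. *)
Lemma side_eq0P i j k p : 0 < p.2 -> i != j -> i != k -> j != k ->
  side i p = 0 <-> height j p * height k p = 1.
Proof.
move=> y0.
have y2 : 0 < p.2 ^+ 2 by rewrite exprn_gt0.
move=> ij ik jk.
have -> : height j p * height k p = p.2 ^+ 2 / (p.2 ^+ 2 + side i p ^+ 2).
  by rewrite -heightM //; have [[-> ->]|[-> ->]] := ord3_pair ij ik jk; rewrite // mulrC.
have d0 : p.2 ^+ 2 + side i p ^+ 2 != 0.
  by rewrite gt_eqF // ltr_wpDr ?sqr_ge0.
split=> [->|/(congr1 ( *%R^~ (p.2 ^+ 2 + side i p ^+ 2)))].
  by rewrite expr0n addr0 divff // gt_eqF.
rewrite /= divfK // mul1r => /eqP; rewrite -subr_eq0 opprD addrA subrr add0r oppr_eq0.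
by rewrite sqrf_eq0 => /eqP.
Qed.

Definition ideal_edge i : set (plane R) := [set p | ideal_triangle p /\ side i p = 0].

Lemma ideal_edge_inj i j p q : j != i -> ideal_edge i p -> ideal_edge i q ->
  height j p = height j q -> p = q.
Proof.
case: p q => [x y] [x' y'] ji [/ideal_y /= y0 s] [/ideal_y /= y'0 s'].
have c0 z w : 0 < w -> z ^+ 2 - z + w ^+ 2 = 0 -> 0 < z /\ 0 < 1 - z :> R.
  move=> w0 e; have w2 : 0 < w ^+ 2 by rewrite exprn_gt0.
  have zz : 0 < z * (1 - z) by nra.
  have [z0|z0] := ltP 0 z; first by split=> //; move: zz; rewrite pmulr_rgt0.
  have : 1 - z <= 0 -> False by lra.
  by move: zz; nra.
move: i j ji s s'; do 2![apply: ord3P] => //= _; rewrite /side /height /horo /= ?divr1.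
- move=> s s'; have -> : x = 1 by lra. have -> : x' = 1 by lra.
  rewrite subrr expr0n add0r expr2 invfM mulrA divff ?gt_eqF // mul1r.
  rewrite add0r [y' ^+ 2]expr2 invfM mulrA divff ?gt_eqF // mul1r.
  by move/invr_inj ->.
- by move=> s s' ->; congr pair; lra.
- move=> -> ->; rewrite expr0n !add0r !expr2 !invfM !mulrA !divff ?gt_eqF // !mul1r.
  by move/invr_inj ->.
- by move=> -> -> ->.
- move=> s s'; have [x0 x1] := c0 _ _ y0 s; have [x'0 x'1] := c0 _ _ y'0 s'.
  have -> : x ^+ 2 + y ^+ 2 = x by lra.
  have -> : x' ^+ 2 + y' ^+ 2 = x' by lra.
  move=> e.
  have : (y / x) ^+ 2 = (y' / x') ^+ 2 by rewrite e.
  have -> : (y / x) ^+ 2 = x^-1 - 1.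
    by rewrite expr_div_n (_ : y ^+ 2 = x - x ^+ 2); [field; rewrite gt_eqF|lra].
  have -> : (y' / x') ^+ 2 = x'^-1 - 1.
    by rewrite expr_div_n (_ : y' ^+ 2 = x' - x' ^+ 2); [field; rewrite gt_eqF|lra].
  move=> /addIr /invr_inj ex; move: e; rewrite -ex => /(congr1 ( *%R^~ x)).
  by rewrite !divfK ?gt_eqF // => ->.
- move=> s s'; have [x0 x1] := c0 _ _ y0 s; have [x'0 x'1] := c0 _ _ y'0 s'.
  have -> : (1 - x) ^+ 2 + y ^+ 2 = 1 - x by lra.
  have -> : (1 - x') ^+ 2 + y' ^+ 2 = 1 - x' by lra.
  move=> e.
  have : (y / (1 - x)) ^+ 2 = (y' / (1 - x')) ^+ 2 by rewrite e.
  have -> : (y / (1 - x)) ^+ 2 = (1 - x)^-1 - 1.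
    by rewrite expr_div_n (_ : y ^+ 2 = x - x ^+ 2); [field; rewrite gt_eqF|lra].
  have -> : (y' / (1 - x')) ^+ 2 = (1 - x')^-1 - 1.
    by rewrite expr_div_n (_ : y' ^+ 2 = x' - x' ^+ 2); [field; rewrite gt_eqF|lra].
  move=> /addIr /invr_inj ex; have {}ex : x = x' by lra.
  move: e; rewrite -ex => /(congr1 ( *%R^~ (1 - x))).
  by rewrite !divfK ?gt_eqF // => ->.
Qed.

Lemma side_gradient i p : 0 < p.2 ->
  exists a b, has_gradient (side i) p a b /\ (a != 0 \/ b != 0).
Proof.
move=> y0; move: i; apply: ord3P.
- exists (0 + -1 * 1), (0 + -1 * 0); split; last by left; rewrite add0r mulr1 oppr_eq0 oner_eq0.
  have := has_gradientD (has_gradient_cst 1 p) (has_gradientM (has_gradient_cst (-1) p) (has_gradient_fst p)).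
  rewrite !mulr0 !addr0.
  by congr has_gradient; apply/funext => q; rewrite /side /= mulN1r.
- exists 1, 0; split; last by left; exact: oner_neq0.
  exact: has_gradient_fst.
- have := has_gradientD (has_gradientD (has_gradientM (has_gradient_fst p) (has_gradient_fst p))
    (has_gradientM (has_gradient_cst (-1) p) (has_gradient_fst p)))
    (has_gradientM (has_gradient_snd p) (has_gradient_snd p)).
  set a := (X in has_gradient _ _ X _); set b := (X in has_gradient _ _ _ X) => G.
  exists a, b; split; last by right; rewrite /b; apply: lt0r_neq0; lra.
  by move: G; congr has_gradient; apply/funext => q; rewrite /side /= mulN1r !expr2.
Qed.

Lemma open_side_gt0 p : 0 < p.2 -> (forall i, 0 < side i p) -> nbhs p (@ideal_triangle R).
Proof.
move=> y0 s0.
have N (f : plane R -> R) : {for p, continuous f} -> 0 < f p -> \forall q \near p, 0 < f q.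
  move=> /continuous_planeP cf fp; have [d d0 H] := cf (f p) fp.
  apply/nbhs_planeP; exists d => // q h1 h2; have := H q h1 h2.
  by rewrite ltr_norml => /andP[? _]; lra.
have Ns i : \forall q \near p, 0 < side i q.
  apply: N (s0 i); have [a [b [G _]]] := side_gradient i y0.
  exact: has_gradient_continuous G.
have Ny : \forall q \near p, 0 < q.2.
  exact: (N snd (has_gradient_continuous (has_gradient_snd p)) y0).
near=> q; apply/ideal_sideP; split; first by near: q.
by apply: ord3P; apply: ltW; near: q; exact: Ns.
Unshelve. all: by end_near. Qed.

(** The sides are zero sets of functions without critical points, so
    [diffeo_boundary_gradient] excludes that an interior point is sent to a
    side. *)
Lemma diffeo_interior A f g p : inverse_diffeos A (@ideal_triangle R) f g ->
  nbhs p A -> nbhs (f p) (@ideal_triangle R).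
Proof.
move=> D nA; have [[AB BA] _ _ _ _] := D.
have Bp := AB _ (nbhs_singleton nA).
have [y0 s0] := (ideal_sideP _).1 Bp.
apply: open_side_gt0 => // i; rewrite lt_neqAle s0 andbT eq_sym; apply/eqP => si.
have [a [b [G ab]]] := side_gradient i y0.
have [a0 b0] : a = 0 /\ b = 0.
  apply: (diffeo_boundary_gradient (inverse_diffeos_sym D) nA G _ si) => q.
  by move=> /ideal_sideP[].
by move: ab; rewrite a0 b0 eqxx; case.
Qed.

Lemma ideal_interiorP p : nbhs p (@ideal_triangle R) <-> 0 < p.2 /\ forall i, 0 < side i p.
Proof.
split=> [n|[]]; last exact: open_side_gt0.
have [y0 s0] := (ideal_sideP _).1 (nbhs_singleton n); split=> // i.
rewrite lt_neqAle s0 andbT eq_sym; apply/eqP => si.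
have [a [b [G ab]]] := side_gradient i y0.
have [|a0 b0] := minimum_gradient G.
  by apply: filterS n => q /ideal_sideP[_ /(_ i)]; rewrite si.
by move: ab; rewrite a0 b0 eqxx; case.
Qed.

End IdealTriangle.

(** * Bounded energy density and symmetries of the ideal triangle *)

Section Symmetries.
Context {R : realType}.
Implicit Types (p q : plane R) (i j k : 'I_3) (f g : plane R -> plane R).
Local Notation ideal := (@ideal_triangle R).

Definition upper : set (plane R) := [set p | 0 < p.2].

Lemma open_upper : open upper.
Proof.
have Io : open [set x : R | 0 < x] by exact: open_gt.
exact: (open_snd Io).
Qed.

Lemma ideal_upper : ideal `<=` upper. Proof. by move=> p /ideal_y. Qed.

(** The energy density of f is at most C, with denominators cleared. The
    condition is on interior points, over which the energy is an integral. *)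
Definition bounded_density f (C : R) := forall p, nbhs p ideal ->
  exists a1 b1 a2 b2, [/\ has_gradient (fun q => (f q).1) p a1 b1,
    has_gradient (fun q => (f q).2) p a2 b2 &
    p.2 ^+ 2 * (a1 ^+ 2 + b1 ^+ 2 + a2 ^+ 2 + b2 ^+ 2) <= C * (f p).2 ^+ 2].

Definition ideal_diffeo f g :=
  inverse_diffeos ideal ideal f g /\ exists2 C, 0 <= C & bounded_density f C.

Lemma near_on (A : set (plane R)) p (P : plane R -> Prop) : nbhs p A -> (forall q, A q -> P q) ->
  \forall q \near p, P q.
Proof. by move=> nA AP; apply: filterS nA. Qed.

Lemma bounded_density_eq f g C : (forall p, ideal p -> f p = g p) ->
  bounded_density f C -> bounded_density g C.
Proof.
move=> fg H p n; have [a1 [b1 [a2 [b2 [G1 G2 B]]]]] := H p n.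
exists a1, b1, a2, b2; split.
- by apply: has_gradient_near G1; apply: near_on n _ => q /fg ->.
- by apply: has_gradient_near G2; apply: near_on n _ => q /fg ->.
- by rewrite -fg //; exact: nbhs_singleton.
Qed.

(** The squared norm of a product of matrices is at most the product of the
    squared norms, by the Cauchy-Schwarz inequality. *)
Lemma bounded_density_comp f g C D : (forall p, nbhs p ideal -> nbhs (f p) ideal) ->
  0 <= C -> 0 <= D ->
  bounded_density f C -> bounded_density g D -> bounded_density (g \o f) (D * C).
Proof.
move=> fi C0 D0 Hf Hg p n.
have [a1 [b1 [a2 [b2 [G1 G2 B]]]]] := Hf p n.
have [c1 [d1 [c2 [d2 [K1 K2 B']]]]] := Hg (f p) (fi p n).
do 4!eexists; split.
- exact: (has_gradient_comp K1 G1 G2).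
- exact: (has_gradient_comp K2 G1 G2).
have y0 : 0 < p.2 by exact: (ideal_y (nbhs_singleton n)).
have z0 : 0 < (f p).2 by exact: (ideal_y (nbhs_singleton (fi p n))).
have CS (c d a a' b b' : R) : (c * a + d * b) ^+ 2 + (c * a' + d * b') ^+ 2 <=
    (c ^+ 2 + d ^+ 2) * (a ^+ 2 + a' ^+ 2 + b ^+ 2 + b' ^+ 2).
  rewrite -subr_ge0 (_ : _ - _ = (c * b - d * a) ^+ 2 + (c * b' - d * a') ^+ 2); last by ring.
  by rewrite addr_ge0 ?sqr_ge0.
set S := a1 ^+ 2 + b1 ^+ 2 + a2 ^+ 2 + b2 ^+ 2 in B.
set S' := c1 ^+ 2 + d1 ^+ 2 + c2 ^+ 2 + d2 ^+ 2 in B'.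
have S0 : 0 <= S by rewrite /S !addr_ge0 ?sqr_ge0.
set Q := (X in _ * X <= _).
have QS : Q <= S' * S.
  have h1 := CS c1 d1 a1 b1 a2 b2; have h2 := CS c2 d2 a1 b1 a2 b2.
  rewrite -/S in h1 h2.
  by rewrite /Q /S' -!addrA addrA (le_trans (lerD h1 h2)) // -mulrDl !addrA.
have z2 : 0 < (f p).2 ^+ 2 by rewrite exprn_gt0.
apply: (@le_trans _ _ (p.2 ^+ 2 * (S' * S))).
  by rewrite ler_wpM2l ?sqr_ge0.
rewrite -(ler_pM2l z2).
have -> : (f p).2 ^+ 2 * (p.2 ^+ 2 * (S' * S)) = ((f p).2 ^+ 2 * S') * (p.2 ^+ 2 * S) by ring.
apply: le_trans (ler_pM _ _ B' B) _.
- by rewrite mulr_ge0 ?sqr_ge0 // /S' !addr_ge0 ?sqr_ge0.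
- by rewrite mulr_ge0 ?sqr_ge0.
- by rewrite /= le_eqVlt; apply/orP; left; apply/eqP; ring.
Qed.

Lemma ideal_diffeo_comp f f' g g' : ideal_diffeo f f' -> ideal_diffeo g g' ->
  ideal_diffeo (g \o f) (f' \o g').
Proof.
move=> [D1 [C C0 B1]] [D2 [C' C'0 B2]]; split; first exact: (inverse_diffeos_comp D1 D2).
exists (C' * C); first by rewrite mulr_ge0.
by apply: bounded_density_comp => // p; apply: diffeo_interior D1.
Qed.

Lemma ideal_diffeo_id : ideal_diffeo id id.
Proof.
split.
  have s : smooth_on ideal id.
    apply: (smooth_map_on open_upper ideal_upper) => k; split.
      by apply: Ck_fst; exact: open_upper.
    by apply: Ck_snd; exact: open_upper.
  by split.
exists 2 => // p _; exists 1, 0, 0, 1; split.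
- exact: has_gradient_fst.
- exact: has_gradient_snd.
- by rewrite expr1n expr0n /= !addr0 mulrC.
Qed.

Lemma ideal_diffeo_image f g p : ideal_diffeo f g -> ideal p -> ideal (f p).
Proof. by move=> [[[H _] _ _ _ _] _]; exact: H. Qed.

Lemma Ck_horo j (k : nat) U : open U -> Ck k U (@horo R j).
Proof.
move=> o; have Csq (f : plane R -> R) : Ck k U f -> Ck k U (fun p => f p ^+ 2 + p.2 ^+ 2).
  by move=> C; exact: (CkD o (CkM o C C) (CkM o (Ck_snd k o) (Ck_snd k o))).
move: j; apply: ord3P; last exact: Ck_cst.
  by apply: Csq; exact: Ck_fst.
by apply: Csq; apply: CkB => //; [exact: Ck_cst|exact: Ck_fst].
Qed.

(** The rotation z |-> 1 / (1 - z), which sends the cusps 0, 1, infinity to 1,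
    infinity, 0. *)
Definition rot p : plane R := ((1 - p.1) / horo i1 p, p.2 / horo i1 p).

Lemma rot_upper p : upper p -> upper (rot p).
Proof. by move=> y0; rewrite /upper /= divr_gt0 // horo_gt0. Qed.

Lemma rot_side i p : upper p -> side (nxt i) (rot p) = side i p / horo i1 p.
Proof.
move=> y0; have := horo_gt0 i1 y0; rewrite /rot; set N := horo i1 p.
have NE : N = (1 - p.1) ^+ 2 + p.2 ^+ 2 by [].
move=> N0; have N0' : N != 0 by rewrite gt_eqF.
move: i; apply: ord3P; rewrite /side /= //.
  transitivity (((1 - p.1) ^+ 2 + p.2 ^+ 2) / N ^+ 2 - (1 - p.1) / N); first by field.
  by rewrite -NE; field.
by apply: (mulIf N0'); rewrite mulrBl !divfK // mul1r NE; ring.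
Qed.

Lemma rot_horo j p : upper p -> horo (nxt j) (rot p) = horo j p / horo i1 p.
Proof.
move=> y0; have := horo_gt0 i1 y0; rewrite /rot.
case: p y0 => x y /= y0.
rewrite /horo /=; move: j; apply: ord3P; rewrite /= => N0; move/lt0r_neq0 : (N0) => N0'.
- by field.
- by rewrite divff.
- by field.
Qed.

Lemma rot_height j p : upper p -> height (nxt j) (rot p) = height j p.
Proof.
move=> y0; rewrite /height rot_horo //= invf_div mulrA divfK //.
by rewrite gt_eqF ?horo_gt0.
Qed.

Lemma rot_ideal p : ideal p -> ideal (rot p).
Proof.
move=> /ideal_sideP[y0 s]; apply/ideal_sideP; split; first exact: rot_upper.
move=> i; rewrite -(nxt3 i) rot_side // divr_ge0 // ltW // horo_gt0 //.
Qed.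

Lemma rot_smooth : smooth_map upper rot.
Proof.
have o := open_upper.
move=> k.
have Cv : Ck k upper (fun p => (horo i1 p)^-1).
  have h0 p : upper p -> horo i1 p != 0 by move=> y0; rewrite gt_eqF ?horo_gt0.
  exact: (Ck_inv o h0 (Ck_horo i1 k o)).
split; apply: (CkM o _ Cv).
- by apply: CkB => //; [exact: Ck_cst|exact: Ck_fst].
- exact: Ck_snd.
Qed.

Lemma rotK p : upper p -> rot (rot (rot p)) = p.
Proof.
move=> y0; rewrite /rot.
have N1 := horo_gt0 i1 y0; have N0 := horo_gt0 i0 y0.
have E1 := rot_horo i0 y0; rewrite /= in E1.
have y1 := rot_upper y0.
have E2 : horo i1 (rot (rot p)) = (horo i0 p)^-1.
  rewrite (rot_horo i0 y1) E1 (rot_horo i2 y0) [horo i2 _]/horo /= mul1r invf_div.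
  by rewrite mulrA mulVf ?mul1r // gt_eqF.
rewrite -/(rot p) -/(rot (rot p)) E2 /= E1 /=.
case: p y0 N1 N0 {E1 E2 y1} => x y /= y0; rewrite /horo /= => N1 N0.
by congr pair; field; rewrite ?gt_eqF.
Qed.

Lemma has_gradient_affine (a b c : R) p : has_gradient (fun q => c + (a * q.1 + b * q.2)) p a b.
Proof.
have := has_gradientD (has_gradient_cst c p) (has_gradient_linear a b p).
by rewrite !add0r.
Qed.

Lemma has_gradient_1B p : has_gradient (fun q : plane R => 1 - q.1) p (-1) 0.
Proof.
have := has_gradient_affine (-1) 0 1 p.
by congr has_gradient; apply/funext => q; rewrite mulN1r mul0r addr0.
Qed.

Lemma has_gradient_sqr (f : plane R -> R) p a b : has_gradient f p a b ->
  has_gradient (fun q => f q ^+ 2 + q.2 ^+ 2) p (2 * f p * a) (2 * f p * b + 2 * p.2).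
Proof.
move=> G.
have := has_gradientD (has_gradientM G G) (has_gradientM (has_gradient_snd p) (has_gradient_snd p)).
by congr has_gradient; ring.
Qed.

(** [rot] is holomorphic, with derivative 1 / (1 - z) ^ 2. *)
Lemma rot_gradient p : upper p -> exists a b,
  [/\ has_gradient (fun q => (rot q).1) p a b, has_gradient (fun q => (rot q).2) p (- b) a &
      a ^+ 2 + b ^+ 2 = (horo i1 p ^+ 2)^-1].
Proof.
move=> y0; have N0 := horo_gt0 i1 y0; have Nn0 := lt0r_neq0 N0.
have GV := @has_gradientV _ (horo i1) _ _ _ (has_gradient_sqr (has_gradient_1B p)) Nn0.
exists (((1 - p.1) ^+ 2 - p.2 ^+ 2) / horo i1 p ^+ 2), (- (2 * p.2 * (1 - p.1)) / horo i1 p ^+ 2); split.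
- have := has_gradientM (has_gradient_1B p) GV; congr has_gradient; move: Nn0; rewrite /horo /= => Nn0; field; exact: Nn0.
- have := has_gradientM (has_gradient_snd p) GV; congr has_gradient; move: Nn0; rewrite /horo /= => Nn0; field; exact: Nn0.
- move: Nn0; rewrite /horo /= => Nn0; field; exact: Nn0.
Qed.

Lemma rot_bounded : bounded_density rot 2.
Proof.
move=> p /nbhs_singleton /ideal_y y0; have [a [b [G1 G2 E]]] := rot_gradient y0.
exists a, b, (- b), a; split=> //.
rewrite /rot /= expr_div_n -E sqrrN le_eqVlt; apply/orP; left; apply/eqP; ring.
Qed.

Lemma inverse_diffeos_rot : inverse_diffeos ideal ideal rot (rot \o rot).
Proof.
have s := smooth_map_on open_upper ideal_upper rot_smooth.
split; last 2 first.
- exact: s.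
- exact: (smooth_on_comp rot_ideal s s).
- by split=> p /rot_ideal // /rot_ideal.
- by move=> p /ideal_upper; exact: rotK.
- by move=> p /ideal_upper; exact: rotK.
Qed.

Lemma ideal_diffeo_rot : ideal_diffeo rot (rot \o rot).
Proof. by split; [exact: inverse_diffeos_rot|exists 2 => //; exact: rot_bounded]. Qed.

Lemma ideal_diffeo_rot2 : ideal_diffeo (rot \o rot) rot.
Proof.
split; first exact: (inverse_diffeos_sym inverse_diffeos_rot).
have [_ [C C0 B]] := ideal_diffeo_comp ideal_diffeo_rot ideal_diffeo_rot.
by exists C.
Qed.

(** The reflection in the line Re z = 1/2, which exchanges the cusps 0 and 1. *)
Definition refl p : plane R := (1 - p.1, p.2).

Definition swap (i : 'I_3) : 'I_3 := match val i with 0 => i1 | 1 => i0 | _ => i2 end.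

Lemma refl_height j p : height (swap j) (refl p) = height j p.
Proof.
rewrite /height; congr (_ / _); move: j; apply: ord3P; rewrite /horo /=; ring.
Qed.

Lemma refl_ideal p : ideal p -> ideal (refl p).
Proof.
move=> /ideal_sideP[y0 s]; apply/ideal_sideP; split=> //.
have := s i0; have := s i1; have := s i2; rewrite /side /= => h2 h1 h0.
by apply: ord3P; rewrite /= ?opprB; lra.
Qed.

Lemma ideal_diffeo_refl : ideal_diffeo refl refl.
Proof.
have o := open_upper.
have s : smooth_on ideal refl.
  apply: (smooth_map_on o ideal_upper) => k; split; last by apply: Ck_snd.
  by apply: CkB => //; [exact: Ck_cst|exact: Ck_fst].
have K p : refl (refl p) = p by case: p => x y; rewrite /refl /= subKr.
split; first by split=> //; split=> p; exact: refl_ideal.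
exists 2 => // p _; exists (-1), 0, 0, 1; split.
- exact: has_gradient_1B.
- exact: has_gradient_snd.
- by rewrite sqrrN expr1n expr0n /= !addr0 mulrC.
Qed.

(** The rotation and the reflection generate the symmetric group of the three
    cusps. *)
Lemma ideal_symmetry (pi : 'I_3 -> 'I_3) : injective pi ->
  exists rho rho', [/\ ideal_diffeo rho rho', ideal_diffeo rho' rho &
    forall j p, ideal p -> height (pi j) (rho p) = height j p].
Proof.
move=> inj.
have n01 : pi i0 != pi i1 by apply/eqP => /inj.
have n02 : pi i0 != pi i2 by apply/eqP => /inj.
have n12 : pi i1 != pi i2 by apply/eqP => /inj.
have hh j p : ideal p -> height (nxt j) (rot p) = height j p.
  by move=> /ideal_upper; exact: rot_height.
have D1 := ideal_diffeo_rot; have D2 := ideal_diffeo_rot2; have D3 := ideal_diffeo_refl.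
have H rho rho' : ideal_diffeo rho rho' -> ideal_diffeo rho' rho ->
    (forall p, ideal p -> [/\ height (pi i0) (rho p) = height i0 p,
      height (pi i1) (rho p) = height i1 p & height (pi i2) (rho p) = height i2 p]) ->
    exists rho rho', [/\ ideal_diffeo rho rho', ideal_diffeo rho' rho &
    forall j p, ideal p -> height (pi j) (rho p) = height j p].
  move=> d d' h; exists rho, rho'; split=> //.
  by apply: ord3P => p /h[].
have : [\/ [\/ [/\ pi i0 = i0, pi i1 = i1 & pi i2 = i2],
            [/\ pi i0 = i1, pi i1 = i2 & pi i2 = i0] |
            [/\ pi i0 = i2, pi i1 = i0 & pi i2 = i1]],
            [/\ pi i0 = i1, pi i1 = i0 & pi i2 = i2] ,
            [/\ pi i0 = i2, pi i1 = i1 & pi i2 = i0] |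
            [/\ pi i0 = i0, pi i1 = i2 & pi i2 = i1]].
  move: n01 n02 n12; move: (pi i0) (pi i1) (pi i2); do 3![apply: ord3P] => // _ _ _.
  - by constructor 1; constructor 1.
  - by constructor 4.
  - by constructor 2.
  - by constructor 1; constructor 2.
  - by constructor 1; constructor 3.
  - by constructor 3.
move=> [[[e0 e1 e2]|[e0 e1 e2]|[e0 e1 e2]]|[e0 e1 e2]|[e0 e1 e2]|[e0 e1 e2]].
- by apply: (H _ _ ideal_diffeo_id ideal_diffeo_id) => p _; rewrite e0 e1 e2.
- by apply: (H _ _ D1 D2) => p ip; rewrite e0 e1 e2; split; [exact: (hh i0 _ ip)|exact: (hh i1 _ ip)|exact: (hh i2 _ ip)].
- apply: (H _ _ D2 D1) => p ip; rewrite e0 e1 e2.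
  have ip' := rot_ideal ip.
  split; [rewrite -(hh i0 _ ip); exact: (hh i1 _ ip')|rewrite -(hh i1 _ ip); exact: (hh i2 _ ip')|
    rewrite -(hh i2 _ ip); exact: (hh i0 _ ip')].
- apply: (H _ _ D3 D3) => p ip; rewrite e0 e1 e2.
  by split; [exact: (refl_height i0)|exact: (refl_height i1)|exact: (refl_height i2)].
- apply: (H _ _ (ideal_diffeo_comp D3 D1) (ideal_diffeo_comp D2 D3)) => p ip.
  rewrite e0 e1 e2 /=; have ip' := refl_ideal ip.
  split; [rewrite -(refl_height i0); exact: (hh i1 _ ip')|rewrite -(refl_height i1); exact: (hh i0 _ ip')|
    rewrite -(refl_height i2); exact: (hh i2 _ ip')].
- apply: (H _ _ (ideal_diffeo_comp D3 D2) (ideal_diffeo_comp D1 D3)) => p ip.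
  rewrite e0 e1 e2 /=; have ip' := refl_ideal ip; have ip'' := rot_ideal ip'.
  split; [exact: (etrans (etrans (hh i2 _ ip'') (hh i1 _ ip')) (refl_height i0 p))|
    exact: (etrans (etrans (hh i1 _ ip'') (hh i0 _ ip')) (refl_height i1 p))|
    exact: (etrans (etrans (hh i0 _ ip'') (hh i2 _ ip')) (refl_height i2 p))].
Qed.

End Symmetries.

(** * Lengths of horocycles and sides *)

Section Curves.
Context {R : realType}.
Implicit Types (p q : plane R) (i j : 'I_3) (c : R -> plane R) (f : plane R -> R).
Local Notation ideal := (@ideal_triangle R).
Local Notation upper := (@upper R).
Local Notation Dx := (fun f : plane R -> R => 'D_((1, 0) : plane R) f).
Local Notation Dy := (fun f : plane R -> R => 'D_((0, 1) : plane R) f).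
Local Notation cx c := (fun s => (c s).1).
Local Notation cy c := (fun s => (c s).2).

Lemma is_derive_curve f c t a b : has_gradient f (c t) a b ->
  derivable (cx c) t 1 -> derivable (cy c) t 1 ->
  is_derive t (1 : R) (fun s => f (c s)) (a * derive1 (cx c) t + b * derive1 (cy c) t).
Proof.
move=> /has_gradientP h D1 D2.
have h1 := differentiableP ((derivable1_diffP _ _).1 D1).
have h2 := differentiableP ((derivable1_diffP _ _).1 D2).
have h12 := is_diff_pair h1 h2.
rewrite (_ : (fun s => ((c s).1, (c s).2)) = c) in h12; last first.
  by apply/funext => s; rewrite -surjective_pairing.
have [d E] := is_diff_comp h12 h.
have D : derivable (f \o c) t 1 by apply: diff_derivable.
split=> //.
rewrite deriveE; last exact: d.
by rewrite E /= (deriv1E D1) (deriv1E D2) !scale1r.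
Qed.

Lemma curve_continuous c t : derivable (cx c) t 1 -> derivable (cy c) t 1 ->
  {for t, continuous c}.
Proof.
move=> /derivable1_diffP /differentiable_continuous h1 /derivable1_diffP /differentiable_continuous h2.
have E : (fun s => ((c s).1, (c s).2)) = c by apply/funext => s; rewrite -surjective_pairing.
rewrite -E; exact: (cvg_pair h1 h2).
Qed.

Definition curve_derivative f c t :=
  Dx f (c t) * derive1 (cx c) t + Dy f (c t) * derive1 (cy c) t.

Lemma is_derive_curveCk U f c t : open U -> Ck 2 U f -> U (c t) ->
  derivable (cx c) t 1 -> derivable (cy c) t 1 ->
  is_derive t (1 : R) (fun s => f (c s)) (curve_derivative f c t).
Proof. by move=> Uo Cf Uc; apply: is_derive_curve; exact: (Ck_gradient Uo Uc Cf). Qed.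

Lemma curve_derivative_continuous U f c t : open U -> Ck 2 U f -> U (c t) ->
  derivable (cx c) t 1 -> derivable (cy c) t 1 ->
  continuous (derive1 (cx c)) -> continuous (derive1 (cy c)) ->
  {for t, continuous (curve_derivative f c)}.
Proof.
move=> Uo [_ Cf] Uc d1 d2 c1 c2.
have [_ Cx] := Cf (1, 0) (or_introl erefl).
have [_ Cy] := Cf (0, 1) (or_intror erefl).
have cc := curve_continuous d1 d2.
have k1 : {for t, continuous (fun s => Dx f (c s))}.
  exact: (@continuous_comp _ _ _ c (Dx f) t cc (@Ck_continuous _ 1 U _ _ Cx Uc)).
have k2 : {for t, continuous (fun s => Dy f (c s))}.
  exact: (@continuous_comp _ _ _ c (Dy f) t cc (@Ck_continuous _ 1 U _ _ Cy Uc)).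
exact: (cvgD (cvgM k1 (c1 t)) (cvgM k2 (c2 t))).
Qed.

Definition speed c t := Num.sqrt (derive1 (cx c) t ^+ 2 + derive1 (cy c) t ^+ 2) / (c t).2.

Lemma hyp_lengthE c : hyp_length c =
  (\int[lebesgue_measure]_(t in `[0%R, 1%R]) (speed c t)%:E)%E.
Proof. by []. Qed.

Lemma Ck_busemann j (n : nat) : Ck n upper (busemann j).
Proof.
have o := @open_upper R.
have h0 k p : upper p -> horo k p != 0 by move=> y0; rewrite gt_eqF ?horo_gt0.
have Io : open [set x : R | 0 < x] by exact: open_gt.
have C := CkM o (Ck_snd n o) (Ck_inv o (h0 j) (Ck_horo j n o)).
by apply: (CkR_comp o Io _ (CkR_ln n) C) => p y0; exact: height_gt0.
Qed.

(** In the hyperbolic metric the gradient of a Busemann function has norm 1. *)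
Lemma busemann_gradient j p : upper p ->
  exists a b, has_gradient (busemann j) p a b /\ a ^+ 2 + b ^+ 2 = (p.2 ^+ 2)^-1.
Proof.
move=> y0; have yn0 : p.2 != 0 by rewrite gt_eqF.
have N0 := horo_gt0 j y0; have Nn0 := lt0r_neq0 N0.
have H a b : has_gradient (horo j) p a b ->
    (a ^+ 2 + b ^+ 2) * p.2 = 2 * b * horo j p ->
    exists a b, has_gradient (busemann j) p a b /\ a ^+ 2 + b ^+ 2 = (p.2 ^+ 2)^-1.
  move=> Gh E.
  have G := has_gradientM (has_gradient_snd p) (has_gradientV Gh Nn0).
  have L := has_gradient_comp1 (is_derive1_ln (height_gt0 j y0)) G.
  do 2!eexists; split; first exact: L.
  rewrite /height -[RHS]mulr1.
  transitivity ((p.2 ^+ 2)^-1 * ((1 + p.2 / (horo j p)^+2 * ((a ^+ 2 + b ^+ 2) * p.2 - 2 * b * horo j p)))).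
    by field; rewrite Nn0 yn0.
  by rewrite E subrr mulr0 addr0.
move: j N0 Nn0 H; apply: ord3P => N0 Nn0 H.
- by apply: (H _ _ (has_gradient_sqr (has_gradient_fst p))); rewrite /horo /=; ring.
- by apply: (H _ _ (has_gradient_sqr (has_gradient_1B p))); rewrite /horo /=; ring.
- by apply: (H 0 0); [exact: has_gradient_cst|rewrite expr0n /= addr0 !mul0r mulr0 mul0r].
Qed.

Section OneCurve.
Variables (D : set (plane R)) (c : R -> plane R) (p q : plane R).
Hypothesis Dupper : D `<=` upper.
Hypothesis Cc : C1_curve D c p q.

Let up (t : R) : t \in `[0, 1] -> upper (c t).
Proof. by case: Cc => _ _ + _ _; rewrite in_itv /= => H /H /Dupper. Qed.

Lemma speed_ge0 (t : R) : t \in `[0, 1] -> 0 <= speed c t.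
Proof. by move=> /up u; rewrite divr_ge0 ?sqrtr_ge0 // ltW. Qed.

Lemma speed_continuous (t : R) : t \in `[0, 1] -> {for t, continuous (speed c)}.
Proof.
move=> t01; have [d [c1 c2] _ _ _] := Cc; have [d1 d2] := d t.
have y0 : (c t).2 != 0 by rewrite gt_eqF //; exact: up.
have k : {for t, continuous (fun s => derive1 (cx c) s ^+ 2 + derive1 (cy c) s ^+ 2)}.
  exact: (cvgD (cvgM (c1 t) (c1 t)) (cvgM (c2 t) (c2 t))).
have k2 := continuous_comp k (@sqrt_continuous R _).
have /derivable1_diffP /differentiable_continuous cy2 := d2.
exact: (cvgM k2 (cvgV y0 cy2)).
Qed.

(** The change of a Busemann function along a curve is the integral of its
    derivative, and the derivative is at most the speed because the gradient has
    norm 1. *)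
Lemma busemann_le_length j : (`|busemann j q - busemann j p|%:E <= hyp_length c)%E.
Proof.
have [d [c1 c2] _ c0 c1q] := Cc.
pose g : R -> R := curve_derivative (busemann j) c.
have o := @open_upper R.
have Dg (t : R) : t \in `[0, 1] -> is_derive t (1 : R) (fun s => busemann j (c s)) (g t).
  by move=> /up u; have [d1 d2] := d t; apply: (is_derive_curveCk o (Ck_busemann j 2)).
have cg (t : R) : t \in `[0, 1] -> {for t, continuous g}.
  by move=> /up u; have [d1 d2] := d t; apply: (curve_derivative_continuous o (Ck_busemann j 2)).
have wg : {within `[0, 1], continuous g}.
  by apply: continuous_in_subspaceT => t; rewrite inE; exact: cg.
have ws : {within `[0, 1], continuous (speed c)}.
  by apply: continuous_in_subspaceT => t; rewrite inE; exact: speed_continuous.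
have I0 : (0 : R) \in `[0, 1] by rewrite in_itv /= lexx ler01.
have I1 : (1 : R) \in `[0, 1] by rewrite in_itv /= lexx ler01.
have cB (t : R) : t \in `[0, 1] -> {for t, continuous (fun s => busemann j (c s))}.
  by move=> /Dg[/derivable1_diffP /differentiable_continuous].
have E : (\int[lebesgue_measure]_(t in `[0%R, 1%R]) (g t)%:E = (busemann j q - busemann j p)%:E)%E.
  rewrite -c0 -c1q EFinB; apply: (@continuous_FTC2 R g (fun s => busemann j (c s)) 0 1 ltr01 wg).
    split.
    - by move=> t t01; case: (Dg t (subset_itv_oo_cc t01)).
    - exact: (cvg_at_right_filter (cB 0 I0)).
    - exact: (cvg_at_left_filter (cB 1 I1)).
  by move=> t t01; rewrite derive1E; case: (Dg t (subset_itv_oo_cc t01)).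
have cpt := @segment_compact R 0 1.
have ig := continuous_compact_integrable cpt wg.
have is_ := continuous_compact_integrable cpt ws.
have mD : measurable (`[0, 1] : set R) by exact: measurable_itv.
have -> : (`|busemann j q - busemann j p|%:E = `|(busemann j q - busemann j p)%:E|)%E by [].
have mg := measurable_int _ ig.
rewrite -E; apply: (le_trans (le_abse_integral lebesgue_measure mD mg)).
rewrite hyp_lengthE; apply: ge0_le_integral => //.
- exact: (measurable_int _ (integrable_abse ig)).
- exact: (measurable_int _ is_).
move=> t t01; rewrite /= lee_fin.
have u : upper (c t) by apply: up.
have [a [b [G ab]]] := busemann_gradient j u.
rewrite /g /curve_derivative (has_gradient_dx G) (has_gradient_dy G) /speed.
set x' := derive1 _ t; set y' := derive1 _ t.
have S0 : 0 <= x' ^+ 2 + y' ^+ 2 by rewrite addr_ge0 ?sqr_ge0.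
rewrite -(@ler_pXn2r _ 2) ?nnegrE ?normr_ge0 //; last first.
  by rewrite divr_ge0 ?sqrtr_ge0 // ltW.
rewrite real_normK ?num_real // expr_div_n sqr_sqrtr // -ab -subr_ge0.
rewrite (_ : _ - _ = (a * y' - b * x') ^+ 2); last by ring.
exact: sqr_ge0.
Qed.

End OneCurve.

(** The conformal factor of [rot] is also the factor by which it changes the
    imaginary part, so [rot] preserves lengths. *)
Lemma rot_curve D c p q : C1_curve D c p q -> (forall t, upper (c t)) ->
  C1_curve (@rot R @` D) (rot \o c) (rot p) (rot q) /\ hyp_length (rot \o c) = hyp_length c.
Proof.
move=> [d [c1 c2] cD c0 c1q] up.
have o := @open_upper R; have [s1 s2] := @rot_smooth R 2.
have E1 t : is_derive t (1 : R) (cx (rot \o c)) (curve_derivative (fun q => (rot q).1) c t).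
  by have [d1 d2] := d t; exact: (is_derive_curveCk o s1).
have E2 t : is_derive t (1 : R) (cy (rot \o c)) (curve_derivative (fun q => (rot q).2) c t).
  by have [d1 d2] := d t; exact: (is_derive_curveCk o s2).
have F1 : derive1 (cx (rot \o c)) = curve_derivative (fun q => (rot q).1) c.
  by apply/funext => t; rewrite derive1E; case: (E1 t).
have F2 : derive1 (cy (rot \o c)) = curve_derivative (fun q => (rot q).2) c.
  by apply/funext => t; rewrite derive1E; case: (E2 t).
split.
  split.
  - by move=> t; have [h1 _] := E1 t; have [h2 _] := E2 t; exact: (conj h1 h2).
  - rewrite F1 F2; split=> t; have [d1 d2] := d t.
      exact: (curve_derivative_continuous o s1).
    exact: (curve_derivative_continuous o s2).
  - by move=> t t01; exists (c t) => //; exact: cD.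
  - by rewrite /= c0.
  - by rewrite /= c1q.
rewrite !hyp_lengthE; apply: eq_integral => t _; congr EFin.
have [a [b [G1 G2 ab]]] := rot_gradient (up t).
rewrite /speed F1 F2 /curve_derivative (has_gradient_dx G1) (has_gradient_dy G1)
  (has_gradient_dx G2) (has_gradient_dy G2).
set x' := derive1 _ t; set y' := derive1 _ t.
have -> : (a * x' + b * y') ^+ 2 + (- b * x' + a * y') ^+ 2 =
  (x' ^+ 2 + y' ^+ 2) * (a ^+ 2 + b ^+ 2) by ring.
have N0 := horo_gt0 i1 (up t); have y0 : 0 < (c t).2 := up t.
rewrite ab sqrtrM ?addr_ge0 ?sqr_ge0 // -exprVn sqrtr_sqr gtr0_norm ?invr_gt0 //.
by rewrite /rot /= invf_div -mulrA; congr (_ * _); field; rewrite !gt_eqF.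
Qed.

Lemma hyp_length_const c k : (forall t, t \in `[0, 1] -> speed c t = k) -> hyp_length c = k%:E.
Proof.
move=> H; rewrite hyp_lengthE.
rewrite (_ : (\int[_]_(t in _) _ = \int[lebesgue_measure]_(t in `[0%R, 1%R]) (cst k%:E) t)%E); last first.
  by apply: eq_integral => t; rewrite inE => t01; rewrite H.
rewrite integral_cst; last exact: measurable_itv.
have E := @lebesgue_measure_itv R `[0, 1]%R.
rewrite /= lte_fin ltr01 sube0 in E.
by rewrite [X in (_ * X)%E](_ : _ = 1%E) ?mule1 //; exact: E.
Qed.

Lemma C1_curve_sub D D' c p q : D `<=` D' -> C1_curve D c p q -> C1_curve D' c p q.
Proof. by move=> DD' [? ? h ? ?]; split=> // t /h /DD'. Qed.

Lemma rot_preimage p : upper p -> exists2 p', upper p' & [/\ rot p' = p,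
  ideal p -> ideal p', forall j, height (nxt j) p = height j p' &
  forall i, side (nxt i) p = 0 <-> side i p' = 0].
Proof.
move=> u; have u1 := rot_upper u; have u2 := rot_upper u1; exists (rot (rot p)) => //.
split; first exact: rotK.
- by move=> h; do 2!apply: rot_ideal.
- by move=> j; rewrite -(rot_height j u2) rotK.
move=> i; rewrite -{1}(rotK u) rot_side //; split=> [/eqP|->]; last by rewrite mul0r.
by rewrite mulf_eq0 invr_eq0 (gt_eqF (horo_gt0 i1 u2)) orbF => /eqP.
Qed.

(** Statements about a cusp are proved at infinity, where horocycles are
    horizontal and sides vertical, and transported by [rot]. *)
Lemma rot_ind (P : 'I_3 -> Prop) : P i2 -> (forall j, P j -> P (nxt j)) -> forall j, P j.
Proof.
move=> h2 H; have h0 := H _ h2; have h1 := H _ h0; exact: ord3P.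
Qed.

Definition line p q : R -> plane R := fun t => (p.1 + t * (q.1 - p.1), p.2 + t * (q.2 - p.2)).

Lemma is_derive_affine (a b : R) (t : R) : is_derive t (1 : R) (fun s => a + s * b) b.
Proof.
have h := is_deriveD (is_derive_cst a t (1 : R)) (is_deriveM (is_derive_id t (1 : R)) (is_derive_cst b t (1 : R))).
have -> : (fun s => a + s * b) = cst a + id * cst b by [].
by apply: (is_derive_eq h); rewrite /GRing.scale /= mulr0 !add0r mulr1.
Qed.

(** At the cusp at infinity the curve is a horizontal segment, of Euclidean
    length at most 1; above height 1 such a segment does not meet the bottom
    side. *)
Lemma horocycle_curve j : forall p q, ideal p -> ideal q ->
  1 <= height j p -> height j q = height j p ->
  exists c, [/\ C1_curve ideal c p q, forall t, upper (c t) &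
    (hyp_length c <= ((height j p)^-1)%:E)%E].
Proof.
move: j; apply: rot_ind => [p q ip iq|j IH p q ip iq hp hq].
  rewrite !height2 => y1 yq.
  have y0 : 0 < p.2 by apply: lt_le_trans y1.
  pose c := fun t : R => (p.1 + t * (q.1 - p.1), p.2).
  have E1 t : derive1 (cx c) t = q.1 - p.1.
    by rewrite derive1E; case: (is_derive_affine p.1 (q.1 - p.1) t).
  have E2 t : derive1 (cy c) t = 0 by rewrite derive1E derive_cst.
  have /ideal_sideP[_ sp] := ip; have /ideal_sideP[_ sq] := iq.
  have := sp i0; have := sp i1; have := sq i0; have := sq i1; rewrite /side /= => q1 q0 p1 p0.
  exists c; split.
  - split.
    + move=> t; split; first by case: (is_derive_affine p.1 (q.1 - p.1) t).
      exact: derivable_cst.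
    + split.
        by rewrite (_ : derive1 _ = cst (q.1 - p.1)); [exact: cst_continuous|apply/funext => t; exact: E1].
      by rewrite (_ : derive1 _ = cst 0); [exact: cst_continuous|apply/funext => t; exact: E2].
    + move=> t /andP[t0 t1]; apply/ideal_sideP; split=> //.
      have x0 : 0 <= p.1 + t * (q.1 - p.1) by nra.
      have x1 : 0 <= 1 - (p.1 + t * (q.1 - p.1)) by nra.
      apply: ord3P; rewrite /side //=.
      by have y2 : 1 <= p.2 ^+ 2 by [rewrite expr_ge1 // ltW]; nra.
    + by rewrite /c mul0r addr0 -surjective_pairing.
    + by rewrite /c mul1r addrC subrK -yq -surjective_pairing.
  - by move=> t.
  - rewrite (@hyp_length_const c (`|q.1 - p.1| / p.2)); last first.
      by move=> t _; rewrite /speed E1 E2 expr0n /= addr0 sqrtr_sqr.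
    rewrite lee_fin ler_pdivrMr // mulVf ?gt_eqF // ler_norml; lra.
have [p' up' [Ep ip' hp' _]] := rot_preimage (ideal_upper ip).
have [q' uq' [Eq iq' hq' _]] := rot_preimage (ideal_upper iq).
have [||c [Cc uc lc]] := IH p' q' (ip' ip) (iq' iq); rewrite -?hp' -?hq' //.
have [C' l'] := rot_curve Cc uc.
exists (rot \o c); split.
- by rewrite -Ep -Eq; apply: C1_curve_sub C' => _ [z iz <-]; exact: rot_ideal.
- by move=> t; apply: rot_upper.
- by rewrite l' hp'.
Qed.

(** At the cusp at infinity the curve is a vertical segment, parametrized so
    that ln y is affine. *)
Lemma edge_curve j : forall i p q, i != j -> ideal_edge i p -> ideal_edge i q ->
  exists c, [/\ C1_curve (ideal_edge i) c p q, forall t, upper (c t) &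
    (hyp_length c <= `|busemann j q - busemann j p|%:E)%E].
Proof.
move: j; apply: rot_ind => [i p q|j IH i p q ij ep eq].
  move=> ij [ip sp] [iq sq].
  have y0 := ideal_y ip; have y0' := ideal_y iq.
  rewrite /busemann !height2; set b := ln p.2; set d := ln q.2 - b.
  pose c := fun t : R => (p.1, expR (b + t * d)).
  have E1 t : derive1 (cx c) t = 0 by rewrite derive1E derive_cst.
  have D2 t : is_derive t (1 : R) (cy c) (expR (b + t * d) * d).
    have := @is_derive1_comp R expR (fun s => b + s * d) t _ _ (is_derive_expR _) (is_derive_affine b d t).
    by rewrite /GRing.scale /= mulrC.
  have E2 t : derive1 (cy c) t = expR (b + t * d) * d by rewrite derive1E; case: (D2 t).
  have px : p.1 = q.1 /\ (p.1 = 0 \/ p.1 = 1).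
    move: i ij sp sq; apply: ord3P => // _; rewrite /side /= => h1 h2.
      by split; [|right]; lra.
    by split; [|left]; lra.
  exists c; split.
  - split.
    + by move=> t; split; [exact: derivable_cst|case: (D2 t)].
    + split.
        by rewrite (_ : derive1 _ = cst 0); [exact: cst_continuous|apply/funext => t; exact: E1].
      rewrite (_ : derive1 _ = (fun t => cy c t * d)); last by apply/funext => t; exact: E2.
      move=> t; have [/derivable1_diffP /differentiable_continuous h _] := D2 t.
      exact: (cvgM h (cvg_cst d)).
    + move=> t _; split; last by move: i ij sp sq {E1 D2 E2}; apply: ord3P.
      apply/ideal_sideP; split; first exact: expR_gt0.
      apply: ord3P; rewrite /side /c /=.
      * by case: px.2 => ->; rewrite ?subr0 ?subrr.
      * by case: px.2 => ->.
      * by case: px.2 => ->; rewrite ?expr1n ?expr0n ?subrr ?oppr0 !add0r ?sqr_ge0.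
    + by rewrite /c mul0r addr0 lnK // -surjective_pairing.
    + by rewrite /c mul1r /d addrC subrK lnK // px.1 -surjective_pairing.
  - by move=> t; exact: expR_gt0.
  - rewrite (@hyp_length_const c `|d|) // => t _; rewrite /speed E1 E2 expr0n /= add0r sqrtr_sqr normrM.
    by rewrite gtr0_norm ?expR_gt0 // mulrC mulKf // gt_eqF // expR_gt0.
have [ip sp] := ep; have [iq sq] := eq.
have [p' up' [Ep ip' hp' sp']] := rot_preimage (ideal_upper ip).
have [q' uq' [Eq iq' hq' sq']] := rot_preimage (ideal_upper iq).
pose i' := nxt (nxt i); have Ei : nxt i' = i by exact: nxt3.
have ij' : i' != j by apply: contraNneq ij => <-; rewrite Ei.
have [||c [Cc uc lc]] := IH i' p' q' ij'.
- by split; [exact: ip'|apply/sp'; rewrite Ei].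
- by split; [exact: iq'|apply/sq'; rewrite Ei].
have [C' l'] := rot_curve Cc uc.
exists (rot \o c); split.
- rewrite -Ep -Eq; apply: C1_curve_sub C' => _ [z [iz sz] <-]; split; first exact: rot_ideal.
  by rewrite -Ei rot_side ?sz ?mul0r //; exact: ideal_upper.
- by move=> t; apply: rot_upper.
- by rewrite l' /busemann hp' hq'.
Qed.

(** The side realizes the lower bound that the Busemann function gives for the
    length of a curve. *)
Lemma edge_dist i j p q : i != j -> ideal_edge i p -> ideal_edge i q ->
  hyp_length_dist (ideal_edge i) p q = `|busemann j q - busemann j p|%:E.
Proof.
move=> ij ep eq; apply/eqP; rewrite eq_le; apply/andP; split.
  have [c [Cc _ lc]] := edge_curve ij ep eq.
  by apply: le_trans lc; apply: ereal_inf_lbound; exists c.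
apply: le_ereal_inf_tmp => _ [c Cc <-].
by apply: (busemann_le_length _ Cc) => z [iz _]; exact: ideal_upper.
Qed.

Lemma edge_point j : forall i (s : R), i != j -> exists2 p, ideal_edge i p & busemann j p = s.
Proof.
move: j; apply: rot_ind => [i s ij|j IH i s ij].
  exists (if i == i1 then 0 else 1, expR s); last by rewrite /busemann height2 /= expRK.
  split.
    apply/ideal_sideP; split; first exact: expR_gt0.
    have s0 := sqr_ge0 (expR s).
    by case: ifP => _; apply: ord3P; rewrite /side /= ?subr0 ?subrr ?expr0n ?expr1n /= ?add0r ?subrr ?add0r.
  by move: i ij; apply: ord3P => // _; rewrite /side /= ?subrr.
pose i' := nxt (nxt i); have Ei : nxt i' = i by exact: nxt3.
have ij' : i' != j by apply: contraNneq ij => <-; rewrite Ei.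
have [p [ip sp] bp] := IH i' s ij'; exists (rot p).
  split; first exact: rot_ideal.
  by rewrite -Ei rot_side ?sp ?mul0r //; exact: ideal_upper.
by rewrite /busemann rot_height //; exact: ideal_upper.
Qed.

End Curves.

(** * Barycentric coordinates and the compact core *)

Section Charts.
Context {R : realType}.
Implicit Types (p q z : plane R) (i j k : 'I_3).
Local Notation ideal := (@ideal_triangle R).
Local Notation punct := (@punctured_triangle R).

Lemma bary0 p : barycentric i0 p = 1 - p.1 - p.2. Proof. by []. Qed.
Lemma bary1 p : barycentric i1 p = p.1. Proof. by []. Qed.
Lemma bary2 p : barycentric i2 p = p.2. Proof. by []. Qed.
Definition baryE := (bary0, bary1, bary2).

Lemma bary_sum i p : barycentric i p + barycentric (nxt i) p + barycentric (nxt (nxt i)) p = 1.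
Proof. by move: i; apply: ord3P; rewrite !baryE; ring. Qed.

Lemma bary_inj p q : (forall i, barycentric i p = barycentric i q) -> p = q.
Proof.
move=> h; have := h i1; have := h i2; rewrite !baryE.
by rewrite [p]surjective_pairing [q]surjective_pairing => /= -> ->.
Qed.

Lemma bary_vertex i j : barycentric i (@vertex R j) = (i == j)%:R.
Proof.
by move: i j; do 2![apply: ord3P]; rewrite !baryE /vertex /tnth /= ?subr0 ?subrr ?sub0r ?oppr0.
Qed.

Lemma punctP p : punct p <-> forall i, 0 <= barycentric i p < 1.
Proof.
split=> [[tp np] i|H].
  rewrite tp /= ltNge; apply/negP => b1; apply: np; exists i => //.
  have s := bary_sum i p; have b2 := tp (nxt i); have b3 := tp (nxt (nxt i)).
  apply: bary_inj => k; rewrite bary_vertex.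
  have [->|ki] := eqVneq k i; first by rewrite mulr1n; lra.
  by rewrite mulr0n; have [->|->] := ord3_neq ki; lra.
split; first by move=> i; case/andP: (H i).
by case=> i _ e; have := H i; rewrite -e bary_vertex eqxx ltxx andbF.
Qed.

Lemma open_edgeP i p : open_edge i p <-> punct p /\ barycentric i p = 0.
Proof. by split=> [[[? ?] ?]|[[? ?] ?]]. Qed.

Lemma bary_line i p q t :
  barycentric i (line p q t) = (1 - t) * barycentric i p + t * barycentric i q.
Proof. by move: i; apply: ord3P; rewrite !baryE /line /=; ring. Qed.

Lemma punct_line p q t : punct p -> punct q -> 0 <= t <= 1 -> punct (line p q t).
Proof.
move=> /punctP hp /punctP hq /andP[t0 t1]; apply/punctP => i; rewrite bary_line.
have /andP[p0 p1] := hp i; have /andP[q0 q1] := hq i.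
apply/andP; split; first by rewrite addr_ge0 ?mulr_ge0 // subr_ge0.
have [->|tn] := eqVneq t 0; first by rewrite subr0 mul1r mul0r addr0.
have {}t0 : 0 < t by rewrite lt_neqAle eq_sym tn.
have h1 : t * barycentric i q < t * 1 by rewrite ltr_pM2l.
have h2 : (1 - t) * barycentric i p <= (1 - t) * 1 by rewrite ler_wpM2l ?subr_ge0 // ltW.
lra.
Qed.

Lemma open_edge_line i p q t : open_edge i p -> open_edge i q -> 0 <= t <= 1 ->
  open_edge i (line p q t).
Proof.
move=> /open_edgeP[hp p0] /open_edgeP[hq q0] t01; apply/open_edgeP.
by split; [exact: punct_line|rewrite bary_line p0 q0 !mulr0 addr0].
Qed.

Lemma line_continuous p q t : {for t, continuous (line p q)}.
Proof.
apply: curve_continuous.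
- by case: (is_derive_affine p.1 (q.1 - p.1) t).
- by case: (is_derive_affine p.2 (q.2 - p.2) t).
Qed.

Lemma line0 p q : line p q 0 = p.
Proof. by rewrite /line !mul0r !addr0 -surjective_pairing. Qed.
Lemma line1 p q : line p q 1 = q.
Proof. by rewrite /line !mul1r [X in (X, _)]addrC [X in (_, X)]addrC !subrK -surjective_pairing. Qed.

Lemma segment_IVT (A : set (plane R)) (phi : plane R -> R) p q :
  (forall t, 0 <= t <= 1 -> A (line p q t)) -> {within A, continuous phi} ->
  phi p <= 0 -> 0 <= phi q -> exists2 t, 0 <= t <= 1 & phi (line p q t) = 0.
Proof.
move=> Al /subspace_continuousP cphi pp pq.
have cw : {within `[0, 1], continuous (fun t => phi (line p q t))}.
  apply/subspace_continuousP => t; rewrite /= in_itv /= => t01 W nW.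
  have N : nbhs (line p q t) [set z | A z -> W (phi z)] := cphi _ (Al t t01) W nW.
  have N2 : nbhs t [set s | A (line p q s) -> W (phi (line p q s))] := @line_continuous p q t _ N.
  suff : nbhs t [set s : R | s \in `[0, 1] -> W (phi (line p q s))] by [].
  by apply: filterS N2 => s /= H s01; apply: H; apply: Al; rewrite in_itv in s01.
have [|||t t01 E] := @IVT R (fun t => phi (line p q t)) 0 1 0 => //.
  by rewrite line0 line1 ge_min pp le_max pq orbT.
by exists t => //; rewrite in_itv in t01.
Qed.

Lemma within_compose (A B : set (plane R)) (f : plane R -> plane R) (F : plane R -> R) :
  (forall p, A p -> B (f p)) -> {within A, continuous f} ->
  (forall z, B z -> {for z, continuous F}) -> {within A, continuous (fun p => F (f p))}.
Proof.
move=> AB /subspace_continuousP cf cF; apply/subspace_continuousP => p Ap.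
move=> W nW; have N : nbhs (f p) (F @^-1` W) := cF _ (AB p Ap) W nW.
exact: (cf p Ap _ N).
Qed.

Lemma Ck_height j (n : nat) : Ck n (@upper R) (height j).
Proof.
have o := @open_upper R.
have C := CkR_comp o openT (fun p _ => I) (CkR_exp n) (Ck_busemann j n).
by apply: Ck_congr C => // p y0; rewrite /= /busemann lnK // posrE height_gt0.
Qed.

Lemma height_continuous j z : ideal z -> {for z, continuous (height j)}.
Proof. by move=> /ideal_upper; exact: (Ck_continuous (Ck_height j 0)). Qed.

Lemma side_continuous i z : ideal z -> {for z, continuous (side i)}.
Proof.
move=> /ideal_y y0; have [a [b [G _]]] := side_gradient i y0.
exact: has_gradient_continuous G.
Qed.

Lemma sides_not_both i j z : ideal z -> i != j -> side i z = 0 -> side j z = 0 -> False.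
Proof.
move=> /ideal_y y0; have := sideM z; have y2 : 0 < z.2 ^+ 2 by rewrite exprn_gt0.
move: i j; do 2![apply: ord3P] => // E _ e1 e2; move: E y2 => <-; rewrite ?e1 ?e2; lra.
Qed.

(** On side [i] the heights at the two ends have product 1, while the height at
    the cusp [i] has product at most 1 with each of them. *)
Lemma height_edge_le1 i z : ideal_edge i z -> height i z <= 1.
Proof.
move=> [iz sz]; have y0 := ideal_y iz.
have h1 := heightM_le1 y0 (nxt_neq i); have h2 := heightM_le1 y0 (nxt2_neq i).
have [h3 _] : side i z = 0 <-> height (nxt i) z * height (nxt (nxt i)) z = 1.
  by apply: side_eq0P => //; rewrite eq_sym ?nxt_neq ?nxt2_neq.
have := h3 sz; have p0 := height_gt0 i y0; have p1 := height_gt0 (nxt i) y0.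
have p2 := height_gt0 (nxt (nxt i)) y0.
move: (height i z) (height (nxt i) z) (height (nxt (nxt i)) z) p0 p1 p2 h1 h2 => a b c a0 b0 c0 h1 h2 E.
rewrite leNgt; apply/negP => a1.
have ba : 0 <= b * a by exact: (ltW (mulr_gt0 b0 a0)).
have ca : 0 <= c * a by exact: (ltW (mulr_gt0 c0 a0)).
have : (b * a) * (c * a) <= 1 by rewrite -[1]mulr1; exact: ler_pM.
rewrite (_ : b * a * (c * a) = b * c * (a * a)); last by ring.
by rewrite E mul1r; nra.
Qed.

(** The ideal triangle with horocyclic neighbourhoods of its three cusps cut
    off. *)
Definition core (M : R) : set (plane R) :=
  [set z | ideal z /\ forall j, height j z <= M].

(** A point of the triangle with small imaginary part y is at horizontal
    distance at most 2 y ^ 2 from the cusp 0 or 1, which gives it a large height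
    there. The core is therefore closed in a rectangle with positive lower edge. *)
Lemma compact_core M : 1 <= M -> compact (core M).
Proof.
(* With y < 1 / (5 M) the point has height above M at the cusp 0 or 1. *)
move=> M1; pose d := (5 * M)^-1.
have M0 : 0 < M by lra.
have d0 : 0 < d by rewrite invr_gt0; lra.
have Md : M * d = 5^-1 by rewrite /d; field; lra.
pose K := (`[0, 1] `*` `[d, M] : set (plane R)).
have cK : compact K by apply: compact_setX; exact: segment_compact.
have KE : core M = K `&` ([set z | 0 <= side i2 z] `&` ([set z | 0 <= M * horo i0 z - z.2] `&`
    [set z | 0 <= M * horo i1 z - z.2])).
  apply/seteqP; split=> [z [/ideal_sideP[y0 s] h]|z [[/= z1 z2] [s2 [h0 h1]]]].
    have h0 : 0 <= M * horo i0 z - z.2.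
      by rewrite subr_ge0 -ler_pdivrMr ?horo_gt0 //; exact: (h i0).
    have h1 : 0 <= M * horo i1 z - z.2.
      by rewrite subr_ge0 -ler_pdivrMr ?horo_gt0 //; exact: (h i1).
    split; last by split; [exact: s|split].
    have s0 := s i0; have s1 := s i1; have s2 := s i2; have hy := h i2.
    rewrite height2 in hy; rewrite /side /= in s0 s1 s2.
    split; rewrite /= in_itv /=; first by apply/andP; split; lra.
    rewrite hy andbT leNgt; apply/negP => yd.
    have yy : M * z.2 < 5^-1 by rewrite -Md ltr_pM2l.
    have y5 : z.2 < 5^-1 by apply: le_lt_trans yy; rewrite ler_peMl // ltW.
    have key (x : R) : 0 <= x -> x <= 2 * z.2 ^+ 2 -> 0 <= M * (x ^+ 2 + z.2 ^+ 2) - z.2 -> False.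
      move=> x0 xy hM.
      have x2 : x ^+ 2 <= z.2 ^+ 2.
        rewrite ler_pXn2r ?nnegrE ?(ltW y0) //; apply: (le_trans xy); nra.
      have : M * (x ^+ 2 + z.2 ^+ 2) <= M * (2 * z.2 ^+ 2) by rewrite ler_pM2l //; lra.
      have : M * (2 * z.2 ^+ 2) = 2 * (M * z.2) * z.2 by ring.
      nra.
    have [xh|xh] := leP z.1 (2^-1).
      by apply: (key z.1) => //; nra.
    by apply: (key (1 - z.1)) => //; nra.
  move: z1 z2; rewrite !in_itv /= => /andP[z10 z11] /andP[z20 z2M].
  have y0 : 0 < z.2 by lra.
  split.
    apply/ideal_sideP; split=> //; apply: ord3P => //; rewrite /side /=; lra.
  apply: ord3P; first by rewrite ler_pdivrMr ?horo_gt0 // -subr_ge0.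
    by rewrite ler_pdivrMr ?horo_gt0 // -subr_ge0.
  by rewrite height2.
rewrite KE; apply: compact_closedI => //.
have cl (f : plane R -> R) : continuous f -> closed [set z | 0 <= f z].
  by move=> cf; apply: (@closed_comp _ _ f [set x | 0 <= x]) => [z _|]; [exact: cf|exact: closed_ge].
have cs i : continuous (fun z : plane R => M * horo i z - z.2).
  have oT := @openT (plane R).
  have C := CkB oT (CkM oT (Ck_cst 0 M oT) (Ck_horo i 0 oT)) (Ck_snd 0 oT).
  by move=> z; exact: (Ck_continuous C I).
apply: closedI; last by apply: closedI; apply: cl; exact: cs.
apply: cl => z; have oT := @openT (plane R).
have C := CkD oT (CkB oT (CkM oT (Ck_fst 0 oT) (Ck_fst 0 oT)) (Ck_fst 0 oT)) (CkM oT (Ck_snd 0 oT) (Ck_snd 0 oT)).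
exact: (Ck_continuous C I).
Qed.

End Charts.

(** * Uniformizations send vertices to cusps and edges to sides *)

Section Ends.
Context {R : realType}.
Implicit Types (p q z : plane R) (i j k : 'I_3).
Local Notation ideal := (@ideal_triangle R).
Local Notation punct := (@punctured_triangle R).

Section OneChart.
Variables (u g : plane R -> plane R).
Hypothesis D : inverse_diffeos punct ideal u g.

Let ui p : punct p -> ideal (u p). Proof. by move=> h; case: D => -[+ _] _ _ _ _; exact. Qed.
Let gp z : ideal z -> punct (g z). Proof. by move=> h; case: D => -[_ +] _ _ _ _; exact. Qed.
Let gu p : punct p -> g (u p) = p. Proof. by move=> h; case: D => _ + _ _ _; exact. Qed.
Let ug z : ideal z -> u (g z) = z. Proof. by move=> h; case: D => _ _ + _ _; exact. Qed.
Let cu : {within punct, continuous u}.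
Proof. by case: D => _ _ _ + _; exact: smooth_on_continuous. Qed.
Let cg : {within ideal, continuous g}.
Proof. by case: D => _ _ _ _; exact: smooth_on_continuous. Qed.

Lemma bary_gradient i p : exists a b, has_gradient (barycentric i) p a b /\ (a != 0 \/ b != 0).
Proof.
move: i; apply: ord3P.
- exists (-1), (-1); split; last by left; rewrite oppr_eq0 oner_neq0.
  have := has_gradient_affine (-1) (-1) 1 p.
  by congr has_gradient; apply/funext => q; rewrite bary0; ring.
- exists 1, 0; split; last by left; exact: oner_neq0.
  exact: has_gradient_fst.
- exists 0, 1; split; last by right; exact: oner_neq0.
  exact: has_gradient_snd.
Qed.

Lemma punct_interior p : punct p -> (forall i, barycentric i p != 0) -> nbhs p punct.
Proof.
move=> /punctP hp h.
have N i : \forall q \near p, 0 < barycentric i q < 1.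
  have [a [b [G _]]] := bary_gradient i p.
  have /continuous_planeP cb := has_gradient_continuous G.
  have /andP[b0 b1] := hp i; have {}b0 : 0 < barycentric i p by rewrite lt_neqAle eq_sym h.
  have [|d d0 H] := cb (Num.min (barycentric i p) (1 - barycentric i p)).
    by rewrite lt_min b0 subr_gt0.
  apply/nbhs_planeP; exists d => // q h1 h2; have := H q h1 h2.
  by rewrite lt_min !ltr_norml => /andP[/andP[? ?] /andP[? ?]]; lra.
apply: filterS3 (N i0) (N i1) (N i2) => q h0 h1 h2; apply/punctP.
by apply: ord3P; [move: h0|move: h1|move: h2] => /andP[? ?]; lra.
Qed.

Lemma chart_boundary i p : open_edge i p -> exists i', side i' (u p) = 0.
Proof.
move=> /open_edgeP[pp b0]; apply: contrapT => /forallNP ns.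
have n : nbhs (u p) ideal.
  have /ideal_sideP[y0 s0] := ui pp.
  by apply: open_side_gt0 => // i'; rewrite lt_neqAle eq_sym s0 andbT; apply/eqP; exact: ns.
have [a [b [G ab]]] := bary_gradient i p.
have [] : a = 0 /\ b = 0.
  apply: (diffeo_boundary_gradient D n (rho := barycentric i)); rewrite ?gu //.
  by move=> q /punctP /(_ i) /andP[].
by move=> a0 b0'; move: ab; rewrite a0 b0' eqxx; case.
Qed.

Lemma chart_interior i z : ideal_edge i z -> exists k, barycentric k (g z) = 0.
Proof.
move=> [iz sz]; apply: contrapT => /forallNP ns.
have n := punct_interior (gp iz) (fun i => introN eqP (ns i)).
have /ideal_interiorP[_ /(_ i)] := diffeo_interior D n.
by rewrite ug // sz ltxx.
Qed.

(** A point of each open edge from which connectedness arguments start. *)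
Definition edge_midpoint i : plane R :=
  line (vertex (nxt i)) (vertex (nxt (nxt i))) 2^-1.

Lemma bary_midpoint i j : barycentric j (edge_midpoint i) = if j == i then 0 else 2^-1.
Proof.
rewrite bary_line !bary_vertex; move: i j; do 2![apply: ord3P]; rewrite /nxt /= ?mulr0n ?mulr1n; lra.
Qed.

Lemma midpoint_edge i : open_edge i (edge_midpoint i).
Proof.
apply/open_edgeP; split; last by rewrite bary_midpoint eqxx.
by apply/punctP => k; rewrite bary_midpoint; case: ifP => _; lra.
Qed.

(** An open edge is connected and the sides are disjoint, so the side that
    contains the image of a point cannot change along the edge: psi below is
    positive on one side and negative on the other two. *)
Lemma chart_edge i : exists i', forall p, open_edge i p -> ideal_edge i' (u p).
Proof.
have [i' s0] := chart_boundary (midpoint_edge i).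
exists i' => p ep; have [pp _] := (open_edgeP i p).1 ep.
split; first exact: ui.
apply: contrapT => sp.
(* By [sideM], psi is positive where [side i'] vanishes. *)
pose psi z := side (nxt i') z * side (nxt (nxt i')) z - side i' z.
have psi_pos z : ideal z -> side i' z = 0 -> 0 < psi z.
  move=> iz e; have y2 : 0 < z.2 ^+ 2 by rewrite exprn_gt0 // ideal_y.
  have := sideM z; rewrite /psi; move: i' e {s0 sp psi}; apply: ord3P => e E; rewrite /= e;
    move: y2; rewrite -E e; nra.
have psi_neg z k : ideal z -> side k z = 0 -> side i' z <> 0 -> psi z < 0.
  move=> iz e ne; have /ideal_sideP[_ sz] := iz.
  have h : 0 < side i' z by rewrite lt_neqAle eq_sym sz andbT; apply/eqP.
  have ki : k != i' by apply/eqP => ki; apply: ne; rewrite -ki.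
  by rewrite /psi; have [<-|<-] := ord3_neq ki; rewrite e ?mul0r ?mulr0; lra.
have cpsi : {within open_edge i, continuous (fun p => psi (u p))}.
  apply: (@within_compose _ _ ideal).
  - by move=> q /open_edgeP[/ui].
  - by apply: continuous_subspaceW cu => q /open_edgeP[].
  - move=> z iz; apply: continuousB; last exact: side_continuous.
    by apply: continuousM; exact: side_continuous.
have [k sk] := chart_boundary ep.
have [||||t t01 E] := @segment_IVT _ (open_edge i) (fun p => psi (u p)) p (edge_midpoint i).
- by move=> t; apply: open_edge_line => //; exact: midpoint_edge.
- exact: cpsi.
- by apply: ltW; apply: (psi_neg _ k) => //; exact: ui.
- by apply: ltW; apply: psi_pos => //; apply: ui; have [] := (open_edgeP _ _).1 (midpoint_edge i).
have el := open_edge_line ep (midpoint_edge i) t01.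
have il : ideal (u (line p (edge_midpoint i) t)) by apply: ui; case/open_edgeP: el.
have [k' sk'] := chart_boundary el.
have [e|ne] := pselect (side i' (u (line p (edge_midpoint i) t)) = 0).
  by have := psi_pos _ il e; rewrite E ltxx.
by have := psi_neg _ _ il sk' ne; rewrite E ltxx.
Qed.

Definition end_nbhd j (e : R) : set (plane R) := [set p | punct p /\ 1 - e < barycentric j p].

Lemma end_nbhd_line j e p q t : end_nbhd j e p -> end_nbhd j e q -> 0 <= t <= 1 ->
  end_nbhd j e (line p q t).
Proof.
move=> [pp bp] [pq bq] t01; split; first exact: punct_line.
rewrite bary_line; case/andP: t01 => t0 t1.
have [->|tn] := eqVneq t 0; first by rewrite subr0 mul1r mul0r addr0.
have {}t0 : 0 < t by rewrite lt_neqAle eq_sym tn.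
have h1 : t * (1 - e) < t * barycentric j q by rewrite ltr_pM2l.
have h2 : (1 - t) * (1 - e) <= (1 - t) * barycentric j p by rewrite ler_wpM2l ?subr_ge0 // ltW.
lra.
Qed.

Lemma end_nbhd_point i j e : i != j -> 0 < e -> exists2 p, open_edge i p & end_nbhd j e p.
Proof.
move=> ij e0; pose t := 1 - Num.min (e / 2) 2^-1.
have m1 : Num.min (e / 2) 2^-1 <= e / 2 by rewrite ge_min lexx.
have m2 : Num.min (e / 2) 2^-1 <= (2^-1 : R) by rewrite ge_min lexx orbT.
have m0 : 0 < Num.min (e / 2) 2^-1 :> R by rewrite lt_min invr_gt0 divr_gt0 // ltr0n.
pose p := line (edge_midpoint i) (vertex j) t.
have bp k : barycentric k p = (1 - t) * (if k == i then 0 else 2^-1) + t * (k == j)%:R.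
  by rewrite bary_line bary_midpoint bary_vertex.
have pp : punct p.
  apply/punctP => k; rewrite bp; rewrite /t.
  case: eqVneq => [->|ki]; first by rewrite (negbTE ij) mulr0n !mulr0; lra.
  by case: eqVneq => _; rewrite ?mulr1n ?mulr0n; lra.
exists p; first by apply/open_edgeP; split=> //; rewrite bp eqxx (negbTE ij) mulr0n !mulr0 addr0.
split=> //; rewrite bp eqxx eq_sym (negbTE ij) mulr1n /t; lra.
Qed.

(** The points that are sent to the compact core form a compact set, on which
    the barycentric coordinate of [j] stays below 1. *)
Lemma end_nbhd_core j M : 1 <= M -> exists2 e : R, 0 < e &
  forall p, end_nbhd j e p -> exists c, M < height c (u p).
Proof.
move=> M1.
have [ne|/set0P/negP/negPn/eqP e0] := pselect (core M !=set0); last first.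
  exists 1 => // p [pp _]; apply: contrapT => /forallNP h.
  have : core M (u p) by split; [exact: ui|move=> c; rewrite leNgt; apply/negP; exact: h].
  by rewrite e0.
have ck := compact_core M1.
have cb : {within core M, continuous (fun z => barycentric j (g z))}.
  apply: (@within_compose _ _ punct).
  - by move=> z [/gp].
  - by apply: continuous_subspaceW cg => z [].
  - move=> p _; have [a [b [G _]]] := bary_gradient j p; exact: has_gradient_continuous G.
have [z0] := compact_EVT_max ne ck cb; rewrite inE => -[iz0 _] H.
have /punctP /(_ j) /andP[_ b1] := gp iz0.
exists (1 - barycentric j (g z0)); first by rewrite subr_gt0.
move=> p [pp bp]; apply: contrapT => /forallNP h.
have : core M (u p) by split; [exact: ui|move=> c; rewrite leNgt; apply/negP; exact: h].
rewrite -inE => /H; rewrite gu //; lra.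
Qed.

(** Horocyclic neighbourhoods of height 1 at distinct cusps are disjoint. *)
Lemma two_heights c c' z (M M' : R) : ideal z -> c != c' -> 1 <= M -> 1 <= M' ->
  M <= height c z -> M' < height c' z -> False.
Proof.
move=> /ideal_y y0 cc M1 M'1 h h'; have := heightM_le1 y0 cc; nra.
Qed.

(** Near a vertex the images leave every compact core, so each of them is high
    above some cusp; the neighbourhood of the vertex being connected and those
    of the cusps disjoint, it is always the same cusp. *)
Lemma chart_end j : exists c, forall M, exists2 e : R, 0 < e &
  forall p, end_nbhd j e p -> M < height c (u p).
Proof.
have [e e0 He] := end_nbhd_core j (lexx (1 : R)).
have [p0 _ n0] := @end_nbhd_point (nxt j) j e (nxt_neq j) e0.
have [c hc] := He _ n0; exists c.
have Hc p : end_nbhd j e p -> 1 < height c (u p).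
  move=> np; rewrite ltNge; apply/negP => hp.
  have ch : {within end_nbhd j e, continuous (fun p => height c (u p) - 1)}.
    apply: (@within_compose _ _ ideal _ (fun z => height c z - 1)).
    - by move=> q [/ui].
    - by apply: continuous_subspaceW cu => q [].
    - move=> z iz; apply: continuousB; [exact: height_continuous|exact: cst_continuous].
  have [||||t t01 E] := @segment_IVT _ (end_nbhd j e) (fun p => height c (u p) - 1) p p0.
  - by move=> t; exact: end_nbhd_line.
  - exact: ch.
  - by rewrite subr_le0.
  - by rewrite subr_ge0 ltW.
  have nl := end_nbhd_line np n0 t01.
  have [c' hc'] := He _ nl; have iz := ui nl.1.
  have [cc|cc] := eqVneq c c'; first by move: E hc'; rewrite -cc => E hc'; lra.
  by apply: (two_heights iz cc (lexx _) (lexx _) _ hc'); lra.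
move=> M; have M1 : 1 <= Num.max M 1 by rewrite le_max lexx orbT.
have [e' e'0 He'] := end_nbhd_core j M1.
exists (Num.min e e'); first by rewrite lt_min e0 e'0.
move=> p [pp bp].
have mm1 : Num.min e e' <= e by rewrite ge_min lexx.
have mm2 : Num.min e e' <= e' by rewrite ge_min lexx orbT.
have n1 : end_nbhd j e p by split=> //; lra.
have n2 : end_nbhd j e' p by split=> //; lra.
have h1 := Hc _ n1; have [c' hc'] := He' _ n2.
have [cc|cc] := eqVneq c c'; last by case: (two_heights (ui pp) cc (lexx _) M1 (ltW h1) hc').
by rewrite cc; apply: le_lt_trans hc'; rewrite le_max lexx.
Qed.

(** If two vertices were sent to the same cusp, the edge between them would be
    sent into a single side with both its ends at that cusp, and the height
    there would take some value twice, against [ideal_edge_inj]. So the cusps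
    are permuted. The sides follow, as an edge ends at two of the vertices, and
    the cusp opposite to a side is the only one where the side does not end. *)
Lemma chart_ends : exists pi : 'I_3 -> 'I_3, [/\ injective pi,
  forall j M, exists2 e : R, 0 < e & forall p, end_nbhd j e p -> M < height (pi j) (u p),
  forall i p, open_edge i p -> ideal_edge (pi i) (u p) &
  forall i z, ideal_edge (pi i) z -> open_edge i (g z)].
Proof.
have [pi Hpi] := choice chart_end.
have notend i j i' : i != j -> (forall p, open_edge i p -> ideal_edge i' (u p)) -> i' != pi j.
  move=> ij Hi'; apply/eqP => e; have [d d0 Hd] := Hpi j 1.
  have [p ep np] := end_nbhd_point ij d0.
  by have := Hd p np; rewrite -e ltNge height_edge_le1 //; exact: Hi'.
have inj : injective pi.
  suff H j k : j != k -> pi j != pi k.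
    by move=> j k e; apply/eqP; apply: contraT => /H; rewrite e eqxx.
  move=> jk; apply/eqP => e.
  have [i ij ik] : exists2 i, i != j & i != k.
    have kj : k != j by rewrite eq_sym.
    have [->|->] := ord3_neq kj; first by exists (nxt (nxt j)); rewrite ?nxt2_neq ?nxt_neq.
    by exists (nxt j); rewrite ?nxt_neq // eq_sym nxt_neq.
  have [i' Hi'] := chart_edge i.
  have ci := notend _ _ _ ij Hi'.
  pose phi p := height (pi j) (u p).
  (* A height that is attained on both halves of the edge, between the midpoint
     and either end. *)
  pose p0 := edge_midpoint i; pose v := phi p0 + 1.
  have e0 : open_edge i p0 := midpoint_edge i.
  have far l : i != l -> pi l = pi j -> exists2 q, open_edge i q & v < phi q /\ 2^-1 < barycentric l q.
    move=> il el; have [d d0 Hd] := Hpi l v.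
    have dm0 : 0 < Num.min d 2^-1 by rewrite lt_min d0 invr_gt0 ltr0n.
    have [q eq_ [pq bq]] := end_nbhd_point il dm0.
    have m1 : Num.min d 2^-1 <= d by rewrite ge_min lexx.
    have m2 : Num.min d 2^-1 <= 2^-1 by rewrite ge_min lexx orbT.
    exists q => //; split; last by lra.
    by rewrite /phi -el; apply: Hd; split=> //; lra.
  have [q1 eq1 [vq1 b1]] := far j ij erefl.
  have [q2 eq2 [vq2 b2]] := far k ik (esym e).
  have cphi : {within open_edge i, continuous (fun p => phi p - v)}.
    apply: (@within_compose _ _ ideal _ (fun z => height (pi j) z - v)).
    - by move=> q /open_edgeP[/ui].
    - by apply: continuous_subspaceW cu => q /open_edgeP[].
    - move=> z iz; apply: continuousB; [exact: height_continuous|exact: cst_continuous].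
  have ivt q : open_edge i q -> v < phi q -> exists2 t, 0 <= t <= 1 & phi (line p0 q t) = v.
    move=> eq_ vq; have [||||t t01 E] := @segment_IVT _ (open_edge i) (fun p => phi p - v) p0 q.
    - by move=> t; exact: open_edge_line.
    - exact: cphi.
    - by rewrite /v; lra.
    - by rewrite subr_ge0 ltW.
    - by exists t => //; lra.
  have [t1 t101 E1] := ivt _ eq1 vq1; have [t2 t201 E2] := ivt _ eq2 vq2.
  have el1 := open_edge_line e0 eq1 t101; have el2 := open_edge_line e0 eq2 t201.
  have pl1 := ((open_edgeP _ _).1 el1).1; have pl2 := ((open_edgeP _ _).1 el2).1.
  have EE : line p0 q1 t1 = line p0 q2 t2.
    rewrite -(gu pl1) -(gu pl2); congr g.
    apply: (ideal_edge_inj (i := i') (j := pi j)); first by rewrite eq_sym.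
    - exact: Hi'.
    - exact: Hi'.
    - by rewrite -/(phi _) E1 -E2.
  have bm l : i != l -> barycentric l p0 = 2^-1.
    by rewrite bary_midpoint eq_sym => /negbTE ->.
  have s : barycentric k q2 <= 1 - barycentric j q2.
    have /open_edgeP[/punctP P0 _] := eq2; have := bary_sum j q2.
    have := P0 (nxt j); have := P0 (nxt (nxt j)); have kj : k != j by rewrite eq_sym.
    by have [->|->] := ord3_neq kj => /andP[? ?] /andP[? ?]; lra.
  have := congr1 (barycentric j) EE; rewrite (bary_line j p0 q1 t1) (bary_line j p0 q2 t2) (bm j ij) => Ej.
  case/andP: t101 => t10 t11; case/andP: t201 => t20 t21.
  have t1e : t1 = 0.
    apply: le_anti; rewrite t10 andbT leNgt; apply/negP => t1p.
    have h1 : 0 < t1 * (barycentric j q1 - 2^-1) by rewrite mulr_gt0 ?subr_gt0.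
    have h2 : 0 <= t2 * (2^-1 - barycentric j q2) by rewrite mulr_ge0 // subr_ge0; lra.
    suff : t1 * (barycentric j q1 - 2^-1) <= 0 by rewrite leNgt h1.
    lra.
  move: E1; rewrite t1e line0 /v => h; have /eqP : (1 : R) = 0 by lra.
  by rewrite oner_eq0.
have edges i p : open_edge i p -> ideal_edge (pi i) (u p).
  have [i' Hi'] := chart_edge i.
  have n1 : i' != pi (nxt i) by apply: notend Hi'; rewrite eq_sym nxt_neq.
  have n2 : i' != pi (nxt (nxt i)) by apply: notend Hi'; rewrite eq_sym nxt2_neq.
  have m1 : pi i != pi (nxt i) by apply/eqP => /inj /eqP; rewrite eq_sym (negbTE (nxt_neq i)).
  have m2 : pi i != pi (nxt (nxt i)) by apply/eqP => /inj /eqP; rewrite eq_sym (negbTE (nxt2_neq i)).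
  have m3 : pi (nxt i) != pi (nxt (nxt i)) by apply/eqP => /inj /eqP; rewrite eq_sym (negbTE (nxt_neq _)).
  suff -> : pi i = i' by exact: Hi'.
  move: n1 n2 m1 m2 m3; move: (pi i) (pi (nxt i)) (pi (nxt (nxt i))) i' {Hi'}.
  by do 4![apply: ord3P].
exists pi; split=> // i z ez.
have [k bk] := chart_interior ez; have iz := ez.1.
have ek : open_edge k (g z) by apply/open_edgeP; split=> //; exact: gp.
have [_ sk] := edges _ _ ek; rewrite ug // in sk.
have [->//|ki] := eqVneq i k.
case: (sides_not_both iz _ ez.2 sk); by apply/eqP => /inj /eqP; rewrite (negbTE ki).
Qed.

End OneChart.

(** A uniformization normalized so that vertex i is sent to cusp i. *)
Record chart (v w : plane R -> plane R) : Prop := Chart {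
  chart_diffeo : inverse_diffeos punct ideal v w;
  chart_cusp : forall j M, exists2 e : R, 0 < e &
    forall p, end_nbhd j e p -> M < height j (v p);
  chart_side : forall i p, open_edge i p -> ideal_edge i (v p);
  chart_side_inv : forall i z, ideal_edge i z -> open_edge i (w z) }.

(** The permutation of the cusps is undone by a symmetry of the ideal triangle. *)
Lemma chart_exists (u g : plane R -> plane R) : inverse_diffeos punct ideal u g ->
  exists (rho rho' : plane R -> plane R) (pi : 'I_3 -> 'I_3),
  [/\ ideal_diffeo rho rho', ideal_diffeo rho' rho, chart (rho' \o u) (g \o rho), injective pi &
    (forall i, u @` open_edge i = ideal_edge (pi i)) /\
    forall j p, punct p -> height (pi j) (u p) = height j (rho' (u p))].
Proof.
move=> D; have [pi [inj ends edges inv]] := chart_ends D.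
have [rho [rho' [D1 D2 H]]] := @ideal_symmetry R pi inj.
have [[Di Dg] gu ug _ _] := D.
have [[[r1 r2] k1 k2 _ _] _] := D1.
have H' j z : ideal z -> height (pi j) z = height j (rho' z).
  by move=> iz; rewrite -{1}(k2 _ iz) H //; exact: r2.
have S i z : ideal z -> side i (rho' z) = 0 <-> side (pi i) z = 0.
  move=> iz; have y1 := ideal_y iz; have y2 := ideal_y (r2 _ iz).
  have n1 : i != nxt i by rewrite eq_sym nxt_neq.
  have n2 : i != nxt (nxt i) by rewrite eq_sym nxt2_neq.
  have n3 : nxt i != nxt (nxt i) by rewrite eq_sym nxt_neq.
  have N a b : a != b -> pi a != pi b by apply: contraNneq => /inj ->.
  rewrite (side_eq0P y2 n1 n2 n3) (side_eq0P y1 (N _ _ n1) (N _ _ n2) (N _ _ n3)).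
  by rewrite !H'.
exists rho, rho', pi; split=> //.
- split.
  + exact: (inverse_diffeos_comp D D2.1).
  + move=> j M; have [e e0 He] := ends j M; exists e => // p np.
    by rewrite /= -H'; [exact: He|exact: Di np.1].
  + move=> i p ep; have [iu su] := edges i p ep; split; first exact: r2.
    by apply/S.
  + move=> i z [iz sz]; apply: inv; split; first exact: r1.
    by apply/S; [exact: r1|rewrite k1].
- split=> [i|j p pp]; last by rewrite H' //; exact: Di.
  apply/seteqP; split=> [_ [p ep <-]|z ez]; first exact: edges.
  by exists (g z); [exact: inv|rewrite ug //; exact: ez.1].
Qed.

End Ends.

(** * Identification of points that are not vertices *)

Section Gluing.
Context {R : realType} (K : gluing_data R).
Implicit Types (A B : face K * 'I_3) (p q : plane R).
Local Notation punct := (@punctured_triangle R).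

Definition terminus A : 'I_3 :=
  if nxt A.2 == origin A then nxt (nxt A.2) else nxt A.2.

Lemma terminus_origin A : terminus A != origin A.
Proof.
by rewrite /terminus; case: ifP => [/eqP <-|/negbT //]; exact: nxt_neq.
Qed.

Lemma terminus_edge A : terminus A != A.2.
Proof. by rewrite /terminus; case: ifP => _; rewrite ?nxt_neq ?nxt2_neq. Qed.

Lemma edge_cases A j : j = A.2 \/ j = origin A \/ j = terminus A.
Proof.
have := origin_edge A; rewrite /terminus; move: A.2 (origin A) j.
by do 3![apply: ord3P] => //= _; auto.
Qed.

Lemma edgeP i p : edge i p <-> (forall j, 0 <= barycentric j p) /\ barycentric i p = 0.
Proof. by split=> [[]|[]]. Qed.

Lemma open_edge_sub i p : open_edge i p -> edge i p. Proof. by case. Qed.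

Lemma vertex_edge i j : j != i -> edge i (@vertex R j).
Proof.
move=> ji; apply/edgeP; split=> [k|]; rewrite bary_vertex; first exact: ler0n.
by rewrite eq_sym (negbTE ji).
Qed.

Lemma edge_bary_sum A p : edge A.2 p ->
  barycentric (origin A) p + barycentric (terminus A) p = 1.
Proof.
move=> /edgeP[_ b0]; have := bary_sum A.2 p; rewrite b0 add0r.
have := origin_edge A; rewrite /terminus => /ord3_neq[->|->]; first by rewrite eqxx.
have -> : (nxt A.2 == nxt (nxt A.2)) = false by rewrite eq_sym (negbTE (nxt_neq _)).
by rewrite addrC.
Qed.

Lemma edge_inj A p q : edge A.2 p -> edge A.2 q ->
  barycentric (terminus A) p = barycentric (terminus A) q -> p = q.
Proof.
move=> ep eq_ e; have := edge_bary_sum ep; have := edge_bary_sum eq_ => s1 s2.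
have /edgeP[_ b1] := ep; have /edgeP[_ b2] := eq_.
apply: bary_inj => j; have [->|[->|->]] := edge_cases A j => //; first by rewrite b1 b2.
by apply: (addIr (barycentric (terminus A) p)); rewrite s2 e s1.
Qed.

Lemma glueK A B p : glued A B -> edge A.2 p -> glue B A (glue A B p) = p.
Proof. by move=> g e; rewrite glue_comp ?glue_id //; exact: glued_sym. Qed.

Lemma edge_vertex A p : edge A.2 p -> vertices p ->
  p = vertex (origin A) \/ p = vertex (terminus A).
Proof.
move=> /edgeP[_ b0] [j _ e]; have [ej|[<-|<-]] := edge_cases A j; [|by left|by right].
by move: b0; rewrite -e bary_vertex ej eqxx => /eqP; rewrite oner_eq0.
Qed.

Lemma vertex_not_open i j : ~ open_edge i (@vertex R j).
Proof. by case=> _; apply; exists j. Qed.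

(** Gluing maps are injective and send origin to origin. If an inner point of
    the edge went to the terminus, the image of the terminus would already be
    attained strictly before that point, by the intermediate value theorem. *)
Lemma glue_open_edge A B p : glued A B -> open_edge A.2 p -> open_edge B.2 (glue A B p).
Proof.
move=> g op; have ep := open_edge_sub op.
have eB := glue_edge g ep; split=> //.
have inj q q' : edge A.2 q -> edge A.2 q' -> glue A B q = glue A B q' -> q = q'.
  by move=> h h' e; rewrite -(glueK g h) e glueK.
have eo : edge A.2 (vertex (origin A) : plane R) by apply: vertex_edge; exact: origin_edge.
have et : edge A.2 (vertex (terminus A) : plane R) by apply: vertex_edge; exact: terminus_edge.
move=> /(edge_vertex eB)[e|e].
  rewrite -(glue_origin g) in e; move: op; rewrite (inj _ _ ep eo e).
  exact: vertex_not_open.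
pose q := glue A B (vertex (terminus A)); have eq_ : edge B.2 q := glue_edge g et.
pose c := barycentric (terminus B) q.
have c0 : 0 <= c by have /edgeP[+ _] := eq_; apply.
have c1 : c <= 1.
  by have := edge_bary_sum eq_; have /edgeP[/(_ (origin B)) + _] := eq_; rewrite -/c; lra.
have [||||t /andP[t0 t1] E] := @segment_IVT R (edge A.2) (fun z => barycentric (terminus B) (glue A B z) - c)
    (vertex (origin A)) p.
- move=> t /andP[t0 t1]; apply/edgeP; split=> [j|]; rewrite bary_line.
    have /edgeP[h _] := ep; have /edgeP[h' _] := eo.
    by rewrite addr_ge0 // mulr_ge0 // subr_ge0.
  by have /edgeP[_ ->] := ep; have /edgeP[_ ->] := eo; rewrite !mulr0 addr0.
- apply: (@within_compose _ _ setT _ (fun z => barycentric (terminus B) z - c)) => //.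
    exact: glue_continuous.
  move=> z _; apply: continuousB; last exact: cst_continuous.
  by have [a [b [G _]]] := bary_gradient (terminus B) z; exact: has_gradient_continuous G.
- by rewrite glue_origin // bary_vertex (negbTE (terminus_origin B)) mulr0n sub0r oppr_le0.
- by rewrite e bary_vertex eqxx mulr1n subr_ge0.
set z := line _ _ t in E.
have ez : edge A.2 z.
  apply/edgeP; split=> [j|]; rewrite bary_line.
    have /edgeP[h _] := ep; have /edgeP[h' _] := eo.
    by rewrite addr_ge0 // mulr_ge0 // subr_ge0.
  by have /edgeP[_ ->] := ep; have /edgeP[_ ->] := eo; rewrite !mulr0 addr0.
have E2 : glue A B z = q.
  by apply: edge_inj; [exact: glue_edge|by []|move/eqP: E; rewrite subr_eq0 => /eqP].
have zt := inj _ _ ez et E2.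
have := congr1 (barycentric (terminus A)) zt.
rewrite /z bary_line !bary_vertex (negbTE (terminus_origin A)) eqxx mulr0n mulr1n mulr0 add0r.
have /open_edgeP[/punctP /(_ (terminus A)) /andP[b0 b1] _] := op.
nra.
Qed.

Lemma open_edge_unique i j p : open_edge i p -> edge j p -> i = j.
Proof.
move=> /open_edgeP[/punctP pp b] /edgeP[_ b']; apply/eqP; rewrite -[_ == _]negbK; apply/negP => ij.
have ji : j != i by rewrite eq_sym.
have s := bary_sum i p; have h1 := pp (nxt i); have h2 := pp (nxt (nxt i)).
by move: b'; have [->|->] := ord3_neq ji => b'; move: h1 h2 => /andP[? ?] /andP[? ?]; lra.
Qed.

(** The identifications that remain when the vertices are removed: there the
    edge that contains a point is unique, so the gluing maps compose and one of
    them is enough. *)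
Definition glued_points (x y : face K * plane R) : Prop :=
  x = y \/ exists A B p, [/\ glued A B, open_edge A.2 p, x = (A.1, p) & y = (B.1, glue A B p)].

Lemma glued_points_sym x y : glued_points x y -> glued_points y x.
Proof.
move=> [->|[A [B [p [g op -> ->]]]]]; first by left.
right; exists B, A, (glue A B p); split=> //; [exact: glued_sym|exact: glue_open_edge|].
by rewrite glueK //; exact: open_edge_sub.
Qed.

Lemma side_unique A B p : A.1 = B.1 -> open_edge A.2 p -> edge B.2 p -> A = B.
Proof.
move: A B => [T i] [T' j] /= <- o e; by rewrite (open_edge_unique o e).
Qed.

Lemma glued_points_trans x y z : glued_points x y -> glued_points y z -> glued_points x z.
Proof.
move=> [->//|[A [B [p [g op -> ->]]]]] [<-|[B' [C [q [g' oq E ->]]]]].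
  by right; exists A, B, p.
case: E => e1 e2; have oB := glue_open_edge g op.
have eB : B = B'.
  by apply: side_unique e1 oB _; rewrite e2; exact: open_edge_sub.
subst B' q; right; exists A, C, p; split=> //; first exact: glued_trans g g'.
by rewrite glue_comp //; exact: open_edge_sub.
Qed.

Lemma glued_points_punct x y : glued_points x y -> punct x.2 -> punct y.2.
Proof.
move=> [->//|[A [B [p [g op -> ->]]]]] _ /=.
by have /open_edgeP[] := glue_open_edge g op.
Qed.

Lemma punct_edge_open i p : punct p -> edge i p -> open_edge i p.
Proof. by move=> pp /edgeP[_ b]; apply/open_edgeP. Qed.

Lemma identified_glued x y : identified x y ->
  (punct x.2 <-> punct y.2) /\ (punct x.2 -> glued_points x y).
Proof.
rewrite /identified => H; elim: x y / H => [a b st|a|a b _ [h1 h2]|a b c _ [h1 h2] _ [h3 h4]].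
- case: a b / st => A B p g ep /=; have H : punct p -> glued_points (A.1, p) (B.1, glue A B p).
    by move=> pp; right; exists A, B, p; split=> //; exact: punct_edge_open.
  split=> //; split=> pp; first exact: (glued_points_punct (H pp)).
  have o := punct_edge_open pp (glue_edge g ep).
  by have := glue_open_edge (glued_sym g) o; rewrite glueK // => /open_edgeP[].
- by split; [exact: iff_refl|left].
- by split; [apply: iff_sym|move=> /h1 /h2 /glued_points_sym].
- split; first exact: iff_trans h1 h3.
  by move=> pp; apply: (glued_points_trans (h2 pp)); apply: h4; apply/h1.
Qed.

Lemma glued_identified x y : glued_points x y -> identified x y.
Proof.
move=> [->|[A [B [p [g op -> ->]]]]]; first exact: rst_refl.
apply: rst_step; apply: GlueStep => //; exact: open_edge_sub.
Qed.

Lemma glue_near_origin A B (e : R) : glued A B -> 0 < e ->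
  exists2 p, open_edge A.2 p & end_nbhd (origin A) e p /\ end_nbhd (origin B) e (glue A B p).
Proof.
move=> g e0.
have oA : A.2 != origin A by rewrite eq_sym origin_edge.
have eo : edge A.2 (vertex (origin A) : plane R) by apply: vertex_edge; exact: origin_edge.
have cb : {within edge A.2, continuous (fun z => barycentric (origin B) (glue A B z))}.
  apply: (@within_compose _ _ setT) => //; first exact: glue_continuous.
  by move=> z _; have [a [b [G _]]] := bary_gradient (origin B) z; exact: has_gradient_continuous G.
have /subspace_continuousP /(_ _ eo) c0 := cb.
have b1 : barycentric (origin B) (glue A B (vertex (origin A))) = 1.
  by rewrite glue_origin // bary_vertex eqxx.
have W : nbhs (barycentric (origin B) (glue A B (vertex (origin A)))) [set r : R | 1 - e < r].
  by apply: open_nbhs_nbhs; split; [exact: open_gt|rewrite /= b1 ltrBlDr ltrDl].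
have : nbhs (vertex (origin A) : plane R)
  [set z | edge A.2 z -> 1 - e < barycentric (origin B) (glue A B z)] := c0 _ W.
move=> /nbhs_planeP[d d0 H].
have m0 : 0 < Num.min d e by rewrite lt_min d0 e0.
have [p op [pp bp]] := @end_nbhd_point R _ _ _ oA m0.
have md : Num.min d e <= d by rewrite ge_min lexx.
have me : Num.min d e <= e by rewrite ge_min lexx orbT.
exists p => //; split; first by split=> //; lra.
have /open_edgeP[pB _] := glue_open_edge g op.
split=> //.
have ep := open_edge_sub op.
have close j : `|barycentric j p - barycentric j (vertex (origin A))| < d.
  have /edgeP[pos b0] := ep; have s := edge_bary_sum ep; have po := pos (terminus A).
  rewrite bary_vertex; have [->|[->|->]] := edge_cases A j.
  - by rewrite b0 (negbTE oA) subrr normr0.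
  - by rewrite eqxx mulr1n ltr_norml; lra.
  - by rewrite (negbTE (terminus_origin A)) mulr0n subr0 ltr_norml; lra.
by apply: H => //; [exact: (close i1)|exact: (close i2)].
Qed.

End Gluing.

(** * Heights on the faces and the shifts of gluing isometries *)

Section Atlas.
Context {R : realType} {K : complex R} (s : ideal_metric K).
Implicit Types (A B : face K * 'I_3) (p q : plane R) (i j k : 'I_3) (T : face K).
Local Notation punct := (@punctured_triangle R).
Local Notation ideal := (@ideal_triangle R).

(** Coordinates on a face that respect the labels of the vertices: [fc_rho] is
    the symmetry of the ideal triangle that relates them to the uniformization,
    and [fc_pi] the corresponding permutation of the cusps. *)
Record face_chart T := FaceChart {
  fc_rho : plane R -> plane R;
  fc_rho' : plane R -> plane R;
  fc_pi : 'I_3 -> 'I_3;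
  fc_diffeo : ideal_diffeo fc_rho fc_rho';
  fc_diffeo' : ideal_diffeo fc_rho' fc_rho;
  fc_chart : chart (fc_rho' \o uniformize s T) (parametrize s T \o fc_rho);
  fc_inj : injective fc_pi;
  fc_edge : forall i, uniformize s T @` open_edge i = ideal_edge (fc_pi i);
  fc_height : forall j p, punct p ->
    height (fc_pi j) (uniformize s T p) = height j (fc_rho' (uniformize s T p)) }.

Lemma face_chart_exists T : exists c : face_chart T, True.
Proof.
have [rho [rho' [pi [D1 D2 C inj [E H]]]]] := chart_exists (uniformize_diffeo s T).
by exists (FaceChart D1 D2 C inj E H).
Qed.

Definition the_chart T : face_chart T := projT1 (cid (face_chart_exists T)).

Definition normal T : plane R -> plane R := fc_rho' (the_chart T) \o uniformize s T.
Definition normal_inv T : plane R -> plane R := parametrize s T \o fc_rho (the_chart T).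
(** The signed distance of p to the horocycle at vertex j of T that touches
    those of the other two vertices. *)
Definition bus T j p : R := busemann j (normal T p).

Lemma normal_chart T : chart (normal T) (normal_inv T).
Proof. exact: fc_chart. Qed.

Lemma normal_ideal T p : punct p -> ideal (normal T p).
Proof. by have [[[H _] _ _ _ _] _ _ _] := normal_chart T; exact: H. Qed.

Lemma normalK T p : punct p -> normal_inv T (normal T p) = p.
Proof. by have [[_ H _ _ _] _ _ _] := normal_chart T; exact: H. Qed.

Lemma normal_invK T z : ideal z -> normal T (normal_inv T z) = z.
Proof. by have [[_ _ H _ _] _ _ _] := normal_chart T; exact: H. Qed.

Lemma busE T j p : punct p -> bus T j p = busemann (fc_pi (the_chart T) j) (uniformize s T p).
Proof. by move=> pp; rewrite /bus /busemann fc_height. Qed.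

Lemma uniformize_ideal T p : punct p -> ideal (uniformize s T p).
Proof. by move=> pp; have [[H _] _ _ _ _] := uniformize_diffeo s T; exact: H. Qed.

Lemma open_edge_punct i p : open_edge i p -> punct p. Proof. by case/open_edgeP. Qed.

Lemma hyp_length_ge0 c p q : C1_curve ideal c p q -> (0 <= hyp_length c)%E.
Proof.
move=> C; apply: integral_ge0 => t t01; rewrite lee_fin.
exact: (speed_ge0 (@ideal_upper R) C).
Qed.

Lemma bus_lipschitz T j p q c : punct p -> punct q ->
  C1_curve ideal c (uniformize s T p) (uniformize s T q) ->
  (`|bus T j q - bus T j p|%:E <= hyp_length c)%E.
Proof.
by move=> pp pq C; rewrite !busE //; exact: (busemann_le_length (@ideal_upper R) C).
Qed.

Lemma horocycle_path T j p q : punct p -> punct q -> 0 <= bus T j p -> bus T j q = bus T j p ->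
  exists2 l, path_of_length s (T, p) (T, q) l & (l <= (expR (- bus T j p))%:E)%E.
Proof.
move=> pp pq; rewrite !busE // => h0 e.
have ip := uniformize_ideal T pp; have iq := uniformize_ideal T pq.
set j' := fc_pi _ j in h0 e *.
have hp := height_gt0 j' (ideal_y ip); have hq := height_gt0 j' (ideal_y iq).
have eh : height j' (uniformize s T q) = height j' (uniformize s T p).
  by move: e; rewrite /busemann => /(congr1 expR); rewrite !lnK.
have h1 : 1 <= height j' (uniformize s T p).
  by rewrite -(lnK hp) -expR0 ler_expR.
have [c [C _ L]] := horocycle_curve ip iq h1 eh.
exists (hyp_length c); first exact: PathArc.
by rewrite expRN /busemann lnK.
Qed.

Lemma bus_edge_point T i j (h : R) : i != j -> exists2 p, open_edge i p & bus T j p = h.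
Proof.
move=> ij; have [z [iz sz] e] := edge_point h ij.
have [_ _ _ H] := normal_chart T.
exists (normal_inv T z); first by apply: H.
by rewrite /bus normal_invK.
Qed.

(** The horocycles of height 1 at the ends of a side touch on that side, so
    there the two signed distances are opposite; their sum measures the distance
    to the side. *)
Lemma bus_edge_le T i j k p : punct p -> i != j -> i != k -> j != k ->
  bus T j p + bus T k p <= 0 /\ (bus T j p + bus T k p = 0 <-> open_edge i p).
Proof.
move=> pp ij ik jk; have iz := normal_ideal T pp; have y0 := ideal_y iz.
have hj := height_gt0 j y0; have hk := height_gt0 k y0.
rewrite /bus /busemann -lnM ?posrE //.
have hh : 0 < height j (normal T p) * height k (normal T p) by rewrite mulr_gt0.
split; first by rewrite -ln1 ler_ln ?posrE // heightM_le1.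
have S := side_eq0P y0 ij ik jk; have [_ _ C1 C2] := normal_chart T.
split=> [/(congr1 expR)|op].
  rewrite lnK // expR0 => /S sz; rewrite -(normalK T pp); exact: C2.
by have [_ /S ->] := C1 _ _ op; rewrite ln1.
Qed.

Lemma bus_edge_inj T i j p q : j != i -> open_edge i p -> open_edge i q ->
  bus T j p = bus T j q -> p = q.
Proof.
move=> ji op oq e; have [_ _ C1 _] := normal_chart T.
rewrite -(normalK T (open_edge_punct op)) -(normalK T (open_edge_punct oq)); congr normal_inv.
have e1 := C1 _ _ op; have e2 := C1 _ _ oq.
apply: (ideal_edge_inj ji e1 e2); have [iz1 _] := e1; have [iz2 _] := e2.
by move: e; rewrite /bus /busemann => /(congr1 expR); rewrite !lnK // posrE height_gt0 // ideal_y.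
Qed.

Lemma bus_edge_lipschitz T i j k p q : i != j -> open_edge i p -> open_edge i q ->
  `|bus T k q - bus T k p| <= `|bus T j q - bus T j p|.
Proof.
move=> ij op oq; have [_ _ C1 _] := normal_chart T.
have [c [C _ L]] := edge_curve ij (C1 _ _ op) (C1 _ _ oq).
rewrite -lee_fin; apply: le_trans L.
by apply: (busemann_le_length _ C) => z [iz _]; exact: ideal_upper.
Qed.

Lemma bus_edge_dist T i j p q : i != j -> open_edge i p -> open_edge i q ->
  hyp_length_dist (uniformize s T @` open_edge i) (uniformize s T p) (uniformize s T q) =
  `|bus T j q - bus T j p|%:E.
Proof.
move=> ij op oq; rewrite (fc_edge (the_chart T)).
rewrite (@edge_dist _ _ (fc_pi (the_chart T) j)).
- by rewrite (busE _ _ (open_edge_punct oq)) (busE _ _ (open_edge_punct op)).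
- by apply: contraNneq ij => /fc_inj ->.
- by rewrite -(fc_edge (the_chart T)); exists p.
- by rewrite -(fc_edge (the_chart T)); exists q.
Qed.

(** In arc length parameters that increase toward the origins, the gluing map is
    the translation by r. *)
Definition shift A B (r : R) := forall p, open_edge A.2 p ->
  bus B.1 (origin B) (glue A B p) = bus A.1 (origin A) p + r.

(** An isometry of the line is a translation or a reflection. A gluing map
    preserves the origin, so it keeps points close to the origin close to it,
    and heights above the origins go to +oo together; this excludes reflections. *)
Lemma shift_exists A B : glued A B -> exists r, shift A B r.
Proof.
move=> g.
have oA : A.2 != origin A by rewrite eq_sym origin_edge.
have oB : B.2 != origin B by rewrite eq_sym origin_edge.
have isom p q : open_edge A.2 p -> open_edge A.2 q ->
    `|bus B.1 (origin B) (glue A B q) - bus B.1 (origin B) (glue A B p)| =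
    `|bus A.1 (origin A) q - bus A.1 (origin A) p|.
  move=> op oq; have := glue_isometry s g op oq.
  rewrite (bus_edge_dist _ oB (glue_open_edge g op) (glue_open_edge g oq)).
  by rewrite (bus_edge_dist _ oA op oq) => -[].
pose f p := bus B.1 (origin B) (glue A B p) - bus A.1 (origin A) p.
have const p q : open_edge A.2 p -> open_edge A.2 q -> f p = f q.
  move=> op oq.
  (* The comparison point z is chosen higher than all four heights, so that
     every absolute value below is a difference in the same order. *)
  pose M := expR (`|bus B.1 (origin B) (glue A B p)| + `|bus B.1 (origin B) (glue A B q)| +
     `|bus A.1 (origin A) p| + `|bus A.1 (origin A) q|).
  have [_ EA _ _] := normal_chart A.1; have [_ EB _ _] := normal_chart B.1.
  have [e1 e10 H1] := EA (origin A) M; have [e2 e20 H2] := EB (origin B) M.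
  have m0 : 0 < Num.min e1 e2 by rewrite lt_min e10 e20.
  have [z zo [[pA nA] [pB nB]]] := glue_near_origin g m0.
  have m1 : Num.min e1 e2 <= e1 by rewrite ge_min lexx.
  have m2 : Num.min e1 e2 <= e2 by rewrite ge_min lexx orbT.
  have hA : M < height (origin A) (normal A.1 z) by apply: H1; split=> //; lra.
  have hB : M < height (origin B) (normal B.1 (glue A B z)) by apply: H2; split=> //; lra.
  have M0 : 0 < M by exact: expR_gt0.
  have bA : ln M < bus A.1 (origin A) z by rewrite /bus /busemann ltr_ln ?posrE // (lt_trans M0).
  have bB : ln M < bus B.1 (origin B) (glue A B z) by rewrite /bus /busemann ltr_ln ?posrE // (lt_trans M0).
  rewrite /M expRK in bA bB.
  have := isom _ _ op zo; have := isom _ _ oq zo; rewrite /f.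
  set x := bus B.1 _ (glue A B z) in bB *; set y := bus A.1 _ z in bA *.
  set a := bus B.1 _ (glue A B p) in bA bB *; set b := bus A.1 _ p in bA bB *.
  set a' := bus B.1 _ (glue A B q) in bA bB *; set b' := bus A.1 _ q in bA bB *.
  have l1 := ler_norm a; have l2 := ler_norm b; have l3 := ler_norm a'; have l4 := ler_norm b'.
  have n1 := normr_ge0 a; have n2 := normr_ge0 b; have n3 := normr_ge0 a'; have n4 := normr_ge0 b'.
  have [x1 x2 y1 y2] : [/\ 0 <= x - a, 0 <= x - a', 0 <= y - b & 0 <= y - b'] by split; lra.
  by rewrite !ger0_norm //; lra.
have [p0 op0 _] := bus_edge_point A.1 0 oA.
by exists (f p0) => p op; rewrite -(const _ _ op op0) /f addrC subrK.
Qed.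

End Atlas.

(** * Walks around a vertex *)

Section Holonomy.
Context {R : realType} {K : complex R} (s : ideal_metric K).
Implicit Types (A B : face K * 'I_3) (p q : plane R) (i j k : 'I_3) (T : face K).
Implicit Types (c : face K * 'I_3) (r h : R) (x y z : face K * plane R).
Local Notation punct := (@punctured_triangle R).
Local Notation ideal := (@ideal_triangle R).
Local Notation bus := (bus s).
Local Notation shift := (shift s).

(** Corners of the triangles are pairs of a face and a vertex. Walking around a
    vertex through the gluings leads from the corner c to c' and raises heights
    by r. At the terminus of a side the shift counts with the opposite sign, as
    the two Busemann functions on a side are opposite. *)
Inductive holonomy : face K * 'I_3 -> face K * 'I_3 -> R -> Prop :=
| HolRefl c : holonomy c c 0
| HolOrigin A B r : glued A B -> shift A B r ->
    holonomy (A.1, origin A) (B.1, origin B) r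
| HolTerminus A B r : glued A B -> shift A B r ->
    holonomy (A.1, terminus A) (B.1, terminus B) (- r)
| HolTrans c c' c'' r r' : holonomy c c' r -> holonomy c' c'' r' ->
    holonomy c c'' (r + r').

Lemma shift_sym A B r : glued A B -> shift A B r -> shift B A (- r).
Proof.
move=> g S p op; have g' := glued_sym g.
have := S _ (glue_open_edge g' op); rewrite glueK //; last exact: open_edge_sub.
by move=> ->; rewrite addrK.
Qed.

Lemma shift_terminus A B r p : glued A B -> shift A B r -> open_edge A.2 p ->
  bus B.1 (terminus B) (glue A B p) = bus A.1 (terminus A) p - r.
Proof.
move=> g S op; have oB := glue_open_edge g op.
have E C q : open_edge C.2 q -> bus C.1 (terminus C) q = - bus C.1 (origin C) q.
  move=> oq.
  have tC : C.2 != terminus C by rewrite eq_sym terminus_edge.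
  have oC : C.2 != origin C by rewrite eq_sym origin_edge.
  have [_ [_ /(_ oq) /eqP]] := bus_edge_le s C.1 (open_edge_punct oq) tC oC (terminus_origin C).
  by rewrite addr_eq0 => /eqP.
by rewrite !E // S // opprD.
Qed.

Lemma holonomy_sym c c' r : holonomy c c' r -> holonomy c' c (- r).
Proof.
elim=> [a|A B a g S|A B a g S|a b d a1 a2 _ h1 _ h2].
- by rewrite oppr0; exact: HolRefl.
- by apply: HolOrigin; [exact: glued_sym|exact: shift_sym].
- by apply: HolTerminus; [exact: glued_sym|exact: shift_sym].
- by rewrite opprD addrC; exact: HolTrans h2 h1.
Qed.

Lemma corner_point c h : exists2 p, punct p & bus c.1 c.2 p = h.
Proof.
have [p op e] := @bus_edge_point _ _ s c.1 (nxt c.2) c.2 h (nxt_neq _).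
by exists p => //; exact: open_edge_punct op.
Qed.

Lemma path_of_length_ge0 x y l : path_of_length s x y l -> (0 <= l)%E.
Proof.
elim=> [//|T p q c pp pq C|a b d l1 l2 _ h1 _ h2]; first exact: (hyp_length_ge0 C).
exact: adde_ge0.
Qed.

(** For each gluing that is crossed, the path follows a horocycle to the side
    and continues on the other side at the shifted height. High above the cusp
    these horocycles are exponentially short. *)
Lemma holonomy_travel c c' r : holonomy c c' r ->
  exists C h0 : R, [/\ 0 <= C, 0 <= h0 & forall h p q, h0 <= h -> punct p -> punct q ->
    bus c.1 c.2 p = h -> bus c'.1 c'.2 q = h + r ->
    exists2 l, path_of_length s (c.1, p) (c'.1, q) l & (l <= (C * expR (- h))%:E)%E].
Proof.
have cross A B i k a : glued A B -> i != A.2 -> k != B.2 ->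
  (forall p, open_edge A.2 p -> bus B.1 k (glue A B p) = bus A.1 i p + a) ->
  exists C h0 : R, [/\ 0 <= C, 0 <= h0 & forall h p q, h0 <= h -> punct p -> punct q ->
    bus A.1 i p = h -> bus B.1 k q = h + a ->
    exists2 l, path_of_length s (A.1, p) (B.1, q) l & (l <= (C * expR (- h))%:E)%E].
  move=> g iA kB S; exists (1 + expR (- a)), (Num.max 0 (- a)); split.
  - by rewrite addr_ge0 ?expR_ge0.
  - by rewrite le_max lexx.
  move=> h p q; rewrite ge_max => /andP[h1 h2] pp pq ep eq_.
  have iA' : A.2 != i by rewrite eq_sym.
  have [z oz ez] := @bus_edge_point _ _ s A.1 A.2 i h iA'.
  have pz := open_edge_punct oz; have oz' := glue_open_edge g oz.
  have pz' := open_edge_punct oz'.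
  have [l1 P1 L1] := @horocycle_path _ _ s A.1 i p z pp pz ltac:(by rewrite ep) ltac:(by rewrite ep).
  have [l2 P2 L2] := @horocycle_path _ _ s B.1 k (glue A B z) q pz' pq
    ltac:(by rewrite S // ez; lra) ltac:(by rewrite S // ez).
  exists (l1 + (0 + l2))%E.
    apply: (PathConcat P1); apply: (PathConcat _ P2); apply: PathGlue => //.
    by apply: rst_step; apply: GlueStep => //; exact: open_edge_sub.
  rewrite add0e mulrDl mul1r EFinD; apply: leeD; first by rewrite -ep.
  by move: L2; rewrite S // ez opprD expRD mulrC.
elim=> [a|A B a g S|A B a g S|a b d r1 r2 _ [C1 [h1 [C10 h10 H1]]] _ [C2 [h2 [C20 h20 H2]]]].
- exists 1, 0; split=> // h p q h0 pp pq ep; rewrite addr0 => eq_.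
  have [l P L] := @horocycle_path _ _ s a.1 a.2 p q pp pq ltac:(by rewrite ep) ltac:(by rewrite ep).
  by exists l => //; rewrite mul1r -ep.
- exact: (cross _ _ _ _ _ g (origin_edge A) (origin_edge B) S).
- apply: (cross _ _ _ _ _ g (terminus_edge A) (terminus_edge B)).
  by move=> p op; exact: shift_terminus.
- exists (C1 + C2 * expR (- r1)), (Num.max h1 (h2 - r1)); split.
  + by rewrite addr_ge0 // mulr_ge0 // expR_ge0.
  + by rewrite le_max h10.
  move=> h p q; rewrite ge_max => /andP[hh1 hh2] pp pq ep eq_.
  have [z pz ez] := corner_point b (h + r1).
  have [l1 P1 L1] := H1 h p z hh1 pp pz ep ez.
  have h2' : h2 <= h + r1 by lra.
  have eq' : bus d.1 d.2 q = h + r1 + r2 by rewrite eq_ addrA.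
  have [l2 P2 L2] := H2 (h + r1) z q h2' pz pq ez eq'.
  exists (l1 + l2)%E; first exact: PathConcat P1 P2.
  rewrite mulrDl EFinD; apply: leeD => //.
  by rewrite -mulrA -expRD addrC -opprD.
Qed.

(** The relation J is abstract so that the lemma serves for paths in both
    directions, [length_dist] being defined by directed paths. *)
Lemma geometric_path (J : face K * plane R -> face K * plane R -> \bar R -> Prop)
    (P : nat -> face K * plane R) (C t : R) :
  (forall x y z l m, J x y l -> J y z m -> J x z (l + m)%E) -> 0 <= C -> 0 <= t < 1 ->
  (forall n, exists2 l, J (P n) (P n.+1) l & (l <= (C * t ^+ n)%:E)%E) ->
  forall n (k : nat), exists2 l, J (P n) (P (n + k.+1)%N) l &
    (l <= (C * t ^+ n / (1 - t))%:E)%E.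
Proof.
move=> J_trans C0 /andP[t0 t1] H n k; elim: k n => [|k IH] n; have [l Pl Ll] := H n.
  exists l; first by rewrite addn1.
  apply: (le_trans Ll); rewrite lee_fin ler_pdivlMr ?subr_gt0 //.
  by rewrite ler_piMr ?mulr_ge0 ?exprn_ge0 //; lra.
have [m Pm Lm] := IH n.+1.
exists (l + m)%E; first by apply: (J_trans _ _ _ _ _ Pl); rewrite addnS -addSn.
apply: (le_trans (leeD Ll Lm)); rewrite -EFinD lee_fin le_eqVlt; apply/orP; left; apply/eqP.
by rewrite exprS; field; rewrite subr_eq0 gt_eqF.
Qed.

Lemma length_dist_le x y l : path_of_length s x y l -> (length_dist s x y <= l)%E.
Proof. by move=> P; apply: ereal_inf_lbound. Qed.

(** Repeating the closed walk raises the height by r each time, so the lengths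
    of the successive paths are dominated by a geometric series. *)
Lemma spiral c r : holonomy c c r -> 0 < r -> exists P : nat -> plane R,
  [/\ forall n, punct (P n), forall M, exists N, forall n, (N <= n)%N -> M < bus c.1 c.2 (P n) &
    forall e : R, 0 < e -> exists N, forall m n, (N <= m)%N -> (N <= n)%N ->
      (length_dist s (c.1, P m) (c.1, P n) < e%:E)%E].
Proof.
move=> H r0.
have [C1 [h1 [C10 h10 H1]]] := holonomy_travel H.
have [C2 [h2 [C20 h20 H2]]] := holonomy_travel (holonomy_sym H).
pose h0 := Num.max h1 h2; pose hh n := h0 + n%:R * r.
have [P HP] := choice (fun n : nat => let: ex_intro2 p a b := corner_point c (hh n) in ex_intro _ p (conj a b)).
have hS n : hh n.+1 = hh n + r by rewrite /hh -natr1 mulrDl mul1r addrA.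
have h0n n : h0 <= hh n by rewrite lerDl mulr_ge0 // ltW.
have h1n n : h1 <= hh n by apply: le_trans (h0n n); rewrite le_max lexx.
have h2n n : h2 <= hh n by apply: le_trans (h0n n); rewrite le_max lexx orbT.
pose t := expR (- r); pose C := Num.max C1 C2 * expR (- h0).
have t01 : 0 <= t < 1 by rewrite expR_ge0 -expR0 ltr_expR oppr_lt0.
have C0 : 0 <= C by rewrite mulr_ge0 ?expR_ge0 // le_max C10.
have et n : expR (- hh n) = expR (- h0) * t ^+ n.
  by rewrite /hh opprD expRD -expRM_natl mulrN.
have F n : exists2 l, path_of_length s (c.1, P n) (c.1, P n.+1) l & (l <= (C * t ^+ n)%:E)%E.
  have [p1 e1] := HP n; have [p2 e2] := HP n.+1.
  have [|l Pl Ll] := H1 (hh n) (P n) (P n.+1) (h1n n) p1 p2 e1; first by rewrite e2 hS.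
  exists l => //; apply: (le_trans Ll); rewrite lee_fin et mulrA /C.
  by rewrite !ler_wpM2r ?exprn_ge0 ?expR_ge0 // le_max lexx.
have B n : exists2 l, path_of_length s (c.1, P n.+1) (c.1, P n) l & (l <= (C * t ^+ n)%:E)%E.
  have [p1 e1] := HP n; have [p2 e2] := HP n.+1.
  have [|l Pl Ll] := H2 (hh n.+1) (P n.+1) (P n) (h2n _) p2 p1 e2; first by rewrite e1 hS addrK.
  exists l => //; apply: (le_trans Ll); rewrite lee_fin et mulrA /C.
  apply: (@le_trans _ _ (Num.max C1 C2 * expR (- h0) * t ^+ n.+1)).
    by rewrite !ler_wpM2r ?exprn_ge0 ?expR_ge0 // le_max lexx orbT.
  rewrite ler_wpM2l // exprS ler_piMl ?exprn_ge0 ?expR_ge0 //; case/andP: t01 => _; exact: ltW.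
have GF := geometric_path (P := fun n => (c.1, P n)) (@PathConcat _ _ s) C0 t01 F.
have GB := @geometric_path (fun x y l => path_of_length s y x l) (fun n => (c.1, P n)) C t
  (fun x y z l m Pl Pm => eq_ind _ _ (PathConcat Pm Pl) _ (addeC m l)) C0 t01 B.
exists P; split.
- by move=> n; have [] := HP n.
- move=> M; exists (Num.truncn (`|M - h0| / r)).+1 => n Nn; have [_ ->] := HP n.
  have : `|M - h0| / r < n%:R.
    by apply: lt_le_trans (Num.Theory.truncnS_gt _) _; rewrite ler_nat.
  by rewrite ltr_pdivrMr // => L; rewrite /hh -ltrBlDl; apply: le_lt_trans L; exact: ler_norm.
move=> e e0.
have t1 : 0 < 1 - t by case/andP: t01 => _; rewrite subr_gt0.
have [N HN] : exists N, C * t ^+ N / (1 - t) < e.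
  have et0 : 0 < e * (1 - t) by rewrite mulr_gt0.
  exists (Num.truncn (C / (e * (1 - t)) / r)).+1; set N := _.+1.
  have L : C / (e * (1 - t)) < expR (N%:R * r).
    have : C / (e * (1 - t)) / r < N%:R by exact: Num.Theory.truncnS_gt.
    rewrite ltr_pdivrMr // => L; apply: lt_le_trans L _.
    by apply: le_trans (expR_ge1Dx _); rewrite lerDr.
  have tN : t ^+ N = (expR (N%:R * r))^-1 by rewrite /t -expRM_natl mulrN expRN.
  rewrite ltr_pdivrMr // tN ltr_pdivrMr ?expR_gt0 //.
  by move: L; rewrite ltr_pdivrMr // mulrC.
exists N.
have tn m : (N <= m)%N -> C * t ^+ m / (1 - t) < e.
  move=> Nm; apply: le_lt_trans HN; rewrite ler_pM2r ?invr_gt0 // ler_wpM2l //.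
  by case/andP: t01 => ? /ltW ?; exact: ler_wiXn2l.
move=> m n Nm Nn; have [mn|nm|<-] := ltngtP m n.
- have [l Pl Ll] := GF m (n - m.+1)%N; rewrite addnS -addSn subnKC // in Pl.
  apply: (le_lt_trans (length_dist_le Pl)); apply: (le_lt_trans Ll).
  by rewrite lte_fin; exact: tn.
- have [l Pl Ll] := GB n (m - n.+1)%N; rewrite addnS -addSn subnKC // in Pl.
  apply: (le_lt_trans (length_dist_le Pl)); apply: (le_lt_trans Ll).
  by rewrite lte_fin; exact: tn.
- have [pp _] := HP m.
  by apply: (le_lt_trans (length_dist_le (PathGlue s (x := (c.1, P m)) (y := (c.1, P m)) pp (rst_refl _ _ _)))); rewrite lte_fin.
Qed.

End Holonomy.

(** * Completeness makes the holonomy trivial *)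

Section Completeness.
Context {R : realType} {K : complex R} (s : ideal_metric K).
Implicit Types (A B : face K * 'I_3) (p q : plane R) (i j k : 'I_3) (T : face K).
Implicit Types (c : face K * 'I_3) (r h : R) (x y z : face K * plane R).
Local Notation punct := (@punctured_triangle R).
Local Notation ideal := (@ideal_triangle R).
Local Notation bus := (bus s).
Local Notation shift := (shift s).
Local Notation holonomy := (holonomy s).

(** A ball around y measured in one face, with the largest difference of
    Busemann functions as distance; it is known by its centre q in that face. *)
Definition near_point y r z := exists2 q, glued_points y (z.1, q) &
  forall j, `|bus z.1 j z.2 - bus z.1 j q| <= r.

(** By [bus_edge_le] the sum is negative off the side, so q has a definite
    distance from the sides that do not contain it. *)
Definition separated (d : R) T q := forall i, ~ open_edge i q ->
  bus T (nxt i) q + bus T (nxt (nxt i)) q <= - (3 * d).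

(** The ball of radius d around q meets no side that avoids q, and heights are
    bounded on it. *)
Definition tame (d : R) T q := separated d T q /\ forall j, bus T j q <= d^-1.

Lemma finite_min (I : finType) (P : I -> R -> Prop) :
  (forall a : I, exists2 d : R, 0 < d & forall e : R, 0 < e -> e <= d -> P a e) ->
  exists2 d : R, 0 < d & forall a, P a d.
Proof.
move=> H.
have H' a : exists d : R, 0 < d /\ forall e : R, 0 < e -> e <= d -> P a e.
  by have [d d0 h] := H a; exists d.
have [f Hf] := choice H'.
pose d := \big[Num.min/1]_a f a.
have d0 : 0 < d.
  rewrite /d; elim/big_ind: _ => [|a b a0 b0|a _]; first exact: ltr01.
    by rewrite lt_min a0 b0.
  by have [] := Hf a.
exists d => // a; have [_ h] := Hf a; apply: h => //.
by rewrite /d; exact: bigmin_le_cond.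
Qed.

Lemma tame_point T q : punct q ->
  exists2 d : R, 0 < d & forall e : R, 0 < e -> e <= d -> tame e T q.
Proof.
move=> pq.
pose P (ij : 'I_3 * 'I_3) (d : R) := (~ open_edge ij.1 q ->
   bus T (nxt ij.1) q + bus T (nxt (nxt ij.1)) q <= - (3 * d)) /\ bus T ij.2 q <= d^-1.
have H : exists2 d : R, 0 < d & forall ij (e : R), 0 < e -> e <= d -> P ij e.
  have [|d d0 Hd] := @finite_min _ (fun ij d => forall e : R, 0 < e -> e <= d -> P ij e); last by exists d.
  move=> [i j].
  pose g := - (bus T (nxt i) q + bus T (nxt (nxt i)) q) / 3.
  have [n1 n2 n3] : [/\ i != nxt i, i != nxt (nxt i) & nxt i != nxt (nxt i)].
    by split; rewrite eq_sym ?nxt_neq ?nxt2_neq.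
  have [g0 gE] := bus_edge_le s T pq n1 n2 n3.
  pose d1 := if pselect (open_edge i q) then 1 else g.
  pose d2 := (1 + `|bus T j q|)^-1.
  have N0 : 0 < 1 + `|bus T j q| by rewrite ltr_pwDl.
  have d20 : 0 < d2 by rewrite invr_gt0.
  have d10 : 0 < d1.
    rewrite /d1; case: pselect => // no; rewrite /g.
    have : bus T (nxt i) q + bus T (nxt (nxt i)) q != 0 by apply/eqP => /gE.
    move=> ne; have : bus T (nxt i) q + bus T (nxt (nxt i)) q < 0 by rewrite lt_neqAle ne g0.
    by move=> h; rewrite divr_gt0 // oppr_gt0.
  exists (Num.min d1 d2); first by rewrite lt_min d10 d20.
  move=> e e0; rewrite le_min => /andP[e1 e2] e' e'0 e'e; split=> /=.
    move=> no; move: e1; rewrite /d1 /g; case: pselect => [//|? /= ?]; lra.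
  have : e' <= (1 + `|bus T j q|)^-1 by apply: (le_trans e'e).
  rewrite -[X in X <= _]invrK lef_pV2 ?posrE ?invr_gt0 // => h.
  by apply: le_trans h; apply: le_trans (ler_norm _) _; rewrite lerDr.
have [d d0 Hd] := H; exists d => // e e0 ed; split=> [i no|j].
  by have [h _] := Hd (i, i0) e e0 ed; exact: h.
by have [_ h] := Hd (i0, j) e e0 ed; exact: h.
Qed.

(** Only finitely many points are glued to a given one. *)
Lemma tame_orbit y : punct y.2 ->
  exists2 d : R, 0 < d & forall z, glued_points y z -> tame d z.1 z.2.
Proof.
move=> py.
have [|d d0 H] := @finite_min (option ((face K * 'I_3) * (face K * 'I_3))%type) (fun ab d =>
  match ab with
  | None => tame d y.1 y.2
  | Some (A, B) => forall p, glued A B -> open_edge A.2 p -> y = (A.1, p) -> tame d B.1 (glue A B p)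
  end); last first.
  exists d => // z [<-|[A [B [p [g op ey ->]]]]]; first exact: (H None).
  exact: (H (Some (A, B))).
move=> [[A B]|]; last exact: tame_point.
have [[p [g op ey]]|no] := pselect (exists p, [/\ glued A B, open_edge A.2 p & y = (A.1, p)]).
  have pB := open_edge_punct (glue_open_edge g op).
  have [d d0 H] := tame_point B.1 pB; exists d => // e e0 ed q _ _ ey'.
  by rewrite ey in ey'; case: ey' => <-; exact: H.
by exists 1 => // e _ _ p g op ey; case: no; exists p.
Qed.

Section Ball.
Variables (y : face K * plane R) (d : R).
Hypothesis d0 : 0 < d.
Hypothesis Hd : forall z, glued_points y z -> tame d z.1 z.2.

(** A ball of radius at most d can be left across a side only if the side
    contains its centre. The gluing then translates both points along the side
    by the same amount, and on a side all differences of Busemann functions are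
    bounded by that of an end. *)
Lemma near_point_glued r z z' : r <= d -> glued_points z z' ->
  near_point y r z -> near_point y r z'.
Proof.
move=> rd [<-//|[A [B [p [g op -> ->]]]]] [q /= gq hq].
have [sep _] := Hd gq.
have oq : open_edge A.2 q.
  apply: contrapT => /sep h; rewrite /= in h.
  have [n1 n2 n3] : [/\ A.2 != nxt A.2, A.2 != nxt (nxt A.2) & nxt A.2 != nxt (nxt A.2)].
    by split; rewrite eq_sym ?nxt_neq ?nxt2_neq.
  have [_ [_ /(_ op) e]] := bus_edge_le s A.1 (open_edge_punct op) n1 n2 n3.
  have := hq (nxt A.2); have := hq (nxt (nxt A.2)).
  rewrite /= !ler_norml => /andP[? ?] /andP[? ?].
  suff : d <= 0 by rewrite leNgt d0.
  by clear n1 n2 n3; lra.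
have [r' S] := shift_exists s g.
exists (glue A B q).
  by apply: (glued_points_trans gq); right; exists A, B, q.
move=> j /=.
have oB : B.2 != origin B by rewrite eq_sym origin_edge.
apply: (le_trans (bus_edge_lipschitz s B.1 j oB (glue_open_edge g oq) (glue_open_edge g op))).
by rewrite !S // opprD addrACA subrr addr0.
Qed.

(** An arc of length l changes each Busemann function by at most l, and gluings
    do not change membership in the balls; so a path that ends in a small ball
    has been in balls around y throughout. *)
Lemma near_point_path x z l : path_of_length s x z l ->
  forall r, 0 <= r -> (r%:E + l <= d%:E)%E -> near_point y r z ->
  exists2 r', 0 <= r' /\ (r'%:E <= r%:E + l)%E & near_point y r' x.
Proof.
elim=> [a b pa ab|T p q c pp pq C|a b e l1 l2 P1 h1 P2 h2] r r0.
- rewrite adde0 lee_fin => rd nb; exists r; first by split.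
  have [_ h] := identified_glued ab.
  by apply: near_point_glued nb => //; apply: glued_points_sym; exact: h.
- move=> rd [q' gq hq].
  have L0 := hyp_length_ge0 C.
  have [len E] : exists len, hyp_length c = len%:E.
    have : (hyp_length c < +oo)%E.
      apply: (@le_lt_trans _ _ d%:E); last exact: ltry.
      by apply: le_trans rd; rewrite leeDr // lee_fin.
    by case: (hyp_length c) L0 => // len _ _; exists len.
  rewrite E lee_fin in L0 *; rewrite E -EFinD lee_fin in rd.
  exists (r + len); first by rewrite addr_ge0.
  exists q' => // j /=.
  have := bus_lipschitz j pp pq C; rewrite E lee_fin => Lp.
  have := hq j; rewrite /= => hj.
  by rewrite distrC in Lp; have := ler_normD (bus T j p - bus T j q) (bus T j q - bus T j q');
    rewrite addrA subrK; lra.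
- move=> rd ne.
  have p1 := path_of_length_ge0 P1; have p2 := path_of_length_ge0 P2.
  have [|r' [r'0 hr'] nb] := h2 r r0 _ ne.
    by apply: le_trans rd; rewrite leeD2l // leeDr.
  have [|r'' [r''0 hr''] na] := h1 r' r'0 _ nb.
    by apply: le_trans rd; rewrite addeCA addeC; apply: leeD2r.
  exists r'' => //; split=> //; apply: (le_trans hr'').
  by rewrite [leRHS]addeCA [leRHS]addeC; apply: leeD2r.
Qed.

Lemma near_point_bounded r z j : r <= d -> near_point y r z -> bus z.1 j z.2 <= d^-1 + d.
Proof.
move=> rd [q gq hq]; have [_ h] := Hd gq; have := h j; have := hq j.
by rewrite /= ler_norml => /andP[_ ?] ?; lra.
Qed.

End Ball.

(** A closed walk with r > 0 gives a Cauchy sequence along which heights are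
    unbounded, whereas heights are bounded on a ball around its limit. *)
Lemma complete_holonomy c r : complete_metric s -> holonomy c c r -> r = 0.
Proof.
move=> cs; wlog r0 : r / 0 < r.
  move=> W H; apply/eqP; apply: contraT; rewrite neq_lt => /orP[r0|r0].
    have := W (- r); rewrite oppr_gt0 => /(_ r0 (holonomy_sym H)) /eqP.
    by rewrite oppr_eq0 (lt_eqF r0).
  by have := W r r0 H => e; move: r0; rewrite e ltxx.
move=> H; have [P [pP up cau]] := spiral H r0.
have [|y [py lim]] := cs (fun n => (c.1, P n)) pP.
  by move=> e /cau.
have [d d0 Hd] := tame_orbit py.
have [N1 H1] := lim d d0; have [N2 H2] := up (d^-1 + d).
pose n := maxn N1 N2.
have /ereal_inf_lt [l /= Pl ld] := H1 n (leq_maxl _ _).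
have ny : near_point y 0 y.
  by exists y.2 => [|j]; [left; rewrite -surjective_pairing|rewrite subrr normr0].
have l0 := path_of_length_ge0 Pl.
have [|r' [r'0 hr'] nx] := near_point_path d0 Hd Pl (lexx 0) _ ny.
  by rewrite add0e ltW.
rewrite add0e in hr'.
have r'd : r' <= d by rewrite -lee_fin (le_trans hr') // ltW.
have := near_point_bounded Hd c.2 r'd nx.
by rewrite /= leNgt H2 // leq_maxr.
Qed.

(** A height is chosen at one corner in each class and transported along the
    walks; trivial holonomy makes the result independent of the walk. *)
Lemma complete_potential : complete_metric s ->
  exists w : face K * 'I_3 -> R, forall c c' r, holonomy c c' r -> w c' = w c + r.
Proof.
move=> cs.
pose conn c c' := `[< exists r, holonomy c c' r >].
have ex c : exists c', conn c c' by exists c; apply/asboolP; exists 0; exact: HolRefl.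
pose rep c := xchoose (ex c).
have repP c : exists r, holonomy (rep c) c r.
  by have /asboolP[r H] := xchooseP (ex c); exists (- r); exact: holonomy_sym.
have repE c c' r : holonomy c c' r -> rep c = rep c'.
  move=> H; apply: eq_xchoose => e; apply/asboolP/asboolP => -[r' H'].
    by exists (- r + r'); apply: (HolTrans (holonomy_sym H)).
  by exists (r + r'); exact: (HolTrans H).
have [w Hw] := choice repP.
exists w => c c' r H; have h1 := Hw c; have h2 := Hw c'.
rewrite (repE _ _ _ H) in h1.
have L := HolTrans (HolTrans h1 H) (holonomy_sym h2).
by have := complete_holonomy cs L; lra.
Qed.

End Completeness.

(** * A smooth step function *)

Section Step.
Context {R : realType}.
Implicit Types (x t : R) (p : plane R).
Let oT : open [set: plane R] := openT.

(** Smoothness is phrased by [CkR] rather than by iterated one-variable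
    derivatives, so that composition with functions on the plane stays within
    one calculus. *)
Definition smoothR (f : R -> R) := forall k, CkR k setT f.

Lemma smoothR_derive f : smoothR f ->
  (forall x, is_derive x (1 : R) f (derive1 f x)) /\ smoothR (derive1 f).
Proof.
move=> sf.
pose D (p : plane R) := 'D_((0, 1) : plane R) (f \o snd) p.
have G p : has_gradient (f \o snd) p ('D_((1, 0) : plane R) (f \o snd) p) (D p).
  exact: (@Ck_gradient _ 0 setT _ p oT I (sf 1%N)).
have E a x : is_derive x (1 : R) f (D (a, x)).
  exact: (is_derive_slice2 (has_gradient_derivable (v := (0, 1)) (G (a, x)))).
have DE a x : derive1 f x = D (a, x) by rewrite derive1E; case: (E a x).
split=> [x|k]; first by rewrite (DE 0); exact: E.
have C : Ck k setT D.
  by have [_ /(_ (0, 1) (or_intror erefl))[]] := sf k.+1.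
by apply: Ck_congr C => // -[a x] _; rewrite /= -DE.
Qed.

Lemma smoothR_cst (a : R) : smoothR (fun=> a). Proof. by move=> k; exact: Ck_cst. Qed.
Lemma smoothR_id : smoothR id. Proof. by move=> k; exact: Ck_snd. Qed.
Lemma smoothRD f g : smoothR f -> smoothR g -> smoothR (fun x => f x + g x).
Proof. by move=> sf sg k; exact: (CkD oT (sf k) (sg k)). Qed.
Lemma smoothRM f g : smoothR f -> smoothR g -> smoothR (fun x => f x * g x).
Proof. by move=> sf sg k; exact: (CkM oT (sf k) (sg k)). Qed.
Lemma smoothR_comp f g : smoothR f -> smoothR g -> smoothR (fun x => g (f x)).
Proof. by move=> sf sg k; exact: (CkR_comp oT openT (fun _ _ => I) (sg k) (sf k)). Qed.
Lemma smoothRN f : smoothR f -> smoothR (fun x => - f x).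
Proof. by move=> sf k; exact: (CkN oT (sf k)). Qed.
Lemma smoothR_affine (a b : R) : smoothR (fun x => a * x + b).
Proof.
apply: smoothRD; last exact: smoothR_cst.
by apply: smoothRM; [exact: smoothR_cst|exact: smoothR_id].
Qed.

(** The functions x ^ - n * exp (- 1 / x), extended by 0. Their span is stable
    under differentiation, which gives smoothness for all of its members at
    once. *)
Definition flat (n : nat) x : R := if 0 < x then x^-1 ^+ n * expR (- x^-1) else 0.

Lemma flat_ge0 n x : 0 <= flat n x.
Proof. by rewrite /flat; case: ifP => // x0; rewrite mulr_ge0 ?expR_ge0 ?exprn_ge0 ?invr_ge0 ?ltW. Qed.

Lemma flat_le0 n x : x <= 0 -> flat n x = 0.
Proof. by rewrite /flat leNgt => /negbTE ->. Qed.

(** From exp t >= (t / m) ^ m with t = 1 / x and m = n + 2; a quadratic bound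
    gives the derivative 0 at the origin. *)
Lemma flat_bound n x : flat n x <= (n.+2)%:R ^+ n.+2 * x ^+ 2.
Proof.
rewrite /flat; case: ifP => [x0|_]; last by rewrite mulr_ge0 ?sqr_ge0 ?exprn_ge0.
set m := n.+2; have m0 : 0 < m%:R :> R by rewrite ltr0n.
have t0 : 0 < x^-1 by rewrite invr_gt0.
have L : (x^-1 / m%:R) ^+ m <= expR (x^-1).
  rewrite [X in _ <= expR X](_ : _ = m%:R * (x^-1 / m%:R)); last by field; rewrite !gt_eqF.
  rewrite expRM_natl ler_pXn2r ?nnegrE ?expR_ge0 //; last by rewrite ltW // divr_gt0.
  by apply: le_trans (expR_ge1Dx _); rewrite lerDr.
have P0 : 0 < (x^-1 / m%:R) ^+ m by rewrite exprn_gt0 // divr_gt0.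
have L2 : expR (- x^-1) <= ((x^-1 / m%:R) ^+ m)^-1.
  by rewrite expRN lef_pV2 ?posrE ?expR_gt0.
apply: le_trans (_ : x^-1 ^+ n * ((x^-1 / m%:R) ^+ m)^-1 <= _).
  by rewrite ler_wpM2l // exprn_ge0 // ltW.
rewrite le_eqVlt; apply/orP; left; apply/eqP.
have xn : x ^+ n != 0 by rewrite expf_neq0 // gt_eqF.
rewrite expr_div_n invf_div !exprVn invrK (_ : x ^+ m = x ^+ n * x ^+ 2); last by rewrite -exprD addn2.
by rewrite mulrCA mulKf.
Qed.

Lemma flat_gradient n p : has_gradient (flat n \o snd) p 0 (flat n.+2 p.2 - n%:R * flat n.+1 p.2).
Proof.
have [p0|p0|p0] := ltgtP p.2 0.
- have N : \forall q \near p, 0 = (flat n \o snd) q.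
    apply/nbhs_planeP; exists (- p.2); first by rewrite oppr_gt0.
    move=> q _; rewrite ltr_norml /= /flat => /andP[_ h].
    by rewrite ifF //; apply/negbTE; rewrite -leNgt; lra.
  have := has_gradient_near N (has_gradient_cst 0 p).
  by rewrite /flat !ifF ?mulr0 ?subrr //; apply/negbTE; rewrite -leNgt ltW.
- have N : \forall q \near p, ((fun t => t ^+ n * expR (- t)) \o (fun q : plane R => q.2^-1)) q = (flat n \o snd) q.
    apply/nbhs_planeP; exists p.2 => // q _; rewrite ltr_norml /= /flat => /andP[h _].
    by rewrite ifT //; lra.
  apply: (has_gradient_near N).
  have Gi := has_gradientV (has_gradient_snd p) (lt0r_neq0 p0).
  have Dt t : is_derive t (1 : R) (fun t => t ^+ n * expR (- t))
      (n%:R * t ^+ n.-1 * expR (- t) - t ^+ n * expR (- t)).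
    have h1 : is_derive t (1 : R) (fun t : R => t ^+ n) (n%:R * t ^+ n.-1).
      by split; [exact: exprn_derivable|rewrite exp_derive /GRing.scale /= mulr1].
    have h2 := @is_derive1_comp R expR -%R t _ _ (is_derive_expR _) (is_deriveNid t (1 : R)).
    have h := is_deriveM h1 h2.
    apply: (is_derive_eq h); rewrite /GRing.scale /=; ring.
  have G := has_gradient_comp1 (Dt p.2^-1) Gi.
  rewrite /flat !ifT //.
  move: G; congr has_gradient; first by rewrite oppr0 mul0r mulr0.
  have E : n%:R * p.2^-1 ^+ n.-1 * p.2^-1 = n%:R * p.2^-1 ^+ n.
    by case: (n) => [|m]; rewrite ?mul0r //= -mulrA -exprSr.
  rewrite mulN1r -[(p.2 ^+ 2)^-1]exprVn.
  transitivity ((p.2^-1 ^+ n * p.2^-1 ^+ 2 - n%:R * p.2^-1 ^+ n.-1 * p.2^-1 * p.2^-1) * expR (- p.2^-1)).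
    by rewrite !expr2; ring.
  by rewrite E !exprS; ring.
- rewrite p0 !flat_le0 // mulr0 subrr; apply/has_gradient_epsP => e e0.
  set K := (n.+2)%:R ^+ n.+2 : R.
  have K0 : 0 < K by rewrite exprn_gt0.
  exists (e / K); first by rewrite divr_gt0.
  move=> q _; rewrite /= p0 subr0 (flat_le0 n (lexx 0)) !mul0r !subr0 => hq.
  have := flat_bound n q.2; have := flat_ge0 n q.2; rewrite -/K => f0 fb.
  rewrite ger0_norm //; apply: (le_trans fb).
  rewrite -real_normK ?num_real // expr2 mulrA.
  have h : K * `|q.2| <= e by rewrite mulrC -ler_pdivlMr // ltW.
  apply: le_trans (_ : e * `|q.2| <= _); first by rewrite ler_wpM2r.
  by rewrite ler_pM2l // lerDr.
Qed.

Lemma flat_smooth n : smoothR (flat n).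
Proof.
move=> k; elim: k n => [|k IH] n.
  by split=> // p _; exact: (has_gradient_continuous (flat_gradient n p)).
apply/(CkSP _ _ oT); exists (fun=> 0), (fun p => flat n.+2 p.2 - n%:R * flat n.+1 p.2); split.
- by move=> p _; exact: flat_gradient.
- exact: Ck_cst.
- apply: (CkB oT (IH n.+2)); exact: (CkM oT (Ck_cst _ _ oT) (IH n.+1)).
Qed.

Definition step x : R := flat 0 x / (flat 0 x + flat 0 (1 - x)).

Lemma flat0_gt0 x : 0 < x -> 0 < flat 0 x.
Proof. by move=> x0; rewrite /flat x0 expr0 mul1r expR_gt0. Qed.

Lemma step_den_gt0 x : 0 < flat 0 x + flat 0 (1 - x).
Proof.
have [x0|x0] := ltP 0 x; first by rewrite ltr_wpDr ?flat_ge0 ?flat0_gt0.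
by rewrite ltr_wpDl ?flat_ge0 ?flat0_gt0 //; lra.
Qed.

Lemma step_le0 x : x <= 0 -> step x = 0.
Proof. by move=> x0; rewrite /step flat_le0 // mul0r. Qed.

Lemma step_ge1 x : 1 <= x -> step x = 1.
Proof.
move=> x1; have := step_den_gt0 x; rewrite /step (@flat_le0 _ (1 - x)); last by lra.
by rewrite addr0 => h; rewrite divff // gt_eqF.
Qed.

Lemma step_itv x : 0 <= step x <= 1.
Proof.
apply/andP; split.
  by apply: divr_ge0; [exact: flat_ge0|exact: (ltW (step_den_gt0 x))].
by rewrite /step ler_pdivrMr ?step_den_gt0 // mul1r lerDl flat_ge0.
Qed.

Lemma step_smooth : smoothR step.
Proof.
have s1 : smoothR (fun x => flat 0 (1 - x)).
  have s := smoothR_comp (smoothR_affine (-1) 1) (flat_smooth 0).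
  move=> k; apply: Ck_congr (s k) => // p _ /=; congr flat; ring.
move=> k; have sd := smoothRD (flat_smooth 0) s1.
have Cv := Ck_inv oT (fun p _ => lt0r_neq0 (step_den_gt0 p.2)) (sd k).
exact: (CkM oT (flat_smooth 0 k) Cv).
Qed.

Lemma smoothR_continuous f : smoothR f -> continuous f.
Proof.
move=> sf x; have [D _] := smoothR_derive sf.
by have [/derivable1_diffP /differentiable_continuous h _] := D x.
Qed.

(** The derivative is continuous and vanishes outside the unit interval. *)
Lemma step_derive_bound : exists2 C : R, 0 < C & forall x, `|derive1 step x| <= C.
Proof.
have [D sD] := smoothR_derive step_smooth.
have c : {within `[0, 1], continuous (fun x => `|derive1 step x|)}.
  apply: continuous_subspaceT => x; apply: continuous_comp; last exact: norm_continuous.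
  exact: (smoothR_continuous sD).
have [z _ H] := EVT_max ler01 c.
exists (`|derive1 step z| + 1); first by rewrite ltr_wpDl.
move=> x.
have out (y a : R) : (\forall z \near y, cst a z = step z) -> derive1 step y = 0.
  move=> N; rewrite derive1E -(near_eq_derive (1 : R) N); exact: derive_cst.
have [x0|x0] := ltP x 0.
  rewrite (out x 0) ?normr0 ?addr_ge0 //; near=> y; rewrite step_le0 //.
  by apply: ltW; near: y; exact: lt_nbhsl.
have [x1|x1] := ltP 1 x.
  rewrite (out x 1) ?normr0 ?addr_ge0 //; near=> y; rewrite step_ge1 //.
  by apply: ltW; near: y; exact: lt_nbhsr.
apply: (@le_trans _ _ `|derive1 step z|); last by rewrite lerDl.
by apply: H; rewrite in_itv /= x0 x1.
Unshelve. all: by end_near. Qed.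

End Step.

(** * Diffeomorphisms of the line that are translations near both ends *)

Section LineDiffeos.
Context {R : realType}.
Implicit Types (f g : R -> R) (a b x t : R).

(** The admissible maps of a side in an arc length parameter. The bounds on the
    derivative and the translations near the ends are what keeps the energy
    density of the extensions to the triangle bounded. *)
Record line_diffeo a b f : Prop := LineDiffeo {
  ld_smooth : smoothR f;
  ld_bound : exists c C : R, 0 < c /\ forall x, c <= derive1 f x <= C;
  ld_ends : exists2 M : R, 0 <= M &
    (forall x, x <= - M -> f x = x + a) /\ (forall x, M <= x -> f x = x + b) }.

Lemma ld_derive a b f x : line_diffeo a b f -> is_derive x (1 : R) f (derive1 f x).
Proof. by move=> [sf _ _]; have [D _] := smoothR_derive sf. Qed.

Lemma ld_increasing a b f x t : line_diffeo a b f -> x < t -> f x < f t.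
Proof.
move=> L xt; have [_ [c [C [c0 H]]] _] := L.
have [||z _ E] := @MVT R f (derive1 f) x t xt.
- by move=> y _; exact: ld_derive L.
- exact/continuous_subspaceT/smoothR_continuous/(ld_smooth L).
rewrite -subr_gt0 E mulr_gt0 ?subr_gt0 //; apply: lt_le_trans c0 _.
by case/andP: (H z).
Qed.

Lemma ld_le a b f x t : line_diffeo a b f -> x <= t -> f x <= f t.
Proof.
by move=> L; rewrite le_eqVlt => /predU1P[->//|/(ld_increasing L)/ltW].
Qed.

Lemma ld_inj a b f : line_diffeo a b f -> injective f.
Proof.
move=> L x t e; apply/eqP; apply: contraT; rewrite neq_lt => /orP[] /(ld_increasing L);
  by rewrite e ltxx.
Qed.

Lemma ld_bounded a b f : line_diffeo a b f -> exists2 B : R, 0 <= B & forall x, `|f x - x| <= B.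
Proof.
move=> L; have [_ _ [M M0 [H1 H2]]] := L.
have a0 := normr_ge0 a; have b0 := normr_ge0 b.
exists (2 * M + `|a| + `|b|); first by rewrite !addr_ge0 // mulr_ge0.
move=> x; have [x1|x1] := leP x (- M).
  by rewrite H1 // addrC addrA addNr add0r; lra.
have [x2|x2] := leP M x.
  by rewrite H2 // addrC addrA addNr add0r; lra.
have := ld_le L (ltW x1); have := ld_le L (ltW x2).
rewrite (H1 (- M) (lexx _)) (H2 M (lexx _)) => h1 h2; have := ler_norm b; have := ler_norm (- a); rewrite normrN.
by rewrite ler_norml; lra.
Qed.

Lemma surj_of_bounded f B : continuous f -> (forall x, `|f x - x| <= B) -> forall t, exists x, f x = t.
Proof.
move=> cf H t.
have h1 := H (t - B); have h2 := H (t + B); have B0 : 0 <= B := le_trans (normr_ge0 _) h1.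
have [|||x _ E] := @IVT R f (t - B) (t + B) t; last by exists x.
- lra.
- exact: continuous_subspaceT.
move: h1 h2; rewrite !ler_norml ge_min le_max => /andP[? ?] /andP[? ?].
by apply/andP; split; apply/orP; [left|right]; lra.
Qed.

Lemma ld_surj a b f : line_diffeo a b f -> forall t, exists x, f x = t.
Proof.
move=> L; have [B _ H] := ld_bounded L.
exact: (surj_of_bounded (smoothR_continuous (ld_smooth L)) H).
Qed.

Lemma ld_comp a b c d f g : line_diffeo a b f -> line_diffeo c d g ->
  line_diffeo (a + c) (b + d) (fun x => g (f x)).
Proof.
move=> L L'; have [sf [c1 [C1 [c10 H1]]] [M M0 [f1 f2]]] := L.
have [sg [c2 [C2 [c20 H2]]] [N N0 [g1 g2]]] := L'.
have D x : derive1 (fun x => g (f x)) x = derive1 g (f x) * derive1 f x.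
  by rewrite derive1E; case: (is_derive1_comp (ld_derive (f x) L') (ld_derive x L)).
split; first exact: smoothR_comp.
  exists (c2 * c1), (C2 * C1); split=> [|x]; first exact: mulr_gt0.
  rewrite D; have /andP[h1 h2] := H1 x; have /andP[h3 h4] := H2 (f x).
  by rewrite !ler_pM //; lra.
have a0 := normr_ge0 a; have b0 := normr_ge0 b; have a1 := ler_norm a; have b1 := ler_norm (- b).
rewrite normrN in b1.
exists (M + N + `|a| + `|b|); first by rewrite !addr_ge0.
split=> x hx; first by rewrite f1 ?g1 -?addrA //; lra.
by rewrite f2 ?g2 -?addrA //; lra.
Qed.

Lemma derive1_affine (u v x : R) : derive1 (fun x => u * x + v) x = u.
Proof.
rewrite derive1E; have := is_derive_affine v u x.
have -> : (fun s => v + s * u) = (fun x => u * x + v) by apply/funext => z; ring.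
by case.
Qed.

Lemma ld_translate a b f (u v : R) : line_diffeo a b f ->
  line_diffeo (a - u + v) (b - u + v) (fun x => f (x - u) + v).
Proof.
have T (w : R) : line_diffeo w w (fun x => x + w).
  have E : (fun x => x + w) = (fun x => 1 * x + w) by apply/funext => z; rewrite mul1r.
  split; [by rewrite E; exact: smoothR_affine|exists 1, 1|by exists 0].
  by split=> // x; rewrite E derive1_affine lexx.
move=> L; have := ld_comp (ld_comp (T (- u)) L) (T v).
by rewrite ![- u + _]addrC.
Qed.

Lemma ld_reflect a b f : line_diffeo a b f -> line_diffeo (- b) (- a) (fun x => - f (- x)).
Proof.
move=> L; have [sf [c [C [c0 H]]] [M M0 [f1 f2]]] := L.
have sN : smoothR (fun x : R => - x) by apply: smoothRN; exact: smoothR_id.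
split.
- exact: (smoothRN (smoothR_comp sN sf)).
- exists c, C; split=> // x.
  have D1 := @is_derive1_comp R f -%R x _ _ (ld_derive (- x) L) (is_deriveNid x (1 : R)).
  have D2 := is_deriveN D1.
  have E : (fun x => - f (- x)) = - (f \o -%R) by apply/funext.
  by rewrite E derive1E; case: D2 => _ ->; rewrite mulrN1 opprK.
- exists M => //; split=> x hx; [rewrite f2|rewrite f1]; rewrite ?opprD ?opprK //; lra.
Qed.

(** The inverse is smooth by [fiber_inverse_smooth], for a map whose fibers all
    carry f. *)
Lemma ld_inverse a b f : line_diffeo a b f -> exists g, [/\ line_diffeo (- a) (- b) g,
  forall t, f (g t) = t & forall x, g (f x) = x].
Proof.
move=> L; have [g fg] := choice (ld_surj L); exists g.
have [sf [c [C [c0 H]]] [M M0 [f1 f2]]] := L.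
have gf x : g (f x) = x by apply: (ld_inj L).
have oT := @openT (plane R).
have G (p : plane R) : has_gradient (f \o snd) p 0 (derive1 f p.2).
  have := has_gradient_comp1 (ld_derive p.2 L) (has_gradient_snd p).
  by rewrite mulr0 mulr1.
have pos (p : plane R) : 0 < derive1 f p.2.
  by apply: lt_le_trans c0 _; case/andP: (H p.2).
have sg : smoothR g.
  exact: (@fiber_inverse_smooth R (f \o snd) (fun=> 0) (fun p => derive1 f p.2) (g \o snd) G pos (fun _ t => fg t) sf).
have [Dg _] := smoothR_derive sg.
have Eg t : derive1 f (g t) * derive1 g t = 1.
  have [_ h] := is_derive1_comp (ld_derive (g t) L) (Dg t).
  rewrite -h (_ : f \o g = id); last by apply/funext => z; exact: fg.
  exact: derive_id.
have a0 := normr_ge0 a; have b0 := normr_ge0 b; have a1 := ler_norm (- a); have b1 := ler_norm b.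
rewrite normrN in a1; have a2 := ler_norm a; have b2 := ler_norm (- b); rewrite normrN in b2.
split=> //; split=> //.
- have C0 : 0 < C by have /andP[h1 h2] := H 0; lra.
  exists C^-1, c^-1; split=> [|t]; first by rewrite invr_gt0.
  have -> : derive1 g t = (derive1 f (g t))^-1.
    by rewrite -[LHS]mul1r -(mulVf (lt0r_neq0 (pos (0, g t)))) /= -mulrA Eg mulr1.
  have /andP[h1 h2] := H (g t); have p0 := pos (0, g t); rewrite /= in p0.
  by rewrite !lef_pV2 ?posrE // h1 h2.
- exists (M + `|a| + `|b|); first by rewrite !addr_ge0.
  by split=> t ht; apply: (ld_inj L); rewrite fg; [rewrite f1|rewrite f2]; lra.
Qed.

(** The function x + d * step (x / n), whose derivative is at least 1/2 when n
    is large. *)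
Lemma ld_step (d : R) : exists f, line_diffeo 0 d f /\ forall x, x <= 0 -> f x = x.
Proof.
have [C C0 HC] := @step_derive_bound R.
have d0 := normr_ge0 d.
pose n := 2 * C * `|d| + 1.
have n1 : 1 <= n by rewrite /n lerDr !mulr_ge0 // ltW.
have n0 : 0 < n by lra.
have E : (fun x => x + d * step (x / n)) = (fun x => x + d * step (n^-1 * x + 0)).
  by apply/funext => x; rewrite addr0 mulrC [x / n]mulrC mulrC.
have ss : smoothR (fun x => step (n^-1 * x + 0)).
  exact: (smoothR_comp (smoothR_affine _ _) step_smooth).
have [Ds _] := smoothR_derive (@step_smooth R).
have D x : is_derive x (1 : R) (fun x => x + d * step (x / n)) (1 + d * (derive1 step (x / n) * n^-1)).
  have da : is_derive x (1 : R) (fun x => x / n) n^-1.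
    have := is_derive_affine 0 n^-1 x.
    by have -> : (fun s => 0 + s * n^-1) = (fun x => x / n) by apply/funext => z; rewrite add0r.
  have h1 := @is_derive1_comp R step (fun x => x / n) x _ _ (Ds (x / n)) da.
  have h2 := is_deriveM (is_derive_cst d x (1 : R)) h1.
  have h3 := is_deriveD (is_derive_id x (1 : R)) h2.
  apply: (is_derive_eq h3); rewrite /GRing.scale /= mulr0 addr0 //.
exists (fun x => x + d * step (x / n)); split; last first.
  by move=> x x0; rewrite step_le0 ?mulr0 ?addr0 // mulr_le0_ge0 // invr_ge0 ltW.
split.
- rewrite E; apply: smoothRD; first exact: smoothR_id.
  by apply: smoothRM ss; exact: smoothR_cst.
- exists 2^-1, (2^-1 + 1); split=> // x; rewrite derive1E; have [_ ->] := D x.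
  have : `|d * (derive1 step (x / n) * n^-1)| <= 2^-1.
    rewrite !normrM [`|n^-1|]gtr0_norm ?invr_gt0 // mulrA ler_pdivrMr //.
    have : `|d| * `|derive1 step (x / n)| <= `|d| * C by rewrite ler_wpM2l.
    by rewrite /n; lra.
  by rewrite ler_norml => /andP[? ?]; lra.
- exists n; first exact: ltW.
  split=> x hx; last by rewrite step_ge1 ?mulr1 // ler_pdivlMr ?mul1r.
  rewrite step_le0 ?mulr0 // mulr_le0_ge0 ?invr_ge0 ?ltW //; lra.
Qed.

Lemma ld_interpolate (d : R) : exists f, line_diffeo d 0 f.
Proof.
have [f [L _]] := ld_step (- d).
by exists (fun x => - f (- x)); have := ld_reflect L; rewrite opprK oppr0.
Qed.

End LineDiffeos.

(** * Extension of side maps to the ideal triangle *)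

Section FiberMap.
Context {R : realType}.
Implicit Types (p q : plane R) (x s : R).
Local Notation ideal := (@ideal_triangle R).
Local Notation upper := (@upper R).
Let oT : open [set: plane R] := openT.

Section OneMap.
Variables (l M B c1 C1 : R) (k kappa : R -> R).
Hypothesis Lk : line_diffeo 0 l k.
Hypothesis Lkappa : line_diffeo 0 l kappa.
Hypothesis k0 : forall s, s <= 0 -> k s = s.
Hypothesis M0 : 0 <= M.
Hypothesis kappaN : forall s, s <= - M -> kappa s = s.
Hypothesis kappaM : forall s, M <= s -> kappa s = k s.
Hypothesis Bk : forall s, `|k s - s| <= B.
Hypothesis Bkappa : forall s, `|kappa s - s| <= B.
Hypothesis c10 : 0 < c1.
Hypothesis dk : forall s, c1 <= derive1 k s <= C1.
Hypothesis dkappa : forall s, c1 <= derive1 kappa s <= C1.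

Let e := expR (- (2 * M)).
Let e0 : 0 < e. Proof. exact: expR_gt0. Qed.

(** The weight of kappa, 1 on the side x = 0 and 0 for x >= e. The bottom side
    over x < e lies at logarithmic height below - M, since there y ^ 2 = x - x ^
    2 < exp (- 2 M); at such heights both k and kappa are the identity. *)
Definition weight x := 1 - step (x / e).

(** On the vertical lines, parametrized by the logarithm s of the height, mu
    interpolates between kappa on the side x = 0 and k on the side x = 1. A
    convex combination of increasing functions is increasing. *)
Definition mu p := k p.2 + weight p.1 * (kappa p.2 - k p.2).
Definition mux p := - (derive1 step (p.1 / e) / e) * (kappa p.2 - k p.2).
Definition mus p := derive1 k p.2 + weight p.1 * (derive1 kappa p.2 - derive1 k p.2).

Lemma weight_itv x : 0 <= weight x <= 1.
Proof. by have := step_itv (x / e); rewrite /weight => /andP[? ?]; apply/andP; split; lra. Qed.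

Lemma weight0 : weight 0 = 1.
Proof. by rewrite /weight mul0r step_le0 ?subr0. Qed.

Lemma weight_ge x : e <= x -> weight x = 0.
Proof. by move=> h; rewrite /weight step_ge1 ?subrr // ler_pdivlMr ?mul1r. Qed.

Lemma mu_smooth n : Ck n setT mu.
Proof.
have sw : Ck n setT (fun p : plane R => weight p.1).
  have C : Ck n setT (fun p : plane R => step (p.1 / e)).
    have Ce : Ck n setT (fun p : plane R => p.1 / e) := CkM oT (Ck_fst n oT) (Ck_cst n e^-1 oT).
    exact: (CkR_comp oT openT (fun _ _ => I) (step_smooth n) Ce).
  exact: (CkB oT (Ck_cst n 1 oT) C).
have Ck_ := ld_smooth Lk n; have Ckap := ld_smooth Lkappa n.
exact: (CkD oT Ck_ (CkM oT sw (CkB oT Ckap Ck_))).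
Qed.

Lemma mu_gradient p : has_gradient mu p (mux p) (mus p).
Proof.
have Gk := has_gradient_comp1 (ld_derive p.2 Lk) (has_gradient_snd p).
have Gkap := has_gradient_comp1 (ld_derive p.2 Lkappa) (has_gradient_snd p).
have [Ds _] := smoothR_derive (@step_smooth R).
have Ge := has_gradientM (has_gradient_fst p) (has_gradient_cst e^-1 p).
have Gs := has_gradient_comp1 (Ds (p.1 / e)) Ge.
have Gw := has_gradientD (has_gradient_cst 1 p) (has_gradientM (has_gradient_cst (-1) p) Gs).
have Gd := has_gradientD Gkap (has_gradientM (has_gradient_cst (-1) p) Gk).
have := has_gradientD Gk (has_gradientM Gw Gd).
rewrite (_ : (fun q => _) = mu); last first.
  by apply/funext => q; rewrite /mu /weight /= !mulN1r.
by congr has_gradient; rewrite /mux /mus /weight /=; ring.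
Qed.

Lemma mus_itv p : c1 <= mus p <= C1.
Proof.
have /andP[a1 a2] := dk p.2; have /andP[b1 b2] := dkappa p.2.
have /andP[w0 w1] := weight_itv p.1; rewrite /mus.
by apply/andP; split; nra.
Qed.

Lemma mus_gt0 p : 0 < mus p.
Proof. by apply: lt_le_trans c10 _; case/andP: (mus_itv p). Qed.

Lemma mu_bounded p : `|mu p - p.2| <= B.
Proof.
have /andP[w0 w1] := weight_itv p.1; have := Bk p.2; have := Bkappa p.2.
rewrite !ler_norml /mu => /andP[? ?] /andP[? ?]; apply/andP; split; nra.
Qed.

Lemma mu_fixed p : 0 <= p.1 <= 1 -> expR (2 * p.2) <= p.1 - p.1 ^+ 2 -> mu p = p.2.
Proof.
move=> /andP[x0 x1] h.
have s0 : p.2 <= 0.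
  suff : 2 * p.2 <= 0 by lra.
  rewrite -ler_expR expR0; apply: (le_trans h); nra.
rewrite /mu k0 //; have [xe|xe] := leP e p.1.
  by rewrite weight_ge // mul0r addr0.
rewrite kappaN ?subrr ?mulr0 ?addr0 //.
have : expR (2 * p.2) < e by apply: le_lt_trans h _; nra.
by rewrite /e ltr_expR; lra.
Qed.

(** The horizontal derivative enters the energy density multiplied by the
    height. The product stays bounded up to the cusp because kappa and k agree
    above M. *)
Lemma mux_bound (C0 : R) p : (forall x, `|derive1 step x| <= C0) -> 
  expR p.2 * `|mux p| <= expR M * (C0 / e * (2 * B)).
Proof.
move=> HC.
have B0 : 0 <= B := le_trans (normr_ge0 _) (Bk 0).
have C00 : 0 <= C0 := le_trans (normr_ge0 _) (HC 0).
have r0 : 0 <= C0 / e * (2 * B) by rewrite !mulr_ge0 // invr_ge0 ltW.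
have [Ms|sM] := leP M p.2.
  by rewrite /mux kappaM // subrr mulr0 normr0 mulr0 mulr_ge0 // expR_ge0.
apply: ler_pM; [exact: expR_ge0|exact: normr_ge0|by rewrite ler_expR ltW|].
rewrite /mux normrM normrN normrM; apply: ler_pM => //.
  rewrite normfV (gtr0_norm e0) ler_pM2r ?invr_gt0 //.
rewrite (_ : kappa p.2 - k p.2 = (kappa p.2 - p.2) - (k p.2 - p.2)); last by ring.
apply: le_trans (ler_normB _ _) _; have := Bk p.2; have := Bkappa p.2; lra.
Qed.

Lemma mu_surj x t : exists s, mu (x, s) = t.
Proof.
apply: (@surj_of_bounded R (fun s => mu (x, s)) B) => [s|s]; last exact: (mu_bounded (x, s)).
have := is_derive_slice2 (has_gradient_derivable (v := (0, 1)) (mu_gradient (x, s))).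
by move=> [/derivable1_diffP /differentiable_continuous].
Qed.

Definition fiber (m : plane R -> R) p : plane R := (p.1, expR (m (p.1, ln p.2))).

Lemma fiber_smooth (m : plane R -> R) : (forall n, Ck n setT m) -> smooth_map upper (fiber m).
Proof.
move=> sm n; have o := @open_upper R; split; first exact: Ck_fst.
have Io : open [set x : R | 0 < x] by exact: open_gt.
have Cl : Ck n upper (fun p => ln p.2).
  by apply: (CkR_comp o Io _ (CkR_ln n) (Ck_snd n o)).
have Cm := @Ck_comp R n upper setT m (fun p => (p.1, ln p.2)) o oT (fun _ _ => I) (sm n) (Ck_fst n o) Cl.
exact: (CkR_comp o openT (fun _ _ => I) (CkR_exp n) Cm).
Qed.

(** Vertical lines are preserved and the bottom side is fixed, so monotonicity
    on the lines keeps the triangle invariant. In the density, the ratio of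
    heights is bounded because mu differs from s by at most B, and the vertical
    derivative by C1. *)
Lemma fiber_diffeo : exists F, ideal_diffeo (fiber mu) F.
Proof.
have [nu' Hnu'] := choice (fun p : plane R => mu_surj p.1 p.2).
pose nu : plane R -> R := nu'.
have munu x t : mu (x, nu (x, t)) = t by exact: (Hnu' (x, t)).
have mono := fiber_increasing mu_gradient mus_gt0.
have numu x s : nu (x, mu (x, s)) = s.
  apply/eqP; apply: contraT; rewrite neq_lt => /orP[] /(mono x); by rewrite munu ltxx.
have nu_smooth := fiber_inverse_smooth mu_gradient mus_gt0 munu mu_smooth.
exists (fiber nu).
have o := @open_upper R.
have key (m : plane R -> R) p : (forall x s, 0 <= x <= 1 -> expR (2 * s) <= x - x ^+ 2 -> m (x, s) = s) ->
    (forall x s t, s <= t -> m (x, s) <= m (x, t)) -> ideal p -> ideal (fiber m p).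
  move=> fix_m mono_m /ideal_sideP[y0 s0].
  have := s0 i0; have := s0 i1; have := s0 i2; rewrite /side /= => h2 h1 h0.
  apply/ideal_sideP; split; first exact: expR_gt0.
  apply: ord3P; rewrite /side //=.
  have [d0|d0] := leP (p.1 - p.1 ^+ 2) 0; first by have := sqr_ge0 (expR (m (p.1, ln p.2))); lra.
  (* The logarithmic height of the bottom side on the vertical line through p,
     where m is the identity. *)
  pose s := 2^-1 * ln (p.1 - p.1 ^+ 2).
  have es : expR (2 * s) = p.1 - p.1 ^+ 2 by rewrite /s mulrA divff // mul1r lnK.
  have ms : m (p.1, s) = s by apply: fix_m; [apply/andP; split; lra|rewrite es].
  have sle : s <= ln p.2.
    suff : 2 * s <= 2 * ln p.2 by lra.
    by rewrite -ler_expR es expRM_natl lnK // ; lra.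
  have := mono_m p.1 _ _ sle; rewrite ms => h.
  have : expR (2 * s) <= expR (2 * m (p.1, ln p.2)) by rewrite ler_expR; lra.
  by rewrite es expRM_natl; lra.
have mu_le x s t : s <= t -> mu (x, s) <= mu (x, t).
  by rewrite le_eqVlt => /predU1P[->//|/(mono x)/ltW].
have nu_le x s t : s <= t -> nu (x, s) <= nu (x, t).
  move=> st; rewrite leNgt; apply/negP => /(mono x); rewrite !munu; lra.
have mu_fix x s : 0 <= x <= 1 -> expR (2 * s) <= x - x ^+ 2 -> mu (x, s) = s.
  by move=> ? ?; exact: mu_fixed.
have nu_fix x s : 0 <= x <= 1 -> expR (2 * s) <= x - x ^+ 2 -> nu (x, s) = s.
  by move=> h1 h2; rewrite -{1}(mu_fix x s h1 h2) numu.
split.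
  split.
  - by split=> p; exact: key.
  - by move=> [x y] /ideal_y /= y0; rewrite /fiber /= expRK numu lnK.
  - by move=> [x y] /ideal_y /= y0; rewrite /fiber /= expRK munu lnK.
  - exact: (smooth_map_on o (@ideal_upper R) (fiber_smooth mu_smooth)).
  - exact: (smooth_map_on o (@ideal_upper R) (fiber_smooth nu_smooth)).
have [C0 C00 HC0] := @step_derive_bound R.
set Q := expR M * (C0 / e * (2 * B)).
exists (expR (2 * B) + Q ^+ 2 + C1 ^+ 2).
  by rewrite !addr_ge0 ?sqr_ge0 ?expR_ge0.
move=> p n; have y0 := ideal_y (nbhs_singleton n).
pose L (q : plane R) : plane R := (q.1, ln q.2).
have Gl := has_gradient_comp1 (is_derive1_ln y0) (has_gradient_snd p).
have Gm : has_gradient (mu \o L) p (mux (L p)) (mus (L p) / p.2).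
  have := @has_gradient_comp R mu L p _ _ _ _ _ _ (mu_gradient (L p)) (has_gradient_fst p) Gl.
  by congr has_gradient; ring.
have GF := @has_gradient_comp1 R expR (mu \o L) p _ _ _ (is_derive_expR (mu (L p))) Gm.
do 4!eexists; split; [exact: has_gradient_fst|exact: GF|].
set E := expR (mu (L p)); have E0 : 0 < E by exact: expR_gt0.
have FE : (fiber mu p).2 = E by [].
rewrite FE expr1n expr0n addr0.
have m1 : p.2 ^+ 2 <= expR (2 * B) * E ^+ 2.
  have -> : p.2 ^+ 2 = expR (2 * (L p).2) by rewrite /= expRM_natl lnK.
  rewrite /E -expRM_natl -expRD ler_expR.
  by have := mu_bounded (L p); rewrite ler_norml => /andP[? ?]; lra.
have m2 : (p.2 * mux (L p)) ^+ 2 <= Q ^+ 2.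
  have h := mux_bound (L p) HC0; rewrite /= lnK // -/Q in h.
  have h' : `|p.2 * mux (L p)| <= Q by rewrite normrM gtr0_norm.
  by rewrite -real_normK ?num_real // ler_pXn2r ?nnegrE ?(le_trans (normr_ge0 _) h').
have m3 : mus (L p) ^+ 2 <= C1 ^+ 2.
  have /andP[h1 h2] := mus_itv (L p); have h0 := mus_gt0 (L p).
  by rewrite ler_pXn2r ?nnegrE //; lra.
have E2 : 0 <= E ^+ 2 by exact: sqr_ge0.
rewrite (_ : _ * _ = p.2 ^+ 2 + (p.2 * mux (L p)) ^+ 2 * E ^+ 2 + mus (L p) ^+ 2 * E ^+ 2); last first.
  by field; rewrite gt_eqF.
have n2 := ler_wpM2r E2 m2; have n3 := ler_wpM2r E2 m3.
apply: (le_trans (lerD (lerD m1 n2) n3)).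
by rewrite !mulrDl.
Qed.

Lemma fiber_side1 p : ideal_edge i1 p ->
  ideal_edge i1 (fiber mu p) /\ busemann i2 (fiber mu p) = kappa (busemann i2 p).
Proof.
move=> [ip sp]; have [F [[[H _] _ _ _ _] _]] := fiber_diffeo.
split; first by split; [exact: H|].
rewrite /busemann !height2 /fiber /= expRK /mu /=.
by rewrite (sp : p.1 = 0) weight0 mul1r addrC subrK.
Qed.

Lemma fiber_side0 p : ideal_edge i0 p ->
  ideal_edge i0 (fiber mu p) /\ busemann i2 (fiber mu p) = k (busemann i2 p).
Proof.
move=> [ip sp]; have [F [[[H _] _ _ _ _] _]] := fiber_diffeo.
split; first by split; [exact: H|].
rewrite /busemann !height2 /fiber /= expRK /mu /=.
rewrite weight_ge ?mul0r ?addr0 //.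
have -> : p.1 = 1 by move: sp; rewrite /side /=; lra.
by rewrite -expR0 ler_expR oppr_le0 mulr_ge0.
Qed.

Lemma fiber_side2 p : ideal_edge i2 p -> fiber mu p = p.
Proof.
move=> [ip]; have y0 := ideal_y ip; have /ideal_sideP[_ s] := ip.
have := s i0; have := s i1; rewrite /side /= => h1 h0 h2.
rewrite /fiber mu_fixed /=; first by rewrite lnK // -surjective_pairing.
  by apply/andP; split; lra.
by rewrite expRM_natl lnK //; lra.
Qed.

End OneMap.

(** For the cusp at infinity this is [fiber mu], with kappa on the side x = 0
    and k on the side x = 1. *)
Lemma cusp_map c : forall l k kappa, line_diffeo 0 l k -> line_diffeo 0 l kappa ->
  (forall s, s <= 0 -> k s = s) ->
  exists F F' : plane R -> plane R, [/\ ideal_diffeo F F',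
    forall p, ideal_edge (nxt (nxt c)) p ->
      ideal_edge (nxt (nxt c)) (F p) /\ busemann c (F p) = kappa (busemann c p),
    forall p, ideal_edge (nxt c) p ->
      ideal_edge (nxt c) (F p) /\ busemann c (F p) = k (busemann c p) &
    forall p, ideal_edge c p -> F p = p].
Proof.
move: c; apply: rot_ind => [l k kappa Lk Lkappa k0|c IH l k kappa Lk Lkappa k0].
  have [_ [c1 [C1 [c10 H1]]] [M1 M10 [k1 k2]]] := Lk.
  have [_ [c2 [C2 [c20 H2]]] [M2 M20 [ka1 ka2]]] := Lkappa.
  have [B1 B10 HB1] := ld_bounded Lk; have [B2 B20 HB2] := ld_bounded Lkappa.
  pose M := Num.max M1 M2; pose B := Num.max B1 B2; pose cc := Num.min c1 c2; pose CC := Num.max C1 C2.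
  have M0 : 0 <= M by rewrite le_max M10.
  have mM1 : M1 <= M by rewrite le_max lexx.
  have mM2 : M2 <= M by rewrite le_max lexx orbT.
  have kN s : s <= - M -> kappa s = s by move=> h; rewrite ka1 ?addr0 //; lra.
  have kM s : M <= s -> kappa s = k s by move=> h; rewrite ka2 ?k2 //; lra.
  have b1 s : `|k s - s| <= B by apply: le_trans (HB1 s) _; rewrite le_max lexx.
  have b2 s : `|kappa s - s| <= B by apply: le_trans (HB2 s) _; rewrite le_max lexx orbT.
  have cc0 : 0 < cc by rewrite lt_min c10 c20.
  have d1 s : cc <= derive1 k s <= CC.
    have /andP[h1 h2] := H1 s; apply/andP; split; first by apply: le_trans h1; rewrite ge_min lexx.
    by apply: le_trans h2 _; rewrite le_max lexx.
  have d2 s : cc <= derive1 kappa s <= CC.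
    have /andP[h1 h2] := H2 s; apply/andP; split; first by apply: le_trans h1; rewrite ge_min lexx orbT.
    by apply: le_trans h2 _; rewrite le_max lexx orbT.
  have [F D] := fiber_diffeo Lk Lkappa k0 kN kM b1 b2 cc0 d1 d2.
  exists (fiber (mu M k kappa)), F; split=> // p.
  - exact: (fiber_side1 Lk Lkappa k0 kN kM b1 b2 cc0 d1 d2).
  - exact: (fiber_side0 Lk Lkappa k0 M0 kN kM b1 b2 cc0 d1 d2).
  - exact: (fiber_side2 k0 kN).
have [F [F' [D E1 E2 E3]]] := IH l k kappa Lk Lkappa k0.
have Dr := @ideal_diffeo_rot R; have Dr2 := @ideal_diffeo_rot2 R.
exists (rot \o (F \o (rot \o rot))), ((rot \o F') \o (rot \o rot)).
have tr i p : ideal_edge (nxt i) p -> ideal_edge i (rot (rot p)) /\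
    forall j, busemann (nxt j) p = busemann j (rot (rot p)).
  move=> [ip sp]; have u := ideal_upper ip.
  have [p' up' [Ep ip' hp' sp']] := rot_preimage u.
  have -> : rot (rot p) = p' by rewrite -Ep rotK.
  by split; [split; [exact: ip'|apply/sp']|move=> j; rewrite /busemann hp'].
have back i q : ideal_edge i q -> ideal_edge (nxt i) (rot q).
  move=> [iq sq]; split; first exact: rot_ideal.
  by rewrite rot_side ?sq ?mul0r //; exact: ideal_upper.
split.
- have := ideal_diffeo_comp (ideal_diffeo_comp Dr2 D) Dr; exact.
- move=> p /tr[ep bp] /=; have [e b] := E1 _ ep; split; first exact: back.
  by rewrite bp -b /busemann rot_height //; apply: ideal_upper; exact: e.1.
- move=> p /tr[ep bp] /=; have [e b] := E2 _ ep; split; first exact: back.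
  by rewrite bp -b /busemann rot_height //; apply: ideal_upper; exact: e.1.
- move=> p ep; have [e b] := tr _ _ ep; rewrite /= E3 // rotK //.
  by apply: ideal_upper; exact: ep.1.
Qed.

Lemma busemann_edge i p : ideal_edge i p ->
  busemann (nxt (nxt i)) p = - busemann (nxt i) p.
Proof.
move=> [ip sp]; have y0 := ideal_y ip.
have [h _] : side i p = 0 <-> height (nxt i) p * height (nxt (nxt i)) p = 1.
  by apply: side_eq0P => //; rewrite eq_sym ?nxt_neq ?nxt2_neq.
have E := h sp; apply/eqP; rewrite -addr_eq0 /busemann -lnM ?posrE ?height_gt0 //.
by rewrite mulrC E ln1.
Qed.

(** Three cusp maps are composed. Each side is moved by two of them, through the
    function k of one end and the function kappa of the other. The functions k
    are chosen freely with the translations l at the cusps; then each kappa is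
    determined by h and the k of the other end. The translations required of h
    near the two ends of a side are what makes kappa the identity near -oo and
    the translation by l near +oo. *)
Lemma triangle_extension (l : 'I_3 -> R) (h : 'I_3 -> R -> R) :
  (forall j, line_diffeo (- l (nxt (nxt j))) (l (nxt j)) (h j)) ->
  exists H H' : plane R -> plane R, ideal_diffeo H H' /\
    forall j p, ideal_edge j p -> ideal_edge j (H p) /\
      busemann (nxt j) (H p) = h j (busemann (nxt j) p).
Proof.
move=> Lh.
have [k Hk] := choice (fun j => @ld_step R (l j)).
have Lk j : line_diffeo 0 (l j) (k j) by case: (Hk j).
have k0 j s : s <= 0 -> k j s = s by case: (Hk j) => _; apply.
(* The function k of a cusp, read in the parameter of the side that increases
   toward the other end. *)
pose kr j s := - k j (- s).
have Lr j : line_diffeo (- l j) 0 (kr j) by have := ld_reflect (Lk j); rewrite oppr0.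
have [g Hg] := choice (fun j => ld_inverse (Lr j)).
have Lg j : line_diffeo (l j) 0 (g j) by case: (Hg j); rewrite opprK oppr0.
have krg j t : kr j (g j t) = t by case: (Hg j).
have gkr j t : g j (kr j t) = t by case: (Hg j).
pose ka0 s := g i1 (h i2 s); pose ka1 s := g i2 (h i0 s); pose ka2 s := h i1 (g i0 s).
have La0 : line_diffeo 0 (l i0) ka0.
  by have := ld_comp (Lh i2) (Lg i1); rewrite addNr addr0.
have La1 : line_diffeo 0 (l i1) ka1.
  by have := ld_comp (Lh i0) (Lg i2); rewrite addNr addr0.
have La2 : line_diffeo 0 (l i2) ka2.
  by have := ld_comp (Lg i0) (Lh i1); rewrite addrN add0r.
have [F0 [F0' [D0 A0 B0 C0]]] := cusp_map i0 (Lk i0) La0 (k0 i0).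
have [F1 [F1' [D1 A1 B1 C1]]] := cusp_map i1 (Lk i1) La1 (k0 i1).
have [F2 [F2' [D2 A2 B2 C2]]] := cusp_map i2 (Lk i2) La2 (k0 i2).
exists (F2 \o (F1 \o F0)), ((F0' \o F1') \o F2'); split.
  exact: (ideal_diffeo_comp (ideal_diffeo_comp D0 D1) D2).
apply: ord3P => p ep /=.
- rewrite (C0 _ ep); have [e1 b1] := A1 _ ep; have [e2 b2] := B2 _ e1; split=> //.
  have n2 := busemann_edge e2; have n1 := busemann_edge e1; rewrite /= in n1 n2 b1 b2 *.
  have -> : busemann i1 (F2 (F1 p)) = - busemann i2 (F2 (F1 p)) by rewrite n2 opprK.
  by rewrite b2 n1 b1 -/(kr i2 _) krg.
- have [e1 b1] := B0 _ ep; rewrite (C1 _ e1); have [e2 b2] := A2 _ e1; split=> //.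
  have n1 := busemann_edge e1; have n := busemann_edge ep; rewrite /= in n n1 b1 b2 *.
  rewrite b2 /ka2; congr h.
  have -> : busemann i2 (F0 p) = kr i0 (busemann i2 p).
    by rewrite /kr -n -b1 n1 opprK.
  by rewrite gkr.
- have [e1 b1] := A0 _ ep; have [e2 b2] := B1 _ e1; rewrite (C2 _ e2); split=> //.
  have n1 := busemann_edge e1; have n2 := busemann_edge e2; rewrite /= in n1 n2 b1 b2 *.
  have -> : busemann i0 (F1 (F0 p)) = - busemann i1 (F1 (F0 p)) by rewrite n2 opprK.
  by rewrite b2 n1 b1 -/(kr i1 _) krg.
Qed.

End FiberMap.

(** * Finite area and finite energy *)

Section Area.
Context {R : realType}.
Implicit Types (p q : plane R).
Local Notation ideal := (@ideal_triangle R).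
Local Notation leb := (@lebesgue_measure R).
Local Notation area := (leb \x leb)%E.

Import HBNNSimple.

(** The integral of a nonnegative function is a supremum over the simple
    functions below it, hence monotone on all functions. It is applied to energy
    densities, for which measurability would need an argument of its own. *)
Lemma ge0_integral_mono d (T : measurableType d) (mu : {measure set T -> \bar R})
    (D D' : set T) (f g : T -> \bar R) :
  (forall x, D x -> (0 <= f x)%E) -> (forall x, D' x -> (0 <= g x)%E) ->
  (forall x, ((f \_ D) x <= (g \_ D') x)%E) ->
  (\int[mu]_(x in D) f x <= \int[mu]_(x in D') g x)%E.
Proof.
move=> f0 g0 fg; rewrite !ge0_integralE //.
by apply: ge_ereal_sup => _ [h hf <-]; apply: ereal_sup_ubound; exists h => // x; exact: le_trans (fg x).
Qed.

Let band p : bool := [&& 0 <= p.1, p.1 <= 1, 0 < p.2 & (2^-1) ^+ 2 <= (p.1 - 2^-1) ^+ 2 + p.2 ^+ 2].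
Let mplane := (measurableTypeR R * measurableTypeR R)%type.
Let dens (p : mplane) : \bar R := (if band p then expR (- 2 * ln p.2) else 0)%:E.

Let dens_measurable : measurable_fun setT dens.
Proof.
have m1 : measurable_fun setT (fun p : mplane => p.1 : R) by exact: measurable_fst.
have m2 : measurable_fun setT (fun p : mplane => p.2 : R) by exact: measurable_snd.
apply/measurable_EFinP; apply: measurable_fun_ifT => //.
- apply: measurable_and; first by apply: measurable_fun_ler.
  apply: measurable_and; first by apply: measurable_fun_ler.
  apply: measurable_and; first by apply: measurable_fun_ltr.
  apply: measurable_fun_ler => //; apply: measurable_funD; apply: measurable_funX => //.
  exact: measurable_funB.
- apply: measurableT_comp; first exact: measurable_expR.
  apply: measurable_funM => //; apply: measurableT_comp => //; exact: measurable_ln.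
Qed.

Let dens_ge0 p : (0 <= dens p)%E.
Proof. by rewrite /dens lee_fin; case: ifP => // _; exact: expR_ge0. Qed.

Let expR_ln (y : R) : 0 < y -> expR (- 2 * ln y) = y ^- 2.
Proof.
by move=> y0; rewrite mulNr expRN expRM_natl lnK.
Qed.

(** At height y the triangle lies in two intervals of length of order y ^ 2 / (1
    + y ^ 2), because x (1 - x) <= y ^ 2. *)
Let dens_section (y : R) : (\int[leb]_x dens (x, y) <= ((fun t : R => (8 : R)%:E * (oneDsqr t)^-1%:E)%E \_ `[0%R, +oo[%classic) y)%E.
Proof.
have [y0|y0] := leP y 0.
  rewrite integral0_eq => [|x _]; first by rewrite patchE; case: ifP => // _; rewrite -EFinM lee_fin mulr_ge0 ?invr_ge0 ?oneDsqr_ge1 // (le_trans ler01) ?oneDsqr_ge1.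
  by rewrite /dens /band /= [0 < y]ltNge y0 !andbF.
rewrite patchE (_ : y \in _); last by rewrite inE /= in_itv /= andbT ltW.
have w0 : 0 < oneDsqr y by apply: lt_le_trans (oneDsqr_ge1 y).
(* For x <= 1/2 one has both x <= 2 y ^ 2 and x <= 1/2, hence x (1 + y ^ 2) <=
   4 y ^ 2. *)
pose m := 4 * y ^+ 2 / oneDsqr y.
have m0 : 0 <= m by rewrite !mulr_ge0 ?invr_ge0 ?sqr_ge0 // ltW.
pose c := y ^- 2.
have c0 : 0 <= c by rewrite invr_ge0 sqr_ge0.
pose f1 (x : R) : \bar R := (c%:E * (\1_`[0%R, m] x)%:E)%E.
pose f2 (x : R) : \bar R := (c%:E * (\1_`[1 - m, 1%R] x)%:E)%E.
have mi (A : set R) : measurable A -> measurable_fun setT (fun x => (\1_A x : R)%:E).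
  by move=> mA; apply/measurable_EFinP; exact: measurable_indic.
have i0 (A : set R) (x : R) : (0 <= (\1_A x : R)%:E)%E by rewrite lee_fin.
have mf (A : set R) : measurable A -> measurable_fun setT (fun x => c%:E * (\1_A x : R)%:E)%E.
  by move=> mA; apply: emeasurable_funM; [exact: measurable_cst|exact: mi].
have f0 (A : set R) (x : R) : (0 <= c%:E * (\1_A x : R)%:E)%E by rewrite mule_ge0 ?lee_fin.
have L : (\int[leb]_x dens (x, y) <= \int[leb]_x (f1 x + f2 x))%E.
  apply: ge0_integral_mono => [//|x _|x]; first by rewrite adde_ge0 ?f0.
  rewrite !patch_setT /dens /f1 /f2 -!EFinM -EFinD lee_fin.
  case: ifPn => [/and4P[/= x0 x1 _ xy]|_]; last by rewrite addr_ge0 // mulr_ge0.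
  rewrite expR_ln //= -/c -mulrDr ler_peMr // !indicE.
  have ym : y ^+ 2 * 4 = m * (1 + y ^+ 2) by rewrite /m mulrC divfK // gt_eqF.
  have y2 : 0 < y ^+ 2 by rewrite exprn_gt0.
  have [xh|xh] := leP x 2^-1.
    suff xm : x <= m.
      have -> : x \in `[0%R, m]%classic by rewrite inE /= in_itv /= x0 xm.
      by rewrite lerDl.
    rewrite -(ler_pM2r w0) /oneDsqr -ym.
    have h1 : 0 <= x * (2^-1 - x) by rewrite mulr_ge0 // subr_ge0.
    have h2 : 0 <= y ^+ 2 * (2^-1 - x) by rewrite mulr_ge0 ?subr_ge0 // ltW.
    by move: xy; rewrite !expr2 in h2 *; lra.
  suff xm : 1 - m <= x.
    have -> : x \in `[1 - m, 1%R]%classic by rewrite inE /= in_itv /= xm.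
    by rewrite lerDr.
  rewrite lerBlDr -lerBlDl -(ler_pM2r w0) /oneDsqr -ym.
  have h1 : 0 <= (1 - x) * (x - 2^-1) by rewrite mulr_ge0 ?subr_ge0 // ltW.
  have h2 : 0 <= y ^+ 2 * (x - 2^-1) by rewrite mulr_ge0 ?subr_ge0 // ltW.
  by move: xy; rewrite !expr2 in h2 *; lra.
apply: (le_trans L).
rewrite ge0_integralD //; try (by move=> x _; exact: f0); try exact: mf.
rewrite !ge0_integralZl_EFin //; try (by apply: mi).
rewrite !integral_indic // !setIT.
have E0 : leb `[0%R, m]%classic = m%:E.
  rewrite lebesgue_measure_itv /= lte_fin; case: ltP => [_|m0']; first by rewrite oppr0 adde0.
  by congr _%:E; apply/le_anti; rewrite m0' m0.
have E1 : leb `[1 - m, 1%R]%classic = m%:E.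
  rewrite lebesgue_measure_itv /= lte_fin ltrBlDr ltrDl.
  case: ltP => [_|m0']; first by rewrite -EFinD; congr _%:E; lra.
  by congr _%:E; apply/le_anti; rewrite m0' m0.
rewrite [leLHS](_ : _ = (c%:E * m%:E + c%:E * m%:E)%E); last first.
  by congr (_ * _ + _ * _)%E; [exact: E0|exact: E1].
rewrite -!EFinM -EFinD lee_fin le_eqVlt; apply/orP; left; apply/eqP.
by rewrite /c /m; field; rewrite !gt_eqF.
Qed.

(** By Tonelli's theorem and the integrability of 1 / (1 + y ^ 2). *)
Lemma area_ideal (C : R) : 0 <= C -> (\int[area]_(p in ideal) (C * p.2 ^- 2)%:E < +oo)%E.
Proof.
move=> C0; apply: (@le_lt_trans _ _ (\int[area]_p (C%:E * dens p))%E).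
  apply: ge0_integral_mono => [p _|p _|p].
  - by rewrite lee_fin mulr_ge0 // invr_ge0 sqr_ge0.
  - by rewrite mule_ge0.
  rewrite patch_setT patchE; case: ifPn => [/set_mem [x0 x1 y0 xy]|_]; last by rewrite mule_ge0.
  by rewrite /dens /band x0 x1 y0 xy /= -EFinM lee_fin expR_ln.
rewrite ge0_integralZl_EFin // lte_mul_pinfty //.
have -> : (\int[area]_p dens p = \int[leb]_y \int[leb]_x dens (x, y))%E.
  exact: (fubini_tonelli2 dens dens_measurable dens_ge0).
have m1 : measurable_fun (`[0, +oo[%classic : set (measurableTypeR R)) (fun x : R => (oneDsqr x)^-1%:E).
  apply/measurable_EFinP; apply: measurable_funTS; apply: continuous_measurable_fun.
  exact: continuous_oneDsqrV.
have p0 (x : R) : (0 <= (oneDsqr x)^-1%:E)%E by rewrite lee_fin invr_ge0 (le_trans ler01) // oneDsqr_ge1.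
apply: (@le_lt_trans _ _ (\int[leb]_(y in `[0%R, +oo[) (8%:E * (oneDsqr y)^-1%:E))%E).
  apply: ge0_integral_mono => [y _|y _|y]; first exact: integral_ge0.
    by rewrite mule_ge0 ?lee_fin.
  by rewrite patch_setT; exact: dens_section.
by rewrite ge0_integralZl_EFin // integral0y_oneDsqr -EFinM ltry.
Qed.

Lemma bounded_energy_term w C : (forall p, ideal p -> ideal (w p)) -> bounded_density w C ->
  (\int[area]_(p in ideal^°) (energy_density w p * p.2 ^- 2)%:E < +oo)%E.
Proof.
move=> wi H.
have D0 p : 0 <= energy_density w p.
  apply: mulr_ge0; last by rewrite !addr_ge0 ?sqr_ge0.
  by rewrite mulr_ge0 ?invr_ge0 ?sqr_ge0.
have DC p : nbhs p ideal -> energy_density w p <= `|C|.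
  move=> n; have [a1 [b1 [a2 [b2 [G1 G2 B]]]]] := H p n.
  have z0 : 0 < (w p).2 by apply: ideal_y; apply: wi; exact: nbhs_singleton.
  rewrite /energy_density (has_gradient_dx G1) (has_gradient_dy G1) (has_gradient_dx G2) (has_gradient_dy G2).
  rewrite mulrAC ler_pdivrMr ?exprn_gt0 //; apply: le_trans B _.
  by rewrite ler_wpM2r ?sqr_ge0 // ler_norm.
apply: (@le_lt_trans _ _ (\int[area]_(p in ideal) (`|C| * p.2 ^- 2)%:E)%E); last exact: area_ideal.
  apply: ge0_integral_mono => [p _|p _|p].
  - by rewrite lee_fin mulr_ge0 // invr_ge0 sqr_ge0.
  - by rewrite lee_fin mulr_ge0 // invr_ge0 sqr_ge0.
  rewrite !patchE; case: ifPn => [/set_mem n|_].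
    rewrite mem_set; last exact: nbhs_singleton.
    by rewrite lee_fin ler_wpM2r ?invr_ge0 ?sqr_ge0 // DC.
  by case: ifP => // _; rewrite lee_fin mulr_ge0 // invr_ge0 sqr_ge0.
Qed.

End Area.

(** * Matching two complete metrics *)

Section OrientedSides.
Context {R : realType} (K : gluing_data R).
Implicit Types (p q : plane R) (j : 'I_3) (T : face K).

(** [triangle_extension] with each side parametrized from its origin instead of
    by the cyclic order; reversing the parameter conjugates a side map by the
    reflection of the line. *)
Lemma oriented_extension T (l : 'I_3 -> R) (h : 'I_3 -> R -> R) :
  (forall j, line_diffeo (- l (terminus (T, j))) (l (origin (T, j))) (h j)) ->
  exists H H' : plane R -> plane R, ideal_diffeo H H' /\
    forall j p, ideal_edge j p -> ideal_edge j (H p) /\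
      busemann (origin (T, j)) (H p) = h j (busemann (origin (T, j)) p).
Proof.
move=> Lh.
pose h' j := if nxt j == origin (T, j) then h j else fun x => - h j (- x).
have Lh' j : line_diffeo (- l (nxt (nxt j))) (l (nxt j)) (h' j).
  have L := Lh j; have oj := origin_edge (T, j); rewrite /= in oj.
  move: L; rewrite /h' /terminus /=; have [<- //|ne L] := eqVneq (nxt j).
  have oe : origin (T, j) = nxt (nxt j) by case: (ord3_neq oj) => // e; rewrite e eqxx in ne.
  by rewrite -oe; have := ld_reflect L; rewrite opprK.
have [H [H' [D E]]] := triangle_extension Lh'.
exists H, H'; split=> // j p ep; have [e b] := E j p ep; split=> //.
have oj := origin_edge (T, j); rewrite /= in oj.
move: b; rewrite /h'; have [<- //|ne b] := eqVneq (nxt j).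
have -> : origin (T, j) = nxt (nxt j) by case: (ord3_neq oj) => // e'; rewrite e' eqxx in ne.
by rewrite !busemann_edge // b opprK.
Qed.

End OrientedSides.

Section Matching.
Context {R : realType} {K : complex R} (sigma tau : ideal_metric K).
Implicit Types (A B : face K * 'I_3) (p q : plane R) (i j : 'I_3) (T : face K).
Local Notation punct := (@punctured_triangle R).
Local Notation ideal := (@ideal_triangle R).
Variables (ws wt : face K * 'I_3 -> R).
Hypothesis ws_holonomy : forall c c' r, holonomy sigma c c' r -> ws c' = ws c + r.
Hypothesis wt_holonomy : forall c c' r, holonomy tau c c' r -> wt c' = wt c + r.

Let o A := (A.1, origin A).
Let t A := (A.1, terminus A).
(** The translation that remains at the terminus when the one at the origin is
    normalized to 0. *)
Let stretch A := ws (t A) - wt (t A) - (wt (o A) - ws (o A)).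

(** In the coordinates x - ws and y - wt at the origin, which gluings preserve,
    the map has to be the identity near the origin and the translation by
    [stretch A] near the terminus. Since [stretch] is invariant under gluing,
    one such map can be fixed for each of its values. *)
Lemma side_maps : exists h : face K * 'I_3 -> R -> R,
  (forall A, line_diffeo (- (wt (t A) - ws (t A))) (wt (o A) - ws (o A)) (h A)) /\
  forall A B r r', glued A B -> shift sigma A B r -> shift tau A B r' ->
    forall x, h B (x + r) = h A x + r'.
Proof.
have [E HE] := choice (@ld_interpolate R).
exists (fun A x => E (stretch A) (x - ws (o A)) + wt (o A)); split=> [A|A B r r' g S S' x].
  have := ld_translate (ws (o A)) (wt (o A)) (HE (stretch A)).
  by congr line_diffeo; rewrite /stretch; lra.
have e1 := ws_holonomy (HolOrigin g S); have e2 := ws_holonomy (HolTerminus g S).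
have e3 := wt_holonomy (HolOrigin g S'); have e4 := wt_holonomy (HolTerminus g S').
have -> : stretch B = stretch A by rewrite /stretch /o /t e1 e2 e3 e4; lra.
rewrite -[ws (o B)]/(ws (B.1, origin B)) -[wt (o B)]/(wt (B.1, origin B)) e1 e3 -/(o A).
by rewrite addrA; congr (E _ _ + _ + _); rewrite opprD addrACA subrr addr0.
Qed.

(** On glued sides the extensions agree by the choice of the side maps, as a
    point of a side is determined by its height. In the isometric coordinates
    the map on a face is an extension composed with symmetries of the ideal
    triangle, so its density is bounded. *)
Lemma matching_map : exists H : face K -> plane R -> plane R, simplicial_diffeos sigma tau H.
Proof.
have [h [Lh glue_h]] := side_maps.
have ext T := oriented_extension (l := fun j => wt (T, j) - ws (T, j)) (h := fun j => h (T, j))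
  (fun j => Lh (T, j)).
have [M HM] := choice ext; have [M' HM'] := choice HM.
pose H T := normal_inv tau T \o (M T \o normal sigma T).
have D T : inverse_diffeos punct punct (H T) ((normal_inv sigma T \o M' T) \o normal tau T).
  have [[D1 _] _] := HM' T.
  have [Ds _ _ _] := normal_chart sigma T; have [Dt _ _ _] := normal_chart tau T.
  exact: (inverse_diffeos_comp (inverse_diffeos_comp Ds D1) (inverse_diffeos_sym Dt)).
have Hpunct T p : punct p -> punct (H T p) by have [[+ _] _ _ _ _] := D T; exact.
have Hedge A p : open_edge A.2 p -> open_edge A.2 (H A.1 p) /\
    bus tau A.1 (origin A) (H A.1 p) = h A (bus sigma A.1 (origin A) p).
  case: A => T i /= op; have [_ E] := HM' T.
  have [_ _ side_s _] := normal_chart sigma T; have [_ _ _ side_t] := normal_chart tau T.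
  have [e b] := E i _ (side_s _ _ op); split; first exact: side_t.
  by rewrite /bus /H /= normal_invK //; case: e.
exists H; split.
- split=> [T p|T i p op|x y px py xy]; first exact: Hpunct.
    by have [] := Hedge (T, i) p op.
  apply: glued_identified; have [_ /(_ px)] := identified_glued xy.
  move=> [->|[A [B [p [g op -> ->]]]]]; first by left.
  right; exists A, B, (H A.1 p); have [oH bH] := Hedge A p op.
  split=> //=; congr pair.
  have [r S] := shift_exists sigma g; have [r' S'] := shift_exists tau g.
  have op' := glue_open_edge g op; have [oH' bH'] := Hedge B _ op'.
  apply: (@bus_edge_inj _ _ tau B.1 _ _ _ _ (origin_edge B) oH' (glue_open_edge g oH)).
  by rewrite bH' S // (glue_h _ _ _ _ g S S') S' // bH.
- apply: lte_sum_pinfty => T _.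
  have [D1 _] := HM' T.
  have Df : ideal_diffeo (fc_rho (the_chart tau T) \o (M T \o fc_rho' (the_chart sigma T)))
      ((fc_rho (the_chart sigma T) \o M' T) \o fc_rho' (the_chart tau T)).
    exact: (ideal_diffeo_comp (ideal_diffeo_comp (fc_diffeo' _) D1) (fc_diffeo _)).
  have inside p : ideal p -> ideal (M T (fc_rho' (the_chart sigma T) p)).
    by move=> ip; apply: (ideal_diffeo_image D1); exact: (ideal_diffeo_image (fc_diffeo' _)).
  have E p : ideal p -> (fc_rho (the_chart tau T) \o (M T \o fc_rho' (the_chart sigma T))) p =
      in_coordinates sigma tau H T p.
    move=> ip; have [_ _ us _ _] := uniformize_diffeo sigma T.
    have [_ _ ut _ _] := uniformize_diffeo tau T.
    rewrite /in_coordinates /H /normal /normal_inv /= us // ut //.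
    exact: (ideal_diffeo_image (fc_diffeo _) (inside _ ip)).
  have [_ [C C0 B]] := Df.
  apply: (bounded_energy_term _ (bounded_density_eq E B)) => p ip.
  by rewrite -E //; exact: (ideal_diffeo_image Df).
- by move=> T; exists ((normal_inv sigma T \o M' T) \o normal tau T).
Qed.

End Matching.

Theorem theorem16 (R : realType) (K : complex R) (sigma tau : ideal_metric K)
  (sigma_complete : complete_metric sigma) (tau_complete : complete_metric tau) :
  exists H : face K -> plane R -> plane R, simplicial_diffeos sigma tau H.
Proof.
have [ws Hs] := complete_potential sigma_complete.
have [wt Ht] := complete_potential tau_complete.
exact: matching_map Hs Ht.
Qed.
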